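(* Under Conditions 1–3 stated in the context, for some constant $c_0>0$, $$P(\mathcal M_*\subseteq\mathcal M_\delta)=1-O\big[\exp\{-c_0n^{1-\iota}/\log n\}\big]\quad\text{as }n\to\infty,$$ where $\iota=2\kappa+2u+t+s<1$ is the constant in Condition 3.
   Context: Setting: $Y=XB+E$ with $Y$ an $n\times m$ response matrix, $X$ an $n\times p$ random predictor matrix with columns $\mathbf x^1,\dots,\mathbf x^p$, $B=[\mathbf b_1,\dots,\mathbf b_p]^{\intercal}$ a $p\times m$ coefficient matrix, and $E$ an $n\times m$ mean-zero error matrix; $p>n$ and $m<n$; dimensions and parameters may depend on $n$. Let $\mathcal M_*=\{k:\mathbf b_k\ne\mathbf 0,\ 1\le k\le p\}$. Canonical correlation screening: for $j=1,\dots,p$ let $$\omega_j=\max_{\mathbf a\in\mathbb R^m}\frac{\mathbf a^{\intercal}(Y-\mathbf 1_n\bar Y)^{\intercal}(\mathbf x^j-\bar x^j\mathbf 1_n)}{\sqrt{\{\mathbf a^{\intercal}(Y-\mathbf 1_n\bar Y)^{\intercal}(Y-\mathbf 1_n\bar Y)\mathbf a\}\{(\mathbf x^j-\bar x^j\mathbf 1_n)^{\intercal}(\mathbf x^j-\bar x^j\mathbf 1_n)\}}},$$ where $\bar x^j$ is the mean of the entries of $\mathbf x^j$, $\bar Y$ is the row mean vector of $Y$ (the $1\times m$ average of the rows of $Y$), $\mathbf 1_n$ is the all-one column vector, and the maximum is over nonzero $\mathbf a$. For $0<\delta<1$ ($\delta$ may depend on $n$), $\mathcal M_\delta=\{j: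 |\omega_j|\text{ is among the largest }\lfloor\delta p\rfloor\text{ of all},\ 1\le j\le p\}$. Condition 1. The rows of $X$ and $E$ independently follow multivariate Gaussian distributions with covariance matrices $\Sigma_x$ and $\Sigma$ respectively. There exist nonnegative constants $t,\tau$ and positive constants $c_1,\dots,c_5$ such that $\lambda_{\max}(\Sigma_x)\le c_1n^{\tau}$, $\lambda_{\min}(\Sigma)\ge c_2n^{-t}$, $\min\mathrm{diag}(\Sigma_x)\ge c_3$, $\max\mathrm{diag}(\Sigma)\le c_4$ and $\max\mathrm{diag}(B^{\intercal}\Sigma_xB)\le c_5$. (Here $\lambda_{\max},\lambda_{\min}$ are the largest and smallest eigenvalues, and $\min\mathrm{diag},\max\mathrm{diag}$ the minimum and maximum diagonal elements.) Condition 2. For some constants $\kappa,u$, $c_6>0$ and $c_7>0$, and for each fixed $i\in\mathcal M_*$, there exists $\mathbf a_{0,i}\in\mathbb R^m$ with $\|\mathbf a_{0,i}\|=1$ such that $\max\{\|\Sigma_x^{1/2}B\mathbf a_{0,i}\|,\|\Sigma^{1/2}\mathbf a_{0,i}\|\}\le c_6n^{u}$ and $|e_i^{\intercal}\Sigma_xB\mathbf a_{0,i}|\,\sigma_{x,i}^{-1}\ge c_7n^{-\kappa}$, where $\sigma_{x,i}^2$ is the $i$-th diagonal element of $\Sigma_x$, $e_i$ is the $i$-th standard basis vector and $\|\cdot\|$ is the $\ell_2$-norm. Condition 3. $m=O(n^{s})$ with $0\le s<1$; $\iota+\tau<1$, where $\iota=2\kappa+2u+t+s$; $p>c_9n$ for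 some constant $c_9>1$; $\log p=O(n^{\pi})$ for some constant $\pi\in(0,1-2\kappa-2u-t-s)$; and $\delta n^{1-\iota-\tau}\to\infty$ as $n\to\infty$. *)

(* Defs.v *)
From HB Require Import structures.
From mathcomp Require Export all_boot all_order all_algebra.
From mathcomp Require Export all_classical all_reals all_analysis.
Export Order.TTheory GRing.Theory Num.Theory.
Export numFieldNormedType.Exports.

Set Implicit Arguments.
Unset Strict Implicit.
Unset Printing Implicit Defensive.

Local Open Scope classical_set_scope.
Local Open Scope ring_scope.

Section Matrices.
Variable R : realType.

Definition psdmx k (A : 'M[R]_k) : Prop :=
  A^T = A /\ forall v : 'cV[R]_k, 0 <= (v^T *m A *m v) 0 0.

(* A^{1/2}: the unique positive semidefinite square root of A; it exists for
   every positive semidefinite A, and the default value 0 is irrelevant then. *)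
Definition mxsqrt k (A : 'M[R]_k) : 'M[R]_k :=
  xget 0 [set S : 'M[R]_k | psdmx S /\ S *m S = A].

(* The Euclidean norm: the library norm on matrices is the sup norm. *)
Definition l2norm k (v : 'cV[R]_k) : R := Num.sqrt (\sum_i v i 0 ^+ 2).

(* For a symmetric matrix of positive size the spectrum and the diagonal are
   finite and nonempty, so the sup and inf below are a max and a min. *)
Definition lambda_max k (A : 'M[R]_k) : R := sup [set a | eigenvalue A a].
Definition lambda_min k (A : 'M[R]_k) : R := inf [set a | eigenvalue A a].
Definition max_diag k (A : 'M[R]_k) : R := sup (range (fun i => A i i)).
Definition min_diag k (A : 'M[R]_k) : R := inf (range (fun i => A i i)).

End Matrices.

Section Probability.
Context (R : realType) (d : measure_display) (T : measurableType d).
Variable P : probability T R.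

(* N(mu, v) on the line, v being the variance. The case v = 0 is the Dirac mass
   at mu, which [normal_prob] does not cover: with standard deviation 0 it is
   uniform on [0, 1]. *)
Definition gaussian_prob (mu v : R) (A : set R) : \bar R :=
  if v == 0 then \d_mu A else normal_prob mu (Num.sqrt v) A.

(* V ~ N(mu, S), with S possibly singular: every linear combination of the
   coordinates of V is normal with the corresponding mean and variance. *)
Definition mvgaussian k (V : T -> 'rV[R]_k) (mu : 'rV[R]_k) (S : 'M[R]_k)
    : Prop :=
  [/\ psdmx S,
      forall j, measurable_fun setT (fun w => V w 0 j)
    & forall (a : 'cV[R]_k) (A : set R), measurable A ->
        P [set w | A ((V w *m a) 0 0)]
        = gaussian_prob ((mu *m a) 0 0) ((a^T *m S *m a) 0 0) A].

(* The sigma-algebra on T generated by the random vector V. *)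
Definition sigma_vector k (V : T -> 'rV[R]_k) : set (set T) :=
  g_sigma_preimage (fun (j : 'I_k) (w : T) => V w 0 j).

Definition mutual_independence (I : finType) (F : I -> set (set T)) : Prop :=
  forall (J : {set I}) (A : I -> set T),
    (forall i, i \in J -> F i (A i)) ->
    P (\bigcap_(i in [set` J]) A i) = (\prod_(i in J) P (A i))%E.

(* The n rows of X and the n rows of E are 2n independent random vectors. *)
Definition independent_rows n p m
    (X : T -> 'M[R]_(n, p)) (E : T -> 'M[R]_(n, m)) : Prop :=
  mutual_independence (fun i : 'I_n + 'I_n =>
    match i with
    | inl i => sigma_vector (fun w => row i (X w))
    | inr i => sigma_vector (fun w => row i (E w))
    end).

End Probability.

Section Screening.
Variable R : realType.

Definition row_mean n q (A : 'M[R]_(n, q)) : 'rV[R]_q :=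
  n%:R^-1 *: \sum_i row i A.

Definition center_cols n q (A : 'M[R]_(n, q)) : 'M[R]_(n, q) :=
  A - (const_mx 1 : 'cV[R]_n) *m row_mean A.

(* The maximum over a != 0 is written as a supremum; it is attained when m > 0.
   Quotients with a zero denominator are 0; the numerator is then 0 as well. *)
Definition cancor n m (Y : 'M[R]_(n, m)) (x : 'cV[R]_n) : R :=
  sup [set (a^T *m (center_cols Y)^T *m center_cols x) 0 0
           / Num.sqrt ((a^T *m ((center_cols Y)^T *m center_cols Y) *m a) 0 0
                       * ((center_cols x)^T *m center_cols x) 0 0)
      | a in [set a : 'cV[R]_m | a != 0]].

Definition active p m (B : 'M[R]_(p, m)) : {set 'I_p} :=
  [set k | row k B != 0]%SET.

(* The j such that `|om j| is among the [D] largest of all, i.e. fewer than [D]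
   of the values are strictly larger; ties are all kept. *)
Definition top_indices p (om : 'I_p -> R) (D : nat) : {set 'I_p} :=
  [set j | (#|[set k | (`|om j| < `|om k|)%R]%SET| < D)%N]%SET.

Definition screened n p m (X : 'M[R]_(n, p)) (Y : 'M[R]_(n, m)) (delta : R)
    : {set 'I_p} :=
  top_indices (fun j => cancor Y (col j X)) (Num.truncn (delta * p%:R)).

End Screening.

(* Main.v *)
(* Let r_n = (c7 / c6) n^(- kappa - u).  Testing the maximum that defines omega_i
   on a_{0,i}, a Bernstein bound over the n independent rows and Gaussian tail
   bounds for the centering terms give omega_i >= r_n / 32 for every active i,
   outside an event of probability O(exp (- c n r_n^2)) per predictor.  On the
   other hand omega_j^2 is at most |Q x_j|^2 / |x_j|^2, where Q projects onto the
   column space of the centered Y and has rank at most m.  Hence the sum over j of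
   omega_j^2 is at most m times the squared operator norm of the centered X,
   divided by the least squared column norm, and a union bound over integer grid
   points makes this O(m p lambda_max / n).  So fewer than m p lambda_max / (n r_n^2)
   indices, up to a constant, reach the level r_n / 32; by Condition 3 this is
   eventually less than floor (delta p), and log p = O(n^pi) absorbs the union
   bound over the p predictors. *)
Require Import Defs.
From mathcomp Require Import sesquilinear spectral complex.
From mathcomp Require Import measurable_realfun.
From mathcomp Require Import ring lra.

Set Implicit Arguments.
Unset Strict Implicit.
Unset Printing Implicit Defensive.
Local Open Scope classical_set_scope.
Local Open Scope ring_scope.

(** * Symmetric matrices *)

(** Three obstacles shape the proof. Independence is a property of sigma-algebras on an abstract
    space, with no product structure to integrate over; expectations of products are therefore
    factored one factor at a time by the layer cake formula, for nonnegative functions only. The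
    cross products of the rows involve correlated Gaussian variables; the Bernstein bound uses only
    their mean and a bound on E exp (|y| / 8), which follows from exponential moments of squares.
    Finally [cancor] is a supremum over uncountably many directions, so the measurability of the
    screening event needs its own argument.

    Every event is brought to one failure probability exp (- n r^2 / (16 C)), with C the constant
    [bernstein_const]; r <= 1 makes it the weakest of the bounds. This r <= 1 is forced:
    Cauchy-Schwarz for the form of Sigma_x gives it as soon as one predictor is active, and with
    none the inclusion is trivial. The exponent n r_n^2 is of order n^(1 - 2 kappa - 2 u), at least
    n^(1 - iota) up to a constant, and half of it pays for the factor p. *)

Lemma horner_mx_diagonalization (F : fieldType) k (U : 'M[F]_k.+1) (D : 'rV[F]_k.+1)
    (q : {poly F}) : U \in unitmx ->
  horner_mx (invmx U *m diag_mx D *m U) q = invmx U *m diag_mx (\row_i q.[D 0 i]) *m U.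
Proof.
move=> Uunit; rewrite horner_mx_uconjC// horner_mx_diag.
by congr (_ *m diag_mx _ *m _); apply/rowP => i; rewrite !mxE.
Qed.

Section SymmetricMatrices.
Variable R : realType.

Local Notation toC := (real_complex R).

(** Over the complex numbers the matrix is Hermitian, hence unitarily diagonalizable with real
    eigenvalues. [W v i] is the squared modulus of the i-th coordinate of [v] in the complex
    eigenbasis; stating everything through these weights keeps the result real without constructing
    a real eigenbasis. *)
Lemma symmetric_functional_calculus k (A : 'M[R]_k.+1) : A^T = A ->
  exists (d : 'I_k.+1 -> R) (W : 'cV[R]_k.+1 -> 'I_k.+1 -> R),
    [/\ forall i, eigenvalue A (d i),
        forall v i, 0 <= W v i,
        forall v (q : {poly R}),
          (v^T *m horner_mx A q *m v) 0 0 = \sum_i q.[d i] * W v i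
      & forall q : {poly R}, (forall i, q.[d i] = 0) -> horner_mx A q = 0].
Proof.
move=> Asym.
pose AC := map_mx toC A.
have ACsym : AC \is symmetricmx.
  by apply/is_hermitianmxP; rewrite expr0 scale1r map_mx_id// /AC map_trmx Asym.
have ACreal : AC \is a mxOver Num.real.
  by apply/mxOverP => i j; rewrite mxE; apply/complex_realP; eexists.
have ACherm := realsym_hermsym ACsym ACreal.
have /orthomx_spectralP AE := hermitian_normalmx ACherm.
have /mxOverP Dreal := hermitian_spectral_diag_real ACherm.
set U := spectralmx AC in AE; set D := spectral_diag AC in AE Dreal.
have Uunit : U \in unitmx := spectral_unit AC.
have Uunitary : U \is unitarymx := spectral_unitarymx AC.
pose d i := Re (D 0 i).
have dE i : toC (d i) = D 0 i by apply: RRe_real; exact: Dreal.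
have qE (q : {poly R}) : map_mx toC (horner_mx A q) =
    invmx U *m diag_mx (\row_i toC q.[d i]) *m U.
  rewrite (_ : \row_i _ = \row_i (map_poly toC q).[D 0 i]); last first.
    by apply/rowP => i; rewrite !mxE -dE horner_map.
  rewrite -(horner_mx_diagonalization _ _ Uunit); apply: etrans (map_horner_mx _ _ _) _.
  exact: (congr1 (fun M => horner_mx M _) AE).
pose w (v : 'cV[R]_k.+1) : 'cV[R[i]]_k.+1 := U *m map_mx toC v.
exists d, (fun v i => Re (w v i 0 * (w v i 0)^*%C)); split.
- move=> i; rewrite -(eigenvalue_map toC) -/AC [X in eigenvalue _ X](dE i).
  apply/eigenvalueP; exists (row i U).
    rewrite {1}AE -row_mul mulmxA mulKVmx// row_mul row_diag_mx.
    by rewrite -scalemxAl -rowE.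
  apply/eqP => r0; have : row i U *m invmx U = 0 by rewrite r0 mul0mx.
  rewrite -row_mul mulmxV// => /rowP/(_ i); rewrite !mxE eqxx/= => /eqP.
  by rewrite oner_eq0.
- by move=> v i; have := mulcJ_ge0 (w v i 0); rewrite lecE => /andP[].
- move=> v q; apply: (@complexI R).
  have -> : toC ((v^T *m horner_mx A q *m v) 0 0) =
      (map_mx toC (v^T *m horner_mx A q *m v)) 0 0 by rewrite [RHS]mxE.
  rewrite !map_mxM qE invmx_unitary// !mulmxA -mulmxA -/(w v).
  have -> : map_mx toC v^T *m map_mx Num.conj U^T = (map_mx conjc (w v))^T.
    rewrite /w map_mxM trmx_mul/=; congr (_ *m _); last by rewrite map_trmx.
    apply/matrixP => i j; rewrite !mxE; exact/esym/conjc_real.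
  rewrite mxE rmorph_sum; apply: eq_bigr => i _ /=.
  rewrite mul_mx_diag !mxE rmorphM/= RRe_real; last exact/ger0_real/mulcJ_ge0.
  by rewrite mulrC mulrA mulrC.
- move=> q q0; apply: (@map_mx_inj _ _ toC); rewrite qE map_mx0.
  rewrite (_ : \row__ _ = 0); last by apply/rowP => i; rewrite !mxE q0.
  by rewrite (_ : diag_mx 0 = 0) ?mulmx0 ?mul0mx//; apply/matrixP => i j; rewrite !mxE mul0rn.
Qed.

Definition sqnorm k (v : 'cV[R]_k) : R := \sum_i v i 0 ^+ 2.

Lemma dotE k (u v : 'cV[R]_k) : (u^T *m v) 0 0 = \sum_i u i 0 * v i 0.
Proof. by rewrite mxE; apply: eq_bigr => i _; rewrite mxE. Qed.

Lemma sqnormE k (v : 'cV[R]_k) : sqnorm v = (v^T *m v) 0 0.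
Proof. by rewrite dotE; apply: eq_bigr => i _; rewrite expr2. Qed.

Lemma sqnorm_ge0 k (v : 'cV[R]_k) : 0 <= sqnorm v.
Proof. by apply: sumr_ge0 => i _; rewrite sqr_ge0. Qed.

Lemma sqnorm_eq0 k (v : 'cV[R]_k) : sqnorm v = 0 -> v = 0.
Proof.
move=> /eqP; rewrite psumr_eq0 => [/allP v0|i _]; last by rewrite sqr_ge0.
apply/matrixP => i j; rewrite ord1 mxE; apply/eqP.
by rewrite -sqrf_eq0; apply: v0; rewrite mem_index_enum.
Qed.

Lemma sqnorm_gt0 k (v : 'cV[R]_k) : v != 0 -> 0 < sqnorm v.
Proof.
by move=> v0; rewrite lt_neqAle sqnorm_ge0 andbT eq_sym; apply: contra_neq v0 => /sqnorm_eq0.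
Qed.

Lemma sqr_l2norm k (v : 'cV[R]_k) : l2norm v ^+ 2 = sqnorm v.
Proof. by rewrite sqr_sqrtr// sqnorm_ge0. Qed.

Lemma sum_cauchy_schwarz (I : finType) (a b : I -> R) :
  (\sum_i a i * b i) ^+ 2 <= (\sum_i a i ^+ 2) * (\sum_i b i ^+ 2).
Proof.
set C := \sum_i _; set A := \sum_i _; set D := \sum_i _.
have D0 : 0 <= D by apply: sumr_ge0 => i _; exact: sqr_ge0.
have : 0 <= \sum_i (D * a i - C * b i) ^+ 2.
  by apply: sumr_ge0 => i _; exact: sqr_ge0.
have -> : \sum_i (D * a i - C * b i) ^+ 2 = D * (A * D - C ^+ 2).
  transitivity (\sum_i (D ^+ 2 * a i ^+ 2 - 2 * D * C * (a i * b i)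
                        + C ^+ 2 * b i ^+ 2)).
    by apply: eq_bigr => i _; ring.
  by rewrite big_split/= sumrB -!mulr_sumr -/A -/C -/D; ring.
move: D0; rewrite le_eqVlt => /predU1P[D0|D0]; last by rewrite pmulr_rge0// subr_ge0.
move=> _; rewrite -D0 mulr0 (_ : C = 0) ?expr0n//.
apply: big1 => i _; have /eqP := esym D0; rewrite psumr_eq0 => [|j _]; last exact: sqr_ge0.
by move=> /allP/(_ i (mem_index_enum i)); rewrite /= sqrf_eq0 => /eqP ->; rewrite mulr0.
Qed.

Lemma dot_cauchy_schwarz k (u v : 'cV[R]_k) :
  ((u^T *m v) 0 0) ^+ 2 <= sqnorm u * sqnorm v.
Proof. by rewrite dotE; exact: sum_cauchy_schwarz. Qed.

Lemma eigenvalue_quad k (A : 'M[R]_k) a : eigenvalue A a ->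
  exists2 v : 'cV[R]_k, v != 0 & (v^T *m A *m v) 0 0 = a * sqnorm v.
Proof.
move=> /eigenvalueP[v vA v0]; exists v^T; first by rewrite trmx_eq0.
by rewrite trmxK vA -scalemxAl mxE sqnormE trmxK.
Qed.

(** The form is the combination of the eigenvalues [d i] with the weights [W v i], which add up to
    the squared norm. That [lambda_max] dominates each [d i] requires the spectrum to be bounded
    above. *)
Lemma quad_le_lambda_max k (A : 'M[R]_k) (v : 'cV[R]_k) : A^T = A ->
  (v^T *m A *m v) 0 0 <= lambda_max A * sqnorm v.
Proof.
case: k A v => [|k] A v Asym; first by rewrite /sqnorm mxE !big_ord0 mulr0.
have [d [W [dA W0 dW _]]] := symmetric_functional_calculus Asym.
have sqnW u : sqnorm u = \sum_i W u i.
  have := dW u 1; rewrite rmorph1 mulmx1 -sqnormE => ->.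
  by apply: eq_bigr => i _; rewrite hornerC mul1r.
have AW u : (u^T *m A *m u) 0 0 = \sum_i d i * W u i.
  have := dW u 'X; rewrite horner_mx_X => ->.
  by apply: eq_bigr => i _; rewrite hornerX.
rewrite AW sqnW mulr_sumr; apply: ler_sum => i _; apply: ler_wpM2r => //.
apply: ub_le_sup; last exact: dA.
(* Any eigenvalue is a Rayleigh quotient, hence a weighted mean of the [d i]. *)
exists (\sum_i `|d i|) => a /eigenvalue_quad[u u0].
rewrite AW => /esym aE; rewrite -(ler_pM2r (sqnorm_gt0 u0)) aE sqnW.
rewrite mulr_sumr; apply: ler_sum => j _; apply: ler_wpM2r => //.
rewrite (le_trans (ler_norm _))// (bigD1 j)//= lerDl.
by apply: sumr_ge0 => l _.
Qed.

Lemma interpolation_poly (F : fieldType) (f : F -> F) (rs : seq F) :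
  uniq rs -> exists q : {poly F}, forall r, r \in rs -> q.[r] = f r.
Proof.
elim: rs => [|r rs IH] /=; first by exists 0.
move=> /andP[rrs /IH[q qf]].
pose N := \prod_(s <- rs) ('X - s%:P).
exists (q + ((f r - q.[r]) / N.[r]) *: N) => s; rewrite inE => /predU1P[->|srs].
  have Nr : N.[r] != 0 by rewrite -rootE root_prod_XsubC.
  by rewrite !hornerE divfK// addrC subrK.
have /rootP Ns : root N s by rewrite root_prod_XsubC.
by rewrite !hornerE Ns mulr0 addr0 qf.
Qed.

Lemma trmx_horner_mx (F : fieldType) k (A : 'M[F]_k.+1) (q : {poly F}) :
  (horner_mx A q)^T = horner_mx A^T q.
Proof.
elim/poly_ind: q => [|q c IH]; first by rewrite !rmorph0 trmx0.
rewrite !rmorphD !rmorphM/= !horner_mx_X !horner_mx_C linearD/= tr_scalar_mx.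
by rewrite -[_ * A]/(_ *m A) trmx_mul IH (comm_mx_horner q (erefl (A^T *m A^T))).
Qed.

(** The root is a polynomial in [A]: interpolate the square root on the spectrum by [q]. Then
    [horner_mx A q] is symmetric, its form has nonnegative coefficients, and q^2 - X vanishes on the
    spectrum, hence at [A]. So [xget] never takes its default value here. *)
Lemma mxsqrtP k (A : 'M[R]_k) : psdmx A ->
  psdmx (mxsqrt A) /\ mxsqrt A *m mxsqrt A = A.
Proof.
move=> psdA; apply: (@xgetPex _ 0 [set S : 'M[R]_k | psdmx S /\ S *m S = A]).
case: k A psdA => [|k] A [Asym Age0].
  by exists A; split; [split | apply/matrixP => -[]].
have [d [W [dA W0 dW d0]]] := symmetric_functional_calculus Asym.
have [q qd] := interpolation_poly Num.sqrt (undup_uniq (codom d)).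
have {}qd i : q.[d i] = Num.sqrt (d i) by apply: qd; rewrite mem_undup codom_f.
have d_ge0 i : 0 <= d i.
  have [u u0 uE] := eigenvalue_quad (dA i).
  by have := Age0 u; rewrite uE pmulr_lge0// sqnorm_gt0.
exists (horner_mx A q); split; first split.
- by rewrite trmx_horner_mx Asym.
- move=> v; rewrite dW; apply: sumr_ge0 => i _.
  by rewrite mulr_ge0// qd sqrtr_ge0.
- apply/eqP; rewrite -subr_eq0; apply/eqP.
  rewrite -[X in _ - X]horner_mx_X -[_ *m _]/(_ * _) -rmorphM -rmorphB.
  by apply: d0 => i; rewrite !hornerE qd -expr2 sqr_sqrtr// subrr.
Qed.

Lemma sqr_l2norm_mxsqrt k (A : 'M[R]_k) (v : 'cV[R]_k) : psdmx A ->
  l2norm (mxsqrt A *m v) ^+ 2 = (v^T *m A *m v) 0 0.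
Proof.
move=> /mxsqrtP[[Ssym _] SS].
by rewrite sqr_l2norm sqnormE trmx_mul Ssym !mulmxA -(mulmxA v^T (mxsqrt A)) SS.
Qed.

Lemma psd_cauchy_schwarz k (A : 'M[R]_k) (u v : 'cV[R]_k) : psdmx A ->
  ((u^T *m A *m v) 0 0) ^+ 2 <= (u^T *m A *m u) 0 0 * (v^T *m A *m v) 0 0.
Proof.
move=> psdA; have [[Ssym _] SS] := mxsqrtP psdA.
rewrite -!sqr_l2norm_mxsqrt// !sqr_l2norm.
have -> : u^T *m A *m v = (mxsqrt A *m u)^T *m (mxsqrt A *m v).
  by rewrite trmx_mul Ssym !mulmxA -(mulmxA u^T (mxsqrt A)) SS.
exact: dot_cauchy_schwarz.
Qed.

Lemma le_min_diag k (A : 'M[R]_k) (j : 'I_k) c : c <= min_diag A -> c <= A j j.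
Proof.
move=> /le_trans; apply; apply: ge_inf; last by exists j.
exists (- \sum_i `|A i i|) => _ [i _ <-]; rewrite lerNl.
rewrite (le_trans (ler_norm _))// normrN (bigD1 i)//= lerDl.
by apply: sumr_ge0.
Qed.

End SymmetricMatrices.

(** * Canonical correlations *)

Section CanonicalCorrelation.
Variable R : realType.

(** Gram-Schmidt, one column at a time: the residual r of the new column is orthogonal to the range
    of the projection built so far, and r r^T / |r|^2 is added unless r = 0. The rank is recorded
    through the trace, the form in which [sum_sqnorm_projection] uses it. *)
Lemma projection_exists n m (A : 'M[R]_(n, m)) :
  exists Q : 'M[R]_n, [/\ Q^T = Q, Q *m Q = Q, Q *m A = A & \tr Q <= m%:R].
Proof.
elim: m A => [|m IH] A.
  exists 0; split; rewrite ?trmx0 ?mul0mx ?mxtrace0//.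
  by apply/matrixP => i [].
rewrite -[A](@hsubmxK _ n 1 m); set y := lsubmx _; set A' := rsubmx _.
have [Q [Qt QQ QA trQ]] := IH A'.
pose r : 'cV[R]_n := y - Q *m y.
have Qr : Q *m r = 0 by rewrite /r mulmxBr mulmxA QQ subrr.
have rQ : r^T *m Q = 0 by rewrite -{1}Qt -trmx_mul Qr trmx0.
have [r0|r0] := eqVneq r 0.
  exists Q; split => //; last by rewrite (le_trans trQ)// ler_nat.
  rewrite (@mul_mx_row _ n n 1 m) QA (_ : Q *m y = y)//.
  by apply/esym/eqP; rewrite -subr_eq0 -/r r0.
have sr := sqnorm_gt0 r0.
pose c := (sqnorm r)^-1.
have rr : r^T *m r = (sqnorm r)%:M.
  by apply/matrixP => i j; rewrite !ord1 sqnormE [RHS]mxE eqxx mulr1n.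
exists (Q + c *: (r *m r^T)); split.
- by rewrite linearD/= linearZ/= trmx_mul trmxK Qt.
- rewrite mulmxDl !mulmxDr QQ -!scalemxAl -!scalemxAr !mulmxA Qr.
  rewrite -(mulmxA r r^T Q) rQ mulmx0 mul0mx !scaler0 addr0 add0r.
  rewrite -(mulmxA r r^T r) rr mul_mx_scalar -scalemxAl scalerA.
  by rewrite -/c mulVf ?gt_eqF// scale1r.
- rewrite (@mul_mx_row _ n n 1 m) (_ : _ *m y = y); last first.
    have ry : r^T *m y = r^T *m r by rewrite {3}/r mulmxBr mulmxA rQ mul0mx subr0.
    rewrite mulmxDl -scalemxAl -mulmxA ry rr mul_mx_scalar scalerA mulVf ?gt_eqF//.
    by rewrite scale1r addrC subrK.
  congr (row_mx y); rewrite mulmxDl QA -scalemxAl -mulmxA -{2}QA (mulmxA r^T) rQ mul0mx mulmx0.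
  by rewrite scaler0 addr0.
- rewrite mxtraceD mxtraceZ mxtrace_mulC rr mxtrace_scalar mulr1n mulVf ?gt_eqF//.
  by rewrite -natr1 lerD2r.
Qed.

(** The squared Frobenius norm of Q Z is summed by rows instead of columns: each row is Z^T applied
    to a column of Q, and the squared norms of the columns of a symmetric idempotent add up to its
    trace. *)
Lemma sum_sqnorm_projection n p (Q : 'M[R]_n) (Z : 'M[R]_(n, p)) (L : R) :
  Q^T = Q -> Q *m Q = Q -> (forall v, sqnorm (Z^T *m v) <= L * sqnorm v) ->
  \sum_j sqnorm (Q *m col j Z) <= L * \tr Q.
Proof.
move=> Qt QQ ZL.
have -> : \sum_j sqnorm (Q *m col j Z) = \sum_i sqnorm (Z^T *m col i Q).
  rewrite /sqnorm exchange_big/=; apply: eq_bigr => i _; apply: eq_bigr => j _.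
  rewrite !mxE; congr (_ ^+ 2); apply: eq_bigr => l _.
  by rewrite !mxE -{1}Qt mxE mulrC.
apply: (@le_trans _ _ (\sum_i L * sqnorm (col i Q))).
  by apply: ler_sum => i _; exact: ZL.
rewrite -mulr_sumr -{2}QQ (_ : \tr (Q *m Q) = \sum_i sqnorm (col i Q))//.
apply: eq_bigr => i _; rewrite mxE; apply: eq_bigr => j _.
by rewrite mxE -{1}Qt mxE expr2.
Qed.

(** The inner product of the two centered vectors, written with plain sums so that tail bounds on
    sums of independent terms apply directly. *)
Definition cdot n (u v : 'cV[R]_n) : R :=
  \sum_i u i 0 * v i 0 - n%:R^-1 * (\sum_i u i 0) * (\sum_i v i 0).

Lemma center_colsE n q (A : 'M[R]_(n, q)) i j :
  center_cols A i j = A i j - n%:R^-1 * \sum_k A k j.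
Proof.
rewrite !mxE big_ord1 !mxE mul1r summxE; congr (_ - _ * _).
by apply: eq_bigr => k _; rewrite mxE.
Qed.

Lemma center_colsM n q l (A : 'M[R]_(n, q)) (C : 'M[R]_(q, l)) :
  center_cols (A *m C) = center_cols A *m C.
Proof.
rewrite /center_cols mulmxBl; congr (_ - _).
rewrite -mulmxA; congr (_ *m _); rewrite /row_mean -scalemxAl mulmx_suml.
by congr (_ *: _); apply: eq_bigr => i _; rewrite row_mul.
Qed.

Lemma center_dotE n (u v : 'cV[R]_n) : (0 < n)%N ->
  ((center_cols u)^T *m center_cols v) 0 0 = cdot u v.
Proof.
move=> n0; have n0R : n%:R != 0 :> R by rewrite pnatr_eq0 -lt0n.
rewrite dotE.
set a := n%:R^-1 * \sum_k u k 0; set b := n%:R^-1 * \sum_k v k 0.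
transitivity (\sum_i (u i 0 * v i 0 - b * u i 0 - a * v i 0 + a * b)).
  by apply: eq_bigr => i _; rewrite !center_colsE -/a -/b; ring.
rewrite big_split/= !sumrB -!mulr_sumr sumr_const card_ord -mulr_natr.
by rewrite /cdot /a /b; field.
Qed.

Lemma cdot_ge0 n (u : 'cV[R]_n) : (0 < n)%N -> 0 <= cdot u u.
Proof. by move=> n0; rewrite -center_dotE// -sqnormE sqnorm_ge0. Qed.

Lemma cdot_le n (u : 'cV[R]_n) : cdot u u <= sqnorm u.
Proof.
rewrite /cdot -dotE -sqnormE lerBlDr lerDl -mulrA mulr_ge0//.
by rewrite -expr2 sqr_ge0.
Qed.

(** Centering removes the additive constants; this is how the unknown mean of the predictors
    disappears. *)
Lemma cdot_affine n (u v : 'cV[R]_n) a b c e : (0 < n)%N ->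
  cdot (const_mx a + b *: u) (const_mx c + e *: v) = b * e * cdot u v.
Proof.
move=> n0; have n0R : n%:R != 0 :> R by rewrite pnatr_eq0 -lt0n.
have S (x y : R) (w : 'cV[R]_n) :
    \sum_i (const_mx x + y *: w) i 0 = n%:R * x + y * \sum_i w i 0.
  transitivity (\sum_(i < n) (x + y * w i 0)).
    by apply: eq_bigr => i _; rewrite !mxE.
  by rewrite big_split/= sumr_const card_ord -mulr_sumr mulr_natl.
rewrite /cdot !S.
have -> : \sum_i (const_mx a + b *: u) i 0 * (const_mx c + e *: v) i 0 =
    n%:R * (a * c) + b * c * \sum_i u i 0 + a * e * \sum_i v i 0 +
    b * e * \sum_i u i 0 * v i 0.
  transitivity (\sum_(i < n) (a * c + b * c * u i 0 + a * e * v i 0 +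
       b * e * (u i 0 * v i 0))).
    by apply: eq_bigr => i _; rewrite !mxE; ring.
  by rewrite !big_split/= sumr_const card_ord -!mulr_sumr mulr_natl.
by field.
Qed.

Lemma center_cols_shift n q (A : 'M[R]_(n, q)) (w : 'rV[R]_q) : (0 < n)%N ->
  center_cols (A - const_mx 1 *m w) = center_cols A.
Proof.
move=> n0; have n0R : n%:R != 0 :> R by rewrite pnatr_eq0 -lt0n.
apply/matrixP => i j; rewrite !center_colsE.
have -> k : (A - const_mx 1 *m w) k j = A k j - w 0 j.
  by rewrite !mxE big_ord1 mxE mul1r.
by under eq_bigr do rewrite !mxE big_ord1 mxE mul1r; rewrite sumrB sumr_const card_ord -mulr_natl; field.
Qed.

(** Centering is a symmetric projection acting on the left, so in the transpose it moves onto [v],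
    whose norm it does not increase. *)
Lemma center_cols_tr_bound n p (Z : 'M[R]_(n, p)) (L : R) : (0 < n)%N -> 0 <= L ->
  (forall v, sqnorm (Z^T *m v) <= L * sqnorm v) ->
  forall v, sqnorm ((center_cols Z)^T *m v) <= L * sqnorm v.
Proof.
move=> n0 L0 ZL v.
have -> : (center_cols Z)^T *m v = Z^T *m center_cols v.
  apply/matrixP => j k; rewrite [k]ord1 !mxE.
  under eq_bigr do rewrite mxE center_colsE mulrBl.
  under [RHS]eq_bigr do rewrite mxE center_colsE mulrBr.
  rewrite !sumrB; congr (_ - _); rewrite -mulr_sumr -mulr_suml.
  by ring.
rewrite (le_trans (ZL _))// ler_wpM2l// sqnormE center_dotE//.
exact: cdot_le.
Qed.

Lemma cancor_quotientE n m (Y : 'M[R]_(n, m)) (x : 'cV[R]_n) (a : 'cV[R]_m) :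
  (0 < n)%N ->
  (a^T *m (center_cols Y)^T *m center_cols x) 0 0
    / Num.sqrt ((a^T *m ((center_cols Y)^T *m center_cols Y) *m a) 0 0
                * ((center_cols x)^T *m center_cols x) 0 0) =
  cdot (Y *m a) x / Num.sqrt (cdot (Y *m a) (Y *m a) * cdot x x).
Proof.
move=> n0; rewrite -!center_dotE// !center_colsM.
by rewrite !trmx_mul !mulmxA.
Qed.

(** [Q] fixes the centered Y a, so in the inner product it can be moved to the other side before
    Cauchy-Schwarz is applied. *)
Lemma cancor_quotient_sqr n m (Y : 'M[R]_(n, m)) (x : 'cV[R]_n) (a : 'cV[R]_m)
    (Q : 'M[R]_n) : (0 < n)%N -> Q^T = Q -> Q *m center_cols Y = center_cols Y ->
  cdot (Y *m a) x ^+ 2 <= cdot (Y *m a) (Y *m a) * sqnorm (Q *m center_cols x).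
Proof.
move=> n0 Qt QY; rewrite -!center_dotE// -sqnormE.
have Qu : Q *m center_cols (Y *m a) = center_cols (Y *m a).
  by rewrite center_colsM mulmxA QY.
rewrite (le_trans _ (dot_cauchy_schwarz _ _))// mulmxA.
by rewrite -[X in _ *m X *m _]Qt -trmx_mul Qu.
Qed.


Lemma ratio_sqr_le (a b c : R) : 0 <= b -> a ^+ 2 <= b * c ->
  a / Num.sqrt b <= Num.sqrt c.
Proof.
rewrite le_eqVlt => /predU1P[<-|b0] abc; first by rewrite sqrtr0 invr0 mulr0 sqrtr_ge0.
rewrite ler_pdivrMr ?sqrtr_gt0//.
have [a0|a0] := leP a 0; first by rewrite (le_trans a0)// mulr_ge0// sqrtr_ge0.
have c0 : 0 <= c by rewrite -(pmulr_rge0 _ b0) (le_trans _ abc)// sqr_ge0.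
by rewrite -sqrtrM// -(ger0_norm (ltW a0)) -sqrtr_sqr ler_sqrt ?mulr_ge0 1?mulrC// ltW.
Qed.

Lemma cancor_quotient_le n m (Y : 'M[R]_(n, m)) (x : 'cV[R]_n) (a : 'cV[R]_m)
    (Q : 'M[R]_n) : (0 < n)%N -> Q^T = Q -> Q *m center_cols Y = center_cols Y ->
  cdot (Y *m a) x / Num.sqrt (cdot (Y *m a) (Y *m a) * cdot x x)
  <= Num.sqrt (sqnorm (Q *m center_cols x) / cdot x x).
Proof.
move=> n0 Qt QY; have := cdot_ge0 x n0; rewrite le_eqVlt => /predU1P[<-|x0].
  by rewrite mulr0 sqrtr0 invr0 mulr0 sqrtr_ge0.
apply: ratio_sqr_le; first by rewrite mulr_ge0// cdot_ge0.
have := cancor_quotient_sqr x a n0 Qt QY.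
by rewrite mulrACA divff ?gt_eqF// mulr1.
Qed.

(** The bound through the projection does not depend on [a], so the set of quotients is bounded
    above and its supremum is a true upper bound. *)
Lemma cancor_has_sup n m (Y : 'M[R]_(n, m)) (x : 'cV[R]_n) (a : 'cV[R]_m) :
  (0 < n)%N -> a != 0 ->
  cdot (Y *m a) x / Num.sqrt (cdot (Y *m a) (Y *m a) * cdot x x) <= cancor Y x.
Proof.
move=> n0 a0; apply: ub_le_sup; last by exists a => //; rewrite cancor_quotientE.
have [Q [Qt _ QY _]] := projection_exists (center_cols Y).
exists (Num.sqrt (sqnorm (Q *m center_cols x) / cdot x x)) => _ [b b0 <-].
by rewrite cancor_quotientE// cancor_quotient_le.
Qed.

(** Replacing a by - a changes the sign of the numerator only. *)
Lemma cancor_abs_ge n m (Y : 'M[R]_(n, m)) (x : 'cV[R]_n) (a : 'cV[R]_m) :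
  (0 < n)%N -> a != 0 ->
  `|cdot (Y *m a) x| / Num.sqrt (cdot (Y *m a) (Y *m a) * cdot x x) <= cancor Y x.
Proof.
move=> n0 a0; have [_|_] := ger0P (cdot (Y *m a) x); first exact: cancor_has_sup.
have := @cancor_has_sup _ _ Y x (- a) n0; rewrite oppr_eq0 => /(_ a0).
have cNl (u v : 'cV[R]_n) : cdot (- u) v = - cdot u v.
  rewrite /cdot; under eq_bigr do rewrite mxE mulNr.
  by under [X in _ - _ * X * _]eq_bigr do rewrite mxE; rewrite !sumrN; ring.
have cNr (u v : 'cV[R]_n) : cdot u (- v) = - cdot u v.
  rewrite /cdot; under eq_bigr do rewrite mxE mulrN.
  by under [X in _ - _ * _ * X]eq_bigr do rewrite mxE; rewrite !sumrN; ring.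
by rewrite mulmxN !cNl cNr opprK.
Qed.

Lemma exists_nonzero_col m : (0 < m)%N -> exists a : 'cV[R]_m, a != 0.
Proof.
move=> m0; exists (const_mx 1); apply/eqP => /matrixP/(_ (Ordinal m0) 0).
by rewrite !mxE => /eqP; rewrite oner_eq0.
Qed.

Lemma cancor_ge0 n m (Y : 'M[R]_(n, m)) (x : 'cV[R]_n) :
  (0 < n)%N -> (0 < m)%N -> 0 <= cancor Y x.
Proof.
move=> n0 /exists_nonzero_col[a a0]; rewrite (le_trans _ (cancor_abs_ge Y x n0 a0))//.
Qed.

Lemma sqr_cancor_le n m (Y : 'M[R]_(n, m)) (x : 'cV[R]_n) (Q : 'M[R]_n) (c : R) :
  (0 < n)%N -> (0 < m)%N -> Q^T = Q -> Q *m center_cols Y = center_cols Y ->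
  0 < c -> c <= cdot x x ->
  cancor Y x ^+ 2 <= sqnorm (Q *m center_cols x) / c.
Proof.
move=> n0 m0 Qt QY c0 cx; apply: (@le_trans _ _ (sqnorm (Q *m center_cols x) / cdot x x)).
  rewrite -[leRHS]sqr_sqrtr ?divr_ge0 ?sqnorm_ge0 ?cdot_ge0//.
  rewrite ler_sqr ?nnegrE ?sqrtr_ge0 ?cancor_ge0//.
  apply: ge_sup; first by have [a a0] := exists_nonzero_col m0; eexists; exists a.
  by move=> _ [b b0 <-]; rewrite cancor_quotientE// cancor_quotient_le.
rewrite ler_wpM2l ?sqnorm_ge0// lef_pV2 ?posrE//.
exact: lt_le_trans cx.
Qed.

(* The canonical correlations with all predictors together only see a projection
   of rank at most [m], hence the factor [m] instead of [n]. *)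
Lemma sum_sqr_cancor_le n m p (Y : 'M[R]_(n, m)) (X : 'M[R]_(n, p))
    (w : 'rV[R]_p) (L c : R) :
  (0 < n)%N -> (0 < m)%N -> 0 <= L -> 0 < c ->
  (forall v, sqnorm ((X - const_mx 1 *m w)^T *m v) <= L * sqnorm v) ->
  (forall j, c <= cdot (col j X) (col j X)) ->
  \sum_j cancor Y (col j X) ^+ 2 <= L * m%:R / c.
Proof.
move=> n0 m0 L0 c0 XL cX.
have [Q [Qt QQ QY trQ]] := projection_exists (center_cols Y).
apply: (@le_trans _ _ (\sum_j sqnorm (Q *m center_cols (col j X)) / c)).
  by apply: ler_sum => j _; exact: sqr_cancor_le.
rewrite -mulr_suml ler_pM2r ?invr_gt0//.
apply: (@le_trans _ _ (\sum_j sqnorm (Q *m col j (center_cols X)))).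
  by apply: ler_sum => j _; rewrite !colE center_colsM.
apply: le_trans (ler_wpM2l L0 trQ); apply: sum_sqnorm_projection => //.
by rewrite -(center_cols_shift X w n0); exact: center_cols_tr_bound.
Qed.

(** Chebyshev counting: every index strictly above [i] contributes at least r^2 to the sum of
    squares, so there are at most s / r^2 < D of them. *)
Lemma top_indicesP p (om : 'I_p -> R) (D : nat) (i : 'I_p) (r s : R) :
  0 < r -> (forall j, 0 <= om j) -> r <= om i ->
  \sum_j om j ^+ 2 <= s -> s < D%:R * r ^+ 2 -> i \in top_indices om D.
Proof.
move=> r0 om0 ri oms sD; rewrite inE -(ltr_nat R) -(ltr_pM2r (exprn_gt0 2 r0)).
apply: le_lt_trans sD; apply: le_trans oms.
rewrite [leRHS](bigID (mem [set k | (`|om i| < `|om k|)%R]%SET))/=.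
rewrite -[leLHS]addr0 lerD//; last by apply: sumr_ge0 => j _; exact: sqr_ge0.
rewrite mulr_natl -sumr_const; apply: ler_sum => j; rewrite inE !ger0_norm//.
by move=> ij; rewrite ler_sqr ?nnegrE ?(ltW r0)// (le_trans ri)// ltW.
Qed.

(** [u] and [v] are the rescaled response combination and predictor. The choice eta^2 = r / 8 makes
    the centering term at most 2 n eta^2 = n r / 4, half of the signal n r / 2; the denominator is
    at most sqrt (16 n * 4 n) = 8 n, whence r / 32. The bounds on [u] are looser than those on [v]
    because [u] is the sum of a predictor part and an error part. *)
Lemma cancor_lower_bound n m (Y : 'M[R]_(n, m)) (x u v : 'cV[R]_n)
    (a : 'cV[R]_m) (b c al sg r eta : R) :
  (0 < n)%N -> a != 0 -> 0 < al -> 0 < sg -> 0 < r -> 0 <= eta -> eta ^+ 2 = r / 8 ->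
  Y *m a = const_mx b + al *: u -> x = const_mx c + sg *: v ->
  n%:R * r / 2 <= \sum_i u i 0 * v i 0 ->
  `|\sum_i u i 0| <= 2 * n%:R * eta -> `|\sum_i v i 0| <= n%:R * eta ->
  sqnorm u <= 16 * n%:R -> sqnorm v <= 4 * n%:R ->
  r / 32 <= cancor Y x.
Proof.
move=> n0 a0 al0 sg0 r0 eta0 etaE YE xE uv su sv uu vv.
apply: le_trans (cancor_abs_ge Y x n0 a0); rewrite YE xE !cdot_affine//.
have N0 : 0 < n%:R :> R by rewrite ltr0n.
have asg0 : 0 < al * sg by rewrite mulr_gt0.
have -> : al * al * cdot u u * (sg * sg * cdot v v) =
  (al * sg) ^+ 2 * (cdot u u * cdot v v) by ring.
rewrite sqrtrM ?sqr_ge0// sqrtr_sqr normrM -mulf_div divff ?normr_eq0 ?gt_eqF// mul1r.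
have num : n%:R * r / 4 <= cdot u v.
  rewrite /cdot; have : `|n%:R^-1 * (\sum_i u i 0) * (\sum_i v i 0)| <= n%:R * r / 4.
    rewrite !normrM (gtr0_norm (_ : 0 < n%:R^-1)) ?invr_gt0//.
    apply: (@le_trans _ _ (n%:R^-1 * (2 * n%:R * eta) * (n%:R * eta))).
      have h : n%:R^-1 * `|\sum_i u i 0| <= n%:R^-1 * (2 * n%:R * eta) by rewrite ler_wpM2l// invr_ge0 ltW.
      by apply: ler_pM => //; rewrite mulr_ge0 ?normr_ge0// invr_ge0 ltW.
    have -> : n%:R^-1 * (2 * n%:R * eta) * (n%:R * eta) = 2 * n%:R * eta ^+ 2 by field; rewrite gt_eqF.
    rewrite etaE; lra.
  move=> /ler_normlP[_]; lra.
have D0 : 0 <= Num.sqrt (cdot u u * cdot v v) by rewrite sqrtr_ge0.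
have Dn : Num.sqrt (cdot u u * cdot v v) <= 8 * n%:R.
  rewrite -[leRHS]ger0_norm ?mulr_ge0// -sqrtr_sqr ler_sqrt ?sqr_ge0//.
  rewrite (_ : (8 * n%:R) ^+ 2 = (16 * n%:R) * (4 * n%:R)); last by ring.
  by apply: ler_pM; rewrite ?cdot_ge0// (le_trans (cdot_le _)).
(* Used to see that the denominator is nonzero: a quotient by 0 would be 0, and the lower bound
   would be lost. *)
have cuv : cdot u v ^+ 2 <= cdot u u * cdot v v.
  by rewrite -!center_dotE// -!sqnormE dot_cauchy_schwarz.
have nr : 0 < n%:R * r / 4 by rewrite divr_gt0// mulr_gt0.
have D1 : 0 < Num.sqrt (cdot u u * cdot v v).
  by rewrite sqrtr_gt0 (lt_le_trans _ cuv)// exprn_gt0// (lt_le_trans nr).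
rewrite ler_pdivlMr// (le_trans _ (ler_norm _))// (le_trans _ num)//.
apply: le_trans (_ : r / 32 * (8 * n%:R) <= _); last by lra.
by rewrite ler_wpM2l// divr_ge0// ltW.
Qed.

End CanonicalCorrelation.

(** * Independence and integrals *)

Section Independence.
Context (R : realType) (d : measure_display) (T : measurableType d).
Variable P : probability T R.

(** Dynkin's argument: the measurable [A] satisfying the product formula with [D] form a
    lambda-system, which contains the pi-system [G]. *)
Lemma indep_g_sigma_algebra (G : set (set T)) (D : set T) :
  setI_closed G -> G `<=` measurable -> measurable D ->
  (forall A, G A -> P (A `&` D) = (P A * P D)%E) ->
  forall A, <<s G >> A -> P (A `&` D) = (P A * P D)%E.
Proof.
move=> GI Gm mD GP.
suff : <<s G >> `<=` [set A | measurable A /\ P (A `&` D) = (P A * P D)%E].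
  by move=> GH A /GH[].
have PDfin : P D \is a fin_num by rewrite fin_num_measure.
apply: lambda_system_subset => //; last by move=> A GA; split; [exact: Gm|exact: GP].
split => //.
- by split => //; rewrite setTI probability_setT mul1e.
- move=> A B BA [mA PA] [mB PB]; split; first exact: measurableD.
  have -> : (A `\` B) `&` D = (A `&` D) `\` (B `&` D).
    apply/seteqP; split => w /= [].
      by move=> [Aw nBw] Dw; split => // -[].
    by move=> [Aw Dw] nBD; split => //; split => // Bw; apply: nBD.
  rewrite !measureD//; try exact: measurableI; last 2 first.
  - by rewrite ltey_eq fin_num_measure.
  - by rewrite ltey_eq fin_num_measure//; exact: measurableI.
  rewrite (_ : A `&` D `&` (B `&` D) = B `&` D); last first.
    by apply/seteqP; split => w /=; [tauto|move=> [Bw Dw]; have := BA _ Bw; tauto].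
  rewrite (_ : A `&` B = B); last exact/setIidPr.
  suff e : (P (A `&` D) - P (B `&` D) = (P A - P B) * P D)%E by exact: e.
  by rewrite PA PB muleBl// fin_num_adde_defr// fin_num_measure.
- move=> F ndF FP.
  have mF i : measurable (F i) by case: (FP i).
  have mU : measurable (\bigcup_i F i) by exact: bigcup_measurable.
  split => //.
  have h1 : (P \o F) n @[n --> \oo] --> P (\bigcup_i F i).
    by apply: nondecreasing_cvg_mu.
  have h2 : (P \o (fun i => F i `&` D)) n @[n --> \oo] --> P (\bigcup_i (F i `&` D)).
    apply: nondecreasing_cvg_mu.
    - by move=> i; exact: measurableI.
    - by apply: bigcup_measurable => i _; exact: measurableI.
    - by move=> i j ij; apply/subsetPset; apply: setSI; apply/subsetPset; exact: ndF.
  have h3 : ((P \o F) n * P D)%E @[n --> \oo] --> (P (\bigcup_i F i) * P D)%E.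
    exact: cvgeZr.
  have E : P \o (fun i => F i `&` D) = (fun n => (P \o F) n * P D)%E.
    by apply/funext => i /=; case: (FP i).
  by rewrite setI_bigcupl; rewrite E in h2; exact: (cvg_unique _ h2 h3).
Qed.

(** The generators are replaced by the generated sigma-algebras one index at a time: in the
    induction the first [j] events are arbitrary members of their sigma-algebra and the others are
    still generators. *)
Lemma indep_family_g_sigma_algebra n (G : 'I_n -> set (set T)) :
  (forall k, setI_closed (G k)) -> (forall k, G k `<=` measurable) ->
  (forall k, G k setT) ->
  (forall C : 'I_n -> set T, (forall k, G k (C k)) ->
     P (\bigcap_k C k) = (\prod_k P (C k))%E) ->
  forall C : 'I_n -> set T, (forall k, <<s G k >> (C k)) ->
     P (\bigcap_k C k) = (\prod_k P (C k))%E.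
Proof.
move=> GI Gm GT GP.
have sGm k : <<s G k >> `<=` measurable.
  by apply: smallest_sub; [exact: sigma_algebra_measurable|exact: Gm].
suff H (j : nat) (C : 'I_n -> set T) :
    (forall k : 'I_n, (k < j)%N -> <<s G k >> (C k)) ->
    (forall k : 'I_n, (j <= k)%N -> G k (C k)) ->
    P (\bigcap_k C k) = (\prod_k P (C k))%E.
  by move=> C CG; apply: (H n) => // k; rewrite leqNgt ltn_ord.
elim: j C => [|j IH] C Clt Cge; first by apply: GP => k; exact: Cge.
have [nj|jn] := leqP n j.
  apply: IH => k kj; first by apply: Clt; exact: ltnW.
  by have := leq_trans nj kj; rewrite leqNgt ltn_ord.
pose k0 := Ordinal jn.
pose upd (A : set T) k := if k == k0 then A else C k.
pose D := \bigcap_(k in [set k | k != k0]) C k.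
have updE A : \bigcap_k upd A k = A `&` D.
  apply/seteqP; split => w.
    move=> h; split; first by have := h k0 I; rewrite /upd eqxx.
    by move=> k /= kk; have := h k I; rewrite /upd (negbTE kk).
  move=> [Aw Dw] k _; rewrite /upd; case: eqP => // /eqP kk; exact: Dw.
have prodE A : (\prod_k P (upd A k) = P A * \prod_(k | k != k0) P (C k))%E.
  rewrite (bigD1 k0)//= /upd eqxx; congr (_ * _)%E.
  by apply: eq_bigr => k /negbTE ->.
have mC k : measurable (C k).
  have [kj|kj] := ltnP k j.+1; first by apply: (sGm k); exact: Clt.
  by apply: (Gm k); exact: Cge.
have mD : measurable D by apply: fin_bigcap_measurable => //; exact: finite_finset.
have PG A : G k0 A -> P (A `&` D) = (P A * \prod_(k | k != k0) P (C k))%E.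
  move=> GA; rewrite -updE -prodE; apply: IH => k kj; rewrite /upd.
    by case: eqP => [kk|/eqP kk]; [by move: kj; rewrite kk /= ltnn|by apply: Clt; exact: ltnW].
  case: eqP => [->//|/eqP kk]; apply: Cge.
  rewrite ltn_neqAle kj andbT; apply: contra kk => /eqP jk.
  by apply/eqP/val_inj.
(* Taking the whole space as the event at [k0] gives the product formula for the remaining
   indices. *)
have PD : P D = (\prod_(k | k != k0) P (C k))%E.
  by have := PG _ (GT k0); rewrite setTI probability_setT mul1e.
have CE : C = upd (C k0) by apply/funext => k; rewrite /upd; case: eqP => [->|].
rewrite CE updE prodE -PD; apply: (indep_g_sigma_algebra (GI k0)) => //.
- by move=> A /PG; rewrite PD.
- exact: Clt.
Qed.

(** Write h (w) as the integral over s >= 0 of the indicator of s < h (w), and exchange the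
    integrals by Tonelli. The factor [f] is carried along so that only one member of a product is
    cut into superlevel sets. *)
Lemma layer_cake (d0 : measure_display) (T0 : measurableType d0)
    (nu : {sigma_finite_measure set T0 -> \bar R}) (f h : T0 -> R) :
  measurable_fun setT f -> measurable_fun setT h ->
  (forall w, 0 <= f w) -> (forall w, 0 <= h w) ->
  (\int[nu]_w (f w * h w)%:E = \int[@lebesgue_measure R]_(s in `[0%R, +oo[)
     \int[nu]_w (f w * \1_(h @^-1` `]s, +oo[) w)%:E)%E.
Proof.
move=> mf mh f0 h0.
pose mu : {measure set _ -> \bar R} := @lebesgue_measure R.
pose A : set (T0 * measurableTypeR R) := [set z | 0 <= z.2 < h z.1].
have mA : measurable A.
  rewrite (_ : A = (fun z => (0 <= z.2) && (z.2 < h z.1)) @^-1` [set true]); last first.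
    by apply/seteqP; split => z.
  rewrite -[_ @^-1` _]setTI.
  apply: measurable_and => //.
    by apply: measurable_fun_ler => //; exact: measurable_snd.
  apply: measurable_fun_ltr => //.
  by apply: measurableT_comp => //; exact: measurable_fst.
have AE w s : \1_A (w, s) = (0 <= s < h w)%R%:R :> R.
  by rewrite indicE; congr (nat_of_bool _)%:R; apply/idP/idP => [/set_mem|h1]//; exact: mem_set.
have sE s w : \1_(h @^-1` `]s, +oo[) w = (s < h w)%R%:R :> R.
  rewrite indicE; congr (nat_of_bool _)%:R; apply/idP/idP => [/set_mem|h1]/=.
    by rewrite in_itv/= andbT.
  by apply: mem_set; rewrite /= in_itv/= andbT.
pose F (z : T0 * measurableTypeR R) := (f z.1 * \1_A z)%:E.
have mF : measurable_fun setT F.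
  apply/measurable_EFinP/measurable_funM.
    by apply: measurableT_comp => //; exact: measurable_fst.
  exact: measurable_indic.
have F0 z : (0 <= F z)%E by rewrite lee_fin mulr_ge0// indicE.
have := @fubini_tonelli _ _ _ _ R nu mu F mF F0.
have -> : (\int[nu]_w \int[mu]_s F (w, s) = \int[nu]_w (f w * h w)%:E)%E.
  apply: eq_integral => w _.
  under eq_integral do rewrite /F/= EFinM.
  rewrite ge0_integralZl_EFin//; last first.
    apply/measurable_EFinP; apply: (measurableT_comp (measurable_indic mA)).
    exact: measurable_pair1.
  rewrite EFinM; congr (_ * _)%E.
  rewrite (_ : (fun s => _) = (fun s => (\1_(`[0, h w[%classic) s)%:E)); last first.
    by apply/funext => s; rewrite AE indicE mem_setE.
  rewrite integral_indic// setIT /mu/= lebesgue_measure_itv/= lte_fin.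
  case: ltgtP (h0 w) => // [h_gt0|<-] _; first by rewrite -EFinB subr0.
  by [].
move=> ->; rewrite [RHS]integral_mkcond; apply: eq_integral => s _.
rewrite patchE mem_setE/= in_itv/= andbT; case: ifPn => s0.
  apply: eq_integral => w _; rewrite /F/=; congr (_ * _)%:E.
  by rewrite AE sE s0.
by apply: integral0_eq => w _; rewrite /F/= AE (negbTE s0) mulr0.
Qed.

(** It suffices to factor the integral against indicators of superlevel sets of [h]: apply the layer
    cake formula to both sides. *)
Lemma integral_mul_superlevel (g h : T -> R) (c : \bar R) :
  measurable_fun setT g -> measurable_fun setT h ->
  (forall w, 0 <= g w) -> (forall w, 0 <= h w) -> (0 <= c)%E ->
  (forall s : R, (\int[P]_w (g w * \1_(h @^-1` `]s, +oo[) w)%:E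
     = c * P (h @^-1` `]s, +oo[))%E) ->
  (\int[P]_w (g w * h w)%:E = c * \int[P]_w (h w)%:E)%E.
Proof.
move=> mg mh g0 h0 c0 H.
rewrite layer_cake//; under eq_integral do rewrite H.
rewrite ge0_integralZl//.
- congr (c * _)%E.
  under [RHS]eq_integral do rewrite -[h _]mul1r.
  rewrite (@layer_cake _ _ P (cst 1))//; apply: eq_integral => s _.
  under eq_integral do rewrite mul1r.
  by rewrite integral_indic ?setIT// -[_ @^-1` _]setTI; exact: mh.
- apply: measurable_funTS.
  pose X : {RV P >-> R} := mfun_Sub (mem_set mh).
  exact: (ccdf_measurable X).
Qed.

(** The same induction as for events: the first [j] factors are arbitrary and the others are
    indicators of sets of [G k]. Superlevel sets turn a function at index [j] into such indicators,
    and at j = 0 the claim is the product formula for events. *)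
Lemma integral_prod_indep n (G : 'I_n -> set (set T)) (h : 'I_n -> T -> R) :
  (forall k, G k `<=` measurable) ->
  (forall C : 'I_n -> set T, (forall k, G k (C k)) ->
     P (\bigcap_k C k) = (\prod_k P (C k))%E) ->
  (forall k B, measurable B -> G k (h k @^-1` B)) -> (forall k w, 0 <= h k w) ->
  (\int[P]_w (\prod_k h k w)%:E = \prod_k \int[P]_w (h k w)%:E)%E.
Proof.
move=> Gm GP hG h0.
suff H (j : nat) (f : 'I_n -> T -> R) :
    (forall k : 'I_n, (k < j)%N -> (forall B, measurable B -> G k (f k @^-1` B)) /\
                                   (forall w, 0 <= f k w)) ->
    (forall k : 'I_n, (j <= k)%N -> exists2 C, G k C & f k = \1_C) ->
    (\int[P]_w (\prod_k f k w)%:E = \prod_k \int[P]_w (f k w)%:E)%E.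
  apply: (H n) => k; last by rewrite leqNgt ltn_ord.
  by split => //; exact: hG.
elim: j f => [|j IH] f flt fge.
  have /choice[C CP] : forall k, exists C, G k C /\ f k = \1_C.
    by move=> k; have [C ? ?] := fge k (leq0n k); exists C.
  have mC k : measurable (C k) by apply: (Gm k); case: (CP k).
  rewrite (_ : (fun w => _) = (fun w => (\1_(\bigcap_k C k) w)%:E)); last first.
    apply/funext => w; congr (_%:E); rewrite indicE.
    have [wC|wC] := pselect ((\bigcap_k C k) w).
      rewrite mem_set// big1// => k _; have [_ ->] := CP k.
      by rewrite indicE mem_set//; exact: wC.
    rewrite memNset//; have [k nCk] : exists k, ~ C k w.
      by apply/existsNP => h1; apply: wC => k _.
    rewrite (bigD1 k)//=; have [_ ->] := CP k.
    by rewrite indicE memNset// mul0r.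
  have IE A : measurable A -> (\int[P]_w (\1_A w)%:E = P A)%E.
    by move=> mA; rewrite integral_indic// setIT.
  rewrite IE; last by apply: fin_bigcap_measurable => //; exact: finite_finset.
  rewrite GP; last by move=> k; case: (CP k).
  by apply: eq_bigr => k _; have [_ ->] := CP k; rewrite IE.
have [nj|jn] := leqP n j.
  apply: IH => k kj; first by apply: flt; exact: ltnW.
  by have := leq_trans nj kj; rewrite leqNgt ltn_ord.
pose k0 := Ordinal jn.
pose upd (u : T -> R) k := if k == k0 then u else f k.
have updE u w : \prod_k upd u k w = (\prod_(k | k != k0) f k w) * u w.
  rewrite (bigD1 k0)//= {1}/upd eqxx mulrC; congr (_ * _).
  by apply: eq_bigr => k /negbTE kk; rewrite /upd kk.
have prodE u : (\prod_k \int[P]_w (upd u k w)%:E =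
    (\prod_(k | k != k0) \int[P]_w (f k w)%:E) * \int[P]_w (u w)%:E)%E.
  rewrite (bigD1 k0)//= {1}/upd eqxx muleC; congr (_ * _)%E.
  by apply: eq_bigr => k /negbTE kk; rewrite /upd kk.
have fP k : (forall w, 0 <= f k w) /\ measurable_fun setT (f k).
  have [kj|kj] := ltnP k j.+1.
    have [fG f0] := flt _ kj; split => // _ B mB; rewrite setTI.
    by apply: (Gm k); exact: fG.
  have [C GC ->] := fge _ kj; split; first by move=> w; rewrite indicE.
  by apply: measurable_indic; exact: (Gm k).
have f_upd : f = upd (f k0) by apply/funext => k; rewrite /upd; case: eqP => [->|].
have -> : (\prod_k \int[P]_w (f k w)%:E =
    (\prod_(k | k != k0) \int[P]_w (f k w)%:E) * \int[P]_w (f k0 w)%:E)%E.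
  by rewrite -prodE -f_upd.
transitivity (\int[P]_w ((\prod_(k | k != k0) f k w) * f k0 w)%:E)%E.
  by apply: eq_integral => w _; rewrite -updE -f_upd.
apply: integral_mul_superlevel.
- under eq_fun do rewrite -big_filter.
  by apply: measurable_prod => k _; case: (fP k).
- by case: (fP k0).
- by move=> w; apply: prodr_ge0 => k _; case: (fP k).
- by case: (fP k0).
- by apply: prode_ge0 => k _; apply: integral_ge0 => w _; rewrite lee_fin; case: (fP k).
move=> s; under eq_integral do rewrite -updE.
have GB : G k0 (f k0 @^-1` `]s, +oo[) by apply: (flt k0 _).1.
rewrite IH => [||].
- by rewrite prodE integral_indic ?setIT//; exact: (Gm k0).
- move=> k kj; rewrite /upd; case: eqP => [kk|_].
    by move: kj; rewrite kk /= ltnn.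
  by apply: flt; exact: ltnW.
- move=> k kj; rewrite /upd; case: eqP => [->|/eqP kk].
    by exists (f k0 @^-1` `]s, +oo[).
  apply: fge; rewrite ltn_neqAle kj andbT; apply: contra kk => /eqP jk.
  by apply/eqP/val_inj.
Qed.

End Independence.

(** * Gaussian variables *)

Section GaussianIntegrals.
Context (R : realType).

(** By the layer cake formula on both sides it is enough to compare superlevel sets, where the claim
    is the definition of [normal_prob]. *)
Lemma integral_normal_prob (m s : R) (f : R -> R) :
  measurable_fun setT f -> (forall x, 0 <= f x) ->
  (\int[normal_prob m s]_x (f x)%:E =
   \int[@lebesgue_measure R]_x (normal_pdf m s x * f x)%:E)%E.
Proof.
move=> mf f0; under eq_integral do rewrite -[f _]mul1r.
rewrite (layer_cake (normal_prob m s) (f := cst 1))//.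
rewrite [RHS]layer_cake//; last 2 first.
- exact: measurable_normal_pdf.
- by move=> x; exact: normal_pdf_ge0.
apply: eq_integral => y _.
have mA : measurable (f @^-1` `]y, +oo[) by rewrite -[_ @^-1` _]setTI; exact: mf.
under eq_integral do rewrite mul1r.
rewrite integral_indic// setIT.
transitivity (\int[@lebesgue_measure R]_(x in f @^-1` `]y, +oo[) (normal_pdf m s x)%:E)%E => //.
rewrite integral_mkcond; apply: eq_integral => x _; rewrite patchE indicE.
by case: ifPn => _; rewrite ?mulr1 ?mulr0.
Qed.

(** Completing the square: exponential tilting shifts the mean by l s^2. *)
Lemma normal_pdf_expR (m s l x : R) : s != 0 ->
  normal_pdf m s x * expR (l * (x - m)) =
  expR (l ^+ 2 * s ^+ 2 / 2) * normal_pdf (m + l * s ^+ 2) s x.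
Proof.
move=> s0; rewrite !normal_pdfE//= /normal_fun.
rewrite -(mulrA (normal_peak s)) -expRD mulrCA -expRD; congr (_ * expR _).
by rewrite -(mulr_natr (s ^+ 2)); field; rewrite s0.
Qed.

(** Completing the square again: the tilted density is normal with standard deviation s / q, where
    q^2 = 1 - 2 th s^2, and the change of the peak leaves the factor 1 / q. *)
Lemma normal_pdf_expR_sqr (m s th x : R) : 0 < s -> 2 * th * s ^+ 2 < 1 ->
  normal_pdf m s x * expR (th * (x - m) ^+ 2) =
  (Num.sqrt (1 - 2 * th * s ^+ 2))^-1 *
    normal_pdf m (s / Num.sqrt (1 - 2 * th * s ^+ 2)) x.
Proof.
move=> s0 ths; set q := Num.sqrt _.
have q0 : 0 < q by rewrite sqrtr_gt0 subr_gt0.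
have q2 : q ^+ 2 = 1 - 2 * th * s ^+ 2 by rewrite sqr_sqrtr// subr_ge0 ltW.
rewrite !normal_pdfE ?gt_eqF ?divr_gt0//= /normal_fun /normal_peak.
rewrite -(mulrA (_^-1)) -expRD (mulrA _^-1); congr (_ * expR _); last first.
  rewrite -(mulr_natr (s ^+ 2)) -(mulr_natr (_ ^+ 2)) expr_div_n q2; field.
  by rewrite -q2 !expf_neq0 ?gt_eqF.
rewrite -invfM; congr (_^-1).
have qE : q = Num.sqrt (q ^+ 2) by rewrite sqrtr_sqr gtr0_norm.
rewrite expr_div_n {1}qE -sqrtrM ?sqr_ge0//.
by congr Num.sqrt; rewrite -(mulr_natr (s ^+ 2 * pi)) -(mulr_natr (_ * pi)); field; rewrite gt_eqF.
Qed.

End GaussianIntegrals.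

(** * Moment generating functions of Gaussian variables *)

Section GaussianLaw.
Context (R : realType) (d : measure_display) (T : measurableType d).
Variable P : probability T R.

Definition gaussian_law (f : T -> R) (mu v : R) :=
  measurable_fun setT f /\
  forall A, measurable A -> P (f @^-1` A) = gaussian_prob mu v A.

Lemma gaussian_law_dirac (f : T -> R) (mu : R) (phi : R -> R) :
  gaussian_law f mu 0 -> measurable_fun setT phi -> (forall x, 0 <= phi x) ->
  (\int[P]_w (phi (f w))%:E = (phi mu)%:E)%E.
Proof.
move=> [mf fP] mphi phi0.
transitivity (\int[pushforward P f]_x (phi x)%:E)%E.
  rewrite ge0_integral_pushforward//; first exact/measurable_EFinP.
  by move=> x _; rewrite lee_fin.
transitivity (\int[\d_mu]_x (phi x)%:E)%E.
  apply: eq_measure_integral => A mA _.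
  by transitivity (gaussian_prob mu 0 A); [exact: fP|rewrite /gaussian_prob eqxx].
by rewrite integral_dirac// ?diracE ?in_setT ?mul1e//; exact/measurable_EFinP.
Qed.

Lemma gaussian_law_density (f : T -> R) (mu v : R) (phi : R -> R) : 0 < v ->
  gaussian_law f mu v -> measurable_fun setT phi -> (forall x, 0 <= phi x) ->
  (\int[P]_w (phi (f w))%:E =
   \int[@lebesgue_measure R]_x (normal_pdf mu (Num.sqrt v) x * phi x)%:E)%E.
Proof.
move=> v0 [mf fP] mphi phi0.
pose g : T -> measurableTypeR R := f.
have mg : measurable_fun setT g by exact: mf.
transitivity (\int[pushforward P g]_x (phi x)%:E)%E.
  rewrite ge0_integral_pushforward//; first exact/measurable_EFinP.
  by move=> x _; rewrite lee_fin.
rewrite -integral_normal_prob//.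
apply: eq_measure_integral => A mA _.
by transitivity (gaussian_prob mu v A); [exact: fP|rewrite /gaussian_prob gt_eqF].
Qed.

Lemma gaussian_mgf (f : T -> R) (mu v l : R) : 0 <= v -> gaussian_law f mu v ->
  (\int[P]_w (expR (l * (f w - mu)))%:E = (expR (l ^+ 2 * v / 2))%:E)%E.
Proof.
move=> v0 fL.
have mphi : measurable_fun setT (fun x : R => expR (l * (x - mu))).
  apply: measurableT_comp => //; apply: measurable_funM => //.
  exact: measurable_funB.
move: v0; rewrite le_eqVlt => /predU1P[v0|v0].
  rewrite -v0 in fL *.
  rewrite (gaussian_law_dirac fL mphi) => [|x]; last exact: expR_ge0.
  by rewrite subrr !mulr0 mul0r.
rewrite (gaussian_law_density v0 fL mphi) => [|x]; last exact: expR_ge0.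
have s0 : Num.sqrt v != 0 by rewrite gt_eqF// sqrtr_gt0.
under eq_integral do rewrite normal_pdf_expR// EFinM.
rewrite ge0_integralZl_EFin//.
- by rewrite integral_normal_pdf mule1 sqr_sqrtr// ltW.
- by move=> x _; rewrite lee_fin normal_pdf_ge0.
- by apply/measurable_EFinP; exact: measurable_normal_pdf.
Qed.

(** Negative [th] is allowed; the computation of the second moment uses both signs. *)
Lemma gaussian_sqr_mgf (f : T -> R) (mu v th : R) : 0 <= v -> gaussian_law f mu v ->
  2 * th * v < 1 ->
  (\int[P]_w (expR (th * (f w - mu) ^+ 2))%:E = ((Num.sqrt (1 - 2 * th * v))^-1)%:E)%E.
Proof.
move=> v0 fL thv.
have mphi : measurable_fun setT (fun x : R => expR (th * (x - mu) ^+ 2)).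
  apply: measurableT_comp => //; apply: measurable_funM => //.
  by apply: measurable_funX; exact: measurable_funB.
move: v0; rewrite le_eqVlt => /predU1P[v0|v0].
  rewrite -v0 in fL *.
  rewrite (gaussian_law_dirac fL mphi) => [|x]; last exact: expR_ge0.
  by rewrite subrr expr0n !mulr0 subr0 sqrtr1 invr1 expR0.
rewrite (gaussian_law_density v0 fL mphi) => [|x]; last exact: expR_ge0.
have s0 : 0 < Num.sqrt v by rewrite sqrtr_gt0.
have s2 : Num.sqrt v ^+ 2 = v by rewrite sqr_sqrtr// ltW.
under eq_integral do rewrite normal_pdf_expR_sqr ?s2// EFinM.
rewrite ge0_integralZl_EFin//.
- by rewrite integral_normal_pdf mule1.
- by move=> x _; rewrite lee_fin normal_pdf_ge0.
- by apply/measurable_EFinP; exact: measurable_normal_pdf.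
Qed.
End GaussianLaw.

(** * Bernstein bound *)

Section Moments.
Context (R : realType) (d : measure_display) (T : measurableType d).
Variable P : probability T R.

(** For x >= 0, insert exp x <= 1 + x exp x into itself. For x = - t < 0, use exp (- t) <= 1 / (1 +
    t) <= 1 - t + t^2. *)
Lemma expR_le_taylor2 (x : R) : expR x <= 1 + x + x ^+ 2 * expR `|x|.
Proof.
have [x0|x0] := leP 0 x.
  have h : expR x <= 1 + x * expR x.
    have := expR_ge1Dx (- x); rewrite -(ler_pM2r (expR_gt0 x)) -expRD addNr expR0.
    by lra.
  have := ler_wpM2l x0 h; rewrite mulrDr mulr1 mulrA -expr2 ger0_norm//; lra.
have [t t0 ->] : exists2 t, 0 < t & x = - t.
  by exists (- x); rewrite ?oppr_gt0 ?opprK.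
have h1 : expR (- t) <= 1 - t + t ^+ 2.
  have := expR_ge1Dx t => h; rewrite expRN.
  have : (expR t)^-1 <= (1 + t)^-1 by rewrite lef_pV2 ?posrE ?expR_gt0//; lra.
  move=> /le_trans; apply.
  rewrite -[leLHS]mul1r ler_pdivrMr; last by lra.
  have : 0 <= t ^+ 3 by rewrite exprn_ge0// ltW.
  rewrite !exprS expr0; nra.
have h2 : 1 <= expR t by have := expR_ge1Dx t; lra.
rewrite sqrrN normrN gtr0_norm//.
have := ler_wpM2l (sqr_ge0 t) h2; lra.
Qed.

(** The weight exp (z / 8), with z = |y|, is split in two: one half dominates exp (th z), the other
    dominates z^2 up to 1024 = 32^2, because z <= 32 exp (z / 32). *)
Lemma expR_le_bernstein (y th : R) : 0 <= th <= 16^-1 ->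
  expR (- th * y) <= 1 - th * y + 1024 * th ^+ 2 * expR (`|y| / 8).
Proof.
move=> /andP[th0 th16].
rewrite (le_trans (expR_le_taylor2 _))// mulNr lerD2l sqrrN exprMn normrN normrM.
rewrite (ger0_norm th0).
suff key : y ^+ 2 * expR (th * `|y|) <= 1024 * expR (`|y| / 8).
  by have := ler_wpM2l (sqr_ge0 th) key; lra.
set z := `|y|; have z0 : 0 <= z by exact: normr_ge0.
have -> : y ^+ 2 = z ^+ 2 by rewrite /z real_normK ?num_real.
have e1 : expR (th * z) <= expR (z / 16).
  by rewrite ler_expR [leRHS]mulrC ler_wpM2r.
have e2 : z ^+ 2 <= 1024 * expR (z / 16).
  have h : 1 + z / 16 / 2 <= expR (z / 16 / 2) by exact: expR_ge1Dx.
  have -> : expR (z / 16) = expR (z / 16 / 2) ^+ 2.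
    by rewrite -expRM_natl; congr expR; field.
  nra.
have -> : expR (z / 8) = expR (z / 16) * expR (z / 16).
  by rewrite -expRD; congr expR; field.
by rewrite mulrA; apply: ler_pM; rewrite ?sqr_ge0 ?expR_ge0.
Qed.

Lemma integral_one : (\int[P]_w 1 = 1)%E.
Proof. by rewrite integral_cst// mul1e; exact: probability_setT. Qed.

(** Integrate the pointwise bound, then use 1 + x <= exp x. The law of [y] enters only through its
    mean and one exponential moment. *)
Lemma integral_expR_bernstein (y : T -> R) (rho th K : R) :
  measurable_fun setT y -> P.-integrable setT (EFin \o y) ->
  (\int[P]_w (y w)%:E = rho%:E)%E ->
  (\int[P]_w (expR (`|y w| / 8))%:E <= K%:E)%E -> 0 <= th <= 16^-1 ->
  (\int[P]_w (expR (- th * y w))%:E <= (expR (- th * rho + 1024 * K * th ^+ 2))%:E)%E.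
Proof.
move=> my iy Ey EK th16.
have th0 : 0 <= th by case/andP: th16.
have mG : measurable_fun setT (fun w => expR (`|y w| / 8)).
  apply: measurableT_comp => //; apply: measurable_funM => //.
  exact: measurableT_comp.
have G0 w : (0 <= (expR (`|y w| / 8))%:E)%E by rewrite lee_fin expR_ge0.
have iG : P.-integrable setT (fun w => (expR (`|y w| / 8))%:E).
  apply/integrableP; split; first exact/measurable_EFinP.
  under eq_integral do rewrite gee0_abs//.
  by rewrite (le_lt_trans EK)// ltry.
apply: (@le_trans _ _ (\int[P]_w (1 + (- th)%:E * (y w)%:E +
     (1024 * th ^+ 2)%:E * (expR (`|y w| / 8))%:E))%E).
  apply: ge0_le_integral => //.
  - apply/measurable_EFinP; apply: measurableT_comp => //.
    exact: measurable_funM.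
  - under eq_fun do rewrite -!EFinM -!EFinD; apply/measurable_EFinP.
    apply: measurable_funD; last exact: measurable_funM.
    by apply: measurable_funD => //; exact: measurable_funM.
  - move=> w _; rewrite -!EFinM -!EFinD lee_fin.
    by rewrite (le_trans (expR_le_bernstein (y w) th16))// mulNr.
have i1 : P.-integrable setT (cst 1%E : T -> \bar R).
  by apply: finite_measure_integrable_cst.
have iy' : P.-integrable setT (fun w => (- th)%:E * (y w)%:E)%E by exact: integrableZl.
have iG' : P.-integrable setT (fun w => (1024 * th ^+ 2)%:E * (expR (`|y w| / 8))%:E)%E.
  exact: integrableZl.
rewrite integralD//; last exact: integrableD.
rewrite integralD// integral_one !integralZl// Ey.
rewrite -EFinM -EFinD.
have : ((1024 * th ^+ 2)%:E * \int[P]_w (expR (`|y w| / 8))%:E <= (1024 * th ^+ 2)%:E * K%:E)%E.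
  have c0 : (0 <= (1024 * th ^+ 2)%:E)%E by rewrite lee_fin mulr_ge0 ?ler0n ?sqr_ge0.
  exact: lee_wpmul2l c0 _ _ EK.
move=> /(leeD2l (1 - th * rho)%:E)/le_trans.
rewrite mulNr => /(_ _ _)->//; rewrite -EFinM -EFinD lee_fin.
apply: le_trans (expR_ge1Dx _); lra.
Qed.

Lemma gaussian_quarter_sqr_mgf (f : T -> R) (mu v : R) : 0 <= v <= 1 ->
  gaussian_law P f mu v ->
  (\int[P]_w (expR ((f w - mu) ^+ 2 / 4))%:E <= 2%:E)%E.
Proof.
move=> /andP[v0 v1] fL; under eq_integral do rewrite mulrC.
rewrite (gaussian_sqr_mgf v0 fL); last by lra.
rewrite lee_fin invf_ple ?posrE//; last by rewrite sqrtr_gt0; lra.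
rewrite -[leLHS]ger0_norm// -sqrtr_sqr ler_sqrt; last by lra.
by rewrite !expr2; lra.
Qed.

Lemma sqrtr_inv_le_up (x : R) : 0 <= x -> 4 * x <= 1 ->
  (Num.sqrt (1 - 2 * x))^-1 <= 1 + x + 4 * x ^+ 2.
Proof.
move=> x0 x4; have D0 : 0 < 1 + x + 4 * x ^+ 2 by have := sqr_ge0 x; lra.
rewrite invf_ple ?posrE//; last by rewrite sqrtr_gt0; lra.
rewrite -[leLHS]ger0_norm ?invr_ge0 ?(ltW D0)// -sqrtr_sqr ler_sqrt; last by lra.
rewrite exprVn -[leLHS]mul1r ler_pdivrMr ?exprn_gt0//.
have -> : (1 - 2 * x) * (1 + x + 4 * x ^+ 2) ^+ 2 =
  1 + x ^+ 2 * (5 - 10 * x - 32 * x ^+ 3) by ring.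
rewrite lerDl mulr_ge0// ?sqr_ge0//.
have : x ^+ 3 <= 16^-1 * x; last by lra.
by rewrite exprS mulrC ler_wpM2r// expr2; nra.
Qed.

Lemma sqrtr_inv_le_down (x : R) : 0 <= x -> x <= 1 ->
  (Num.sqrt (1 + 2 * x))^-1 <= 1 - x + 2 * x ^+ 2.
Proof.
move=> x0 x1; have D0 : 0 < 1 - x + 2 * x ^+ 2 by have := sqr_ge0 x; nra.
rewrite invf_ple ?posrE//; last by rewrite sqrtr_gt0; lra.
rewrite -[leLHS]ger0_norm ?invr_ge0 ?(ltW D0)// -sqrtr_sqr ler_sqrt; last by lra.
rewrite exprVn -[leLHS]mul1r ler_pdivrMr ?exprn_gt0//.
have -> : (1 + 2 * x) * (1 - x + 2 * x ^+ 2) ^+ 2 =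
  1 + x ^+ 2 * (1 + 6 * x - 4 * x ^+ 2 + 8 * x ^+ 3) by ring.
rewrite lerDl mulr_ge0// ?sqr_ge0//.
have x30 : 0 <= x ^+ 3 by rewrite exprn_ge0.
have : x ^+ 2 <= x by rewrite expr2 ler_piMr.
lra.
Qed.

(** The second moment is the derivative at 0 of the moment generating function of the square Z,
    extracted by inequalities: 1 + th Z <= exp (th Z) bounds it above and 1 - th Z <= exp (- th Z)
    bounds it below. The expansions of (1 -+ 2 x)^(-1/2) leave errors 4 th v^2 and 2 th v^2, which
    vanish with th. *)
Lemma gaussian_second_moment (f : T -> R) (mu v : R) : 0 <= v ->
  gaussian_law P f mu v -> (\int[P]_w ((f w - mu) ^+ 2)%:E = v%:E)%E.
Proof.
move=> v0 fL; have mf := fL.1.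
set m2 := (\int[P]_w _)%E.
have mZ : measurable_fun setT (fun w => (f w - mu) ^+ 2).
  by apply: measurable_funX; exact: measurable_funB.
have Z0 w : (0 <= ((f w - mu) ^+ 2)%:E)%E by rewrite lee_fin sqr_ge0.
have m20 : (0 <= m2)%E by apply: integral_ge0.
have lin th : 0 <= th -> (\int[P]_w (th * (f w - mu) ^+ 2)%:E = th%:E * m2)%E.
  move=> th0; under eq_integral do rewrite EFinM.
  by rewrite ge0_integralZl_EFin//; exact/measurable_EFinP.
have mE th : measurable_fun setT (fun w => expR (th * (f w - mu) ^+ 2)).
  by apply: measurableT_comp => //; exact: measurable_funM.
have upper th : 0 <= th -> 4 * th * v <= 1 ->
    (1 + th%:E * m2 <= (1 + th * v + 4 * th ^+ 2 * v ^+ 2)%:E)%E.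
  move=> th0 thv; rewrite -lin//.
  have <- : (\int[P]_w (1 + (th * (f w - mu) ^+ 2)%:E) =
      1 + \int[P]_w (th * (f w - mu) ^+ 2)%:E)%E.
    rewrite ge0_integralD//; first by rewrite integral_one.
      by move=> w _; rewrite lee_fin mulr_ge0// sqr_ge0.
    by apply/measurable_EFinP; exact: measurable_funM.
  apply: (@le_trans _ _ (\int[P]_w (expR (th * (f w - mu) ^+ 2))%:E)%E).
    apply: ge0_le_integral => //.
    - by move=> w _; rewrite -EFinD lee_fin addr_ge0// mulr_ge0// sqr_ge0.
    - under eq_fun do rewrite -EFinD; apply/measurable_EFinP.
      by apply: measurable_funD => //; exact: measurable_funM.
    - exact/measurable_EFinP.
    - by move=> w _; rewrite -EFinD lee_fin expR_ge1Dx.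
  rewrite (gaussian_sqr_mgf v0 fL); last by lra.
  have := sqrtr_inv_le_up (mulr_ge0 th0 v0); rewrite mulrA => /(_ thv).
  rewrite lee_fin mulrA exprMn; lra.
have m2fin : m2 \is a fin_num.
  rewrite ge0_fin_numE//.
  (* One admissible positive value is enough: an infinite second moment would make the left side of
     [upper] infinite. *)
  pose th := (4 * v + 1)^-1.
  have v1 : 0 < 4 * v + 1 by lra.
  have th0 : 0 < th by rewrite invr_gt0.
  have thv : 4 * th * v <= 1.
    by rewrite /th mulrAC ler_pdivrMr// mul1r; lra.
  have := upper th (ltW th0) thv; case: (m2) m20 => [r _ _|_|//]; first exact: ltry.
  by rewrite gt0_muley ?lte_fin//= leye_eq.
have [r m2E] : exists r, m2 = r%:E by exists (fine m2); rewrite fineK.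
rewrite m2E.
congr (_%:E); apply/eqP; rewrite eq_le; apply/andP; split.
  apply/ler_addgt0Pr => e e0.
  (* [q] is 1 / th: its first term makes th admissible in [upper], its last one makes the error 4
     v^2 / q at most e. *)
  pose q := 4 * v + 1 + 4 * v ^+ 2 / e.
  have q0 : 0 < q.
    by have : 0 <= 4 * v ^+ 2 / e; [rewrite divr_ge0 ?mulr_ge0 ?sqr_ge0// ltW|rewrite /q; lra].
  have vq : 4 * v <= q.
    by have : 0 <= 4 * v ^+ 2 / e; [rewrite divr_ge0 ?mulr_ge0 ?sqr_ge0// ltW|rewrite /q; lra].
  have eq : 4 * v ^+ 2 <= e * q.
    have -> : e * q = e * (4 * v + 1) + 4 * v ^+ 2 by rewrite /q; field; rewrite gt_eqF.
    by rewrite lerDr mulr_ge0 ?ltW//; lra.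
  have := upper q^-1; rewrite m2E -EFinM -EFinD lee_fin invr_ge0 (ltW q0) => /(_ isT).
  have -> : 4 * q^-1 * v = 4 * v / q by ring.
  rewrite ler_pdivrMr// mul1r => /(_ vq).
  rewrite -addrA lerD2l -(ler_pM2l q0) mulrA mulfV ?gt_eqF// mul1r.
  have -> : q * (q^-1 * v + 4 * q^-1 ^+ 2 * v ^+ 2) = v + 4 * v ^+ 2 / q.
    by field; rewrite gt_eqF.
  move=> /le_trans; apply; rewrite lerD2l ler_pdivrMr//.
have lower th : 0 <= th -> th * v <= 1 -> th * v - 2 * th ^+ 2 * v ^+ 2 <= th * r.
  move=> th0 thv.
  have : (1 <= \int[P]_w (expR (- th * (f w - mu) ^+ 2))%:E + th%:E * m2)%E.
    rewrite -lin// -ge0_integralD//;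
      do ?[by move=> w _; rewrite lee_fin mulr_ge0// sqr_ge0
          |by apply/measurable_EFinP => //; exact: measurable_funM].
    have {1}-> : 1%E = (\int[P]_w (cst 1%E w))%E.
      by rewrite integral_one.
    apply: ge0_le_integral => //.
    - under eq_fun do rewrite -EFinD; apply/measurable_EFinP.
      by apply: measurable_funD => //; exact: measurable_funM.
    - move=> w _; rewrite -EFinD lee_fin mulNr.
      by have := expR_ge1Dx (- (th * (f w - mu) ^+ 2)); lra.
  have thv0 : 0 <= th * v by rewrite mulr_ge0.
  rewrite (gaussian_sqr_mgf v0 fL); last by lra.
  rewrite m2E -EFinM -EFinD lee_fin.
  have := sqrtr_inv_le_down thv0 thv.
  have -> : 1 - 2 * - th * v = 1 + 2 * (th * v) by ring.
  rewrite exprMn; lra.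
apply/ler_addgt0Pr => e e0.
pose q := v + 1 + 2 * v ^+ 2 / e.
have q1 : 0 <= 2 * v ^+ 2 / e by rewrite divr_ge0 ?mulr_ge0 ?sqr_ge0// ltW.
have q0 : 0 < q by rewrite /q; lra.
have vq : v <= q by rewrite /q; lra.
have eq : 2 * v ^+ 2 <= e * q.
  have -> : e * q = e * (v + 1) + 2 * v ^+ 2 by rewrite /q; field; rewrite gt_eqF.
  by rewrite lerDr mulr_ge0 ?ltW//; lra.
have := lower q^-1; rewrite invr_ge0 (ltW q0) => /(_ isT).
rewrite mulrC ler_pdivrMr// mul1r => /(_ vq).
rewrite -(ler_pM2l q0) [leRHS]mulrA mulfV ?gt_eqF// mul1r.
have -> : q * (v / q - 2 * q^-1 ^+ 2 * v ^+ 2) = v - 2 * v ^+ 2 / q.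
  by field; rewrite gt_eqF.
have : 2 * v ^+ 2 / q <= e by rewrite ler_pdivrMr.
lra.
Qed.
End Moments.

(** * Expectations of products of two variables *)

Section ProductMoments.
Context (R : realType) (d : measure_display) (T : measurableType d).
Variable P : probability T R.

(** The superlevel principle is applied twice, once for each factor, which leaves the independence
    of two events. *)
Lemma integral_mul_indep (g h : T -> R) :
  measurable_fun setT g -> measurable_fun setT h ->
  (forall w, 0 <= g w) -> (forall w, 0 <= h w) ->
  (forall A B, measurable A -> measurable B ->
     P (g @^-1` A `&` h @^-1` B) = (P (g @^-1` A) * P (h @^-1` B))%E) ->
  (\int[P]_w (g w * h w)%:E = \int[P]_w (g w)%:E * \int[P]_w (h w)%:E)%E.
Proof.
move=> mg mh g0 h0 gh.
have mpre (f : T -> R) (A : set R) : measurable_fun setT f -> measurable A ->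
    measurable (f @^-1` A).
  by move=> mf mA; rewrite -[_ @^-1` _]setTI; exact: mf.
apply: integral_mul_superlevel => //.
  by apply: integral_ge0 => w _; rewrite lee_fin.
move=> s; under eq_integral do rewrite mulrC.
rewrite muleC; apply: integral_mul_superlevel => //.
  by apply: measurable_indic; exact: mpre.
move=> t; have -> : (P (h @^-1` `]s, +oo[) * P (g @^-1` `]t, +oo[) =
    P (g @^-1` `]t, +oo[ `&` h @^-1` `]s, +oo[))%E by rewrite gh// muleC.
transitivity (\int[P]_w (\1_(g @^-1` `]t, +oo[ `&` h @^-1` `]s, +oo[) w)%:E)%E.
  by apply: eq_integral => w _; rewrite indicI mulrC.
by rewrite integral_indic ?setIT//; apply: measurableI; exact: mpre.
Qed.

Lemma gaussian_integral_eq (f g : T -> R) (mu v : R) (phi : R -> R) : 0 <= v ->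
  gaussian_law P f mu v -> gaussian_law P g mu v ->
  measurable_fun setT phi -> (forall x, 0 <= phi x) ->
  (\int[P]_w (phi (f w))%:E = \int[P]_w (phi (g w))%:E)%E.
Proof.
rewrite le_eqVlt => /predU1P[<-|v0] fL gL mphi phi0.
  by rewrite (gaussian_law_dirac fL mphi phi0) (gaussian_law_dirac gL mphi phi0).
by rewrite (gaussian_law_density v0 fL mphi phi0) (gaussian_law_density v0 gL mphi phi0).
Qed.

Lemma integrable_sqr (f : T -> R) (v : R) : measurable_fun setT f ->
  (\int[P]_w (f w ^+ 2)%:E = v%:E)%E -> P.-integrable setT (fun w => (f w ^+ 2)%:E).
Proof.
move=> mf fv; apply/integrableP; split.
  by apply/measurable_EFinP; exact: measurable_funX.
under eq_integral do rewrite gee0_abs ?lee_fin ?sqr_ge0//.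
by rewrite fv ltry.
Qed.

Lemma integrable_mul_sqr (f g : T -> R) (v v' : R) :
  measurable_fun setT f -> measurable_fun setT g ->
  (\int[P]_w (f w ^+ 2)%:E = v%:E)%E -> (\int[P]_w (g w ^+ 2)%:E = v'%:E)%E ->
  P.-integrable setT (fun w => (f w * g w)%:E).
Proof.
move=> mf mg fv gv'.
apply: (@le_integrable _ _ _ _ _ _ _ (fun w => (f w ^+ 2)%:E + (g w ^+ 2)%:E)%E) => //.
- by apply/measurable_EFinP; exact: measurable_funM.
- move=> w _; rewrite -EFinD !abse_EFin lee_fin [leRHS]ger0_norm; last first.
    by rewrite addr_ge0// sqr_ge0.
  rewrite ler_norml; have := sqr_ge0 (f w + g w); have := sqr_ge0 (f w - g w).
  have := sqr_ge0 (f w); have := sqr_ge0 (g w).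
  rewrite sqrrB sqrrD; move: (f w ^+ 2) (g w ^+ 2) (f w * g w).
  by move=> a b c *; apply/andP; split; lra.
- by apply: integrableD => //; [exact: integrable_sqr fv|exact: integrable_sqr gv'].
Qed.

(** Factorization is available for nonnegative functions only, so both variables are split into
    positive and negative parts. As e and - e have the same law, the two parts of e have the same
    mean, and the positive and negative totals of e f cancel. *)
Lemma integral_mul_indep_symmetric (e f : T -> R) (s v : R) : 0 <= s ->
  gaussian_law P e 0 s -> gaussian_law P (fun w => - e w) 0 s ->
  measurable_fun setT f -> (\int[P]_w (f w ^+ 2)%:E = v%:E)%E ->
  (forall A B, measurable A -> measurable B ->
     P (e @^-1` A `&` f @^-1` B) = (P (e @^-1` A) * P (f @^-1` B))%E) ->
  P.-integrable setT (fun w => (e w * f w)%:E) /\ (\int[P]_w (e w * f w)%:E = 0)%E.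
Proof.
move=> s0 eL neL mf fv ef; have me := eL.1.
have e2 : (\int[P]_w (e w ^+ 2)%:E = s%:E)%E.
  rewrite -(gaussian_second_moment s0 eL).
  by apply: eq_integral => w _; rewrite subr0.
have ief := integrable_mul_sqr me mf e2 fv; split => //.
pose pos (x : R) := Num.max x 0.
have mpos : measurable_fun setT pos by apply: measurable_maxr.
have pos0 x : 0 <= pos x by rewrite /pos le_max lexx orbT.
pose posN (x : R) := pos (- x).
have mposN : measurable_fun setT posN.
  by apply: measurableT_comp => //; exact: oppr_measurable.
have posE x : x = pos x - pos (- x).
  by rewrite /pos; have [x0|x0] := leP x 0; case: (leP (- x)) => ?; lra.
pose I (phi psi : R -> R) := (\int[P]_w (phi (e w) * psi (f w))%:E)%E.
have IE (phi psi : R -> R) : measurable_fun setT phi -> measurable_fun setT psi ->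
    (forall x, 0 <= phi x) -> (forall x, 0 <= psi x) ->
    I phi psi = (\int[P]_w (phi (e w))%:E * \int[P]_w (psi (f w))%:E)%E.
  move=> mphi mpsi phi0 psi0; apply: integral_mul_indep => //.
  - exact: measurableT_comp.
  - exact: measurableT_comp.
  - move=> A B mA mB.
    apply: (ef (phi @^-1` A) (psi @^-1` B)).
      by rewrite -[_ @^-1` _]setTI; exact: mphi.
    by rewrite -[_ @^-1` _]setTI; exact: mpsi.
have eN : (\int[P]_w (pos (e w))%:E = \int[P]_w (pos (- e w))%:E)%E.
  exact: (gaussian_integral_eq s0 eL neL).
pose yp w := pos (e w) * pos (f w) + pos (- e w) * pos (- f w).
pose yn w := pos (e w) * pos (- f w) + pos (- e w) * pos (f w).
have yE w : e w * f w = yp w - yn w.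
  by rewrite {1}(posE (e w)) {1}(posE (f w)) /yp /yn; ring.
have mc (phi psi : R -> R) : measurable_fun setT phi -> measurable_fun setT psi ->
    measurable_fun setT (fun w => (phi (e w) * psi (f w))%:E).
  move=> mphi mpsi; apply/measurable_EFinP/measurable_funM; exact: measurableT_comp.
have ypE : (\int[P]_w (yp w)%:E = I pos pos + I posN posN)%E.
  rewrite /yp; under eq_integral do rewrite EFinD.
  rewrite ge0_integralD//; first [by move=> w _; rewrite lee_fin mulr_ge0|exact: (mc pos pos)|exact: (mc posN posN)|exact: (mc pos posN)|exact: (mc posN pos)].
have ynE : (\int[P]_w (yn w)%:E = I pos posN + I posN pos)%E.
  rewrite /yn; under eq_integral do rewrite EFinD.
  rewrite ge0_integralD//; first [by move=> w _; rewrite lee_fin mulr_ge0|exact: (mc pos pos)|exact: (mc posN posN)|exact: (mc pos posN)|exact: (mc posN pos)].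
have ypn : (\int[P]_w (yp w)%:E = \int[P]_w (yn w)%:E)%E.
  have eN' : (\int[P]_w (posN (e w))%:E = \int[P]_w (pos (e w))%:E)%E by rewrite eN.
  have posN0 x : 0 <= posN x by exact: pos0.
  rewrite ypE ynE (IE pos pos)// (IE posN posN)// (IE pos posN)// (IE posN pos)//.
  by rewrite eN' addeC.
have absE x : `|x| = pos x + pos (- x).
  by rewrite /pos; case: (ger0P x) => x0; case: (leP x 0) => ?; case: (leP (- x) 0) => ?; lra.
have ypn_abs w : yp w + yn w = `|e w * f w|.
  by rewrite normrM !absE /yp /yn; ring.
have yp0 w : 0 <= yp w by rewrite addr_ge0// mulr_ge0.
have yn0 w : 0 <= yn w by rewrite addr_ge0// mulr_ge0.
have iyp : P.-integrable setT (fun w => (yp w)%:E).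
  apply: le_integrable ief => //.
    rewrite /yp; under eq_fun do rewrite EFinD; apply: emeasurable_funD;
      first [exact: (mc pos pos)|exact: (mc posN posN)|exact: (mc pos posN)|exact: (mc posN pos)].
  by move=> w _; rewrite !abse_EFin lee_fin -ypn_abs ger0_norm// lerDl.
have iyn : P.-integrable setT (fun w => (yn w)%:E).
  apply: le_integrable ief => //.
    rewrite /yn; under eq_fun do rewrite EFinD; apply: emeasurable_funD;
      first [exact: (mc pos pos)|exact: (mc posN posN)|exact: (mc pos posN)|exact: (mc posN pos)].
  by move=> w _; rewrite !abse_EFin lee_fin -ypn_abs ger0_norm// lerDr.
under eq_integral do rewrite yE EFinB.
rewrite integralB// ypn subee//; exact: integrable_fin_num.
Qed.
End ProductMoments.

(** * Linear forms in the rows *)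

Section Rows.
Context (R : realType) (d : measure_display) (T : measurableType d).
Variable P : probability T R.
Variables (n p m : nat) (X : T -> 'M[R]_(n, p)) (E : T -> 'M[R]_(n, m)).
Variables (mu : 'rV[R]_p) (Sx : 'M[R]_p) (S : 'M[R]_m).
Hypothesis gaussX : forall i : 'I_n, mvgaussian P (fun w => row i (X w)) mu Sx.
Hypothesis gaussE : forall i : 'I_n, mvgaussian P (fun w => row i (E w)) 0 S.
Hypothesis indep : independent_rows P X E.

Definition sigmaX (k : 'I_n) : set (set T) := sigma_vector (fun w => row k (X w)).
Definition sigmaE (k : 'I_n) : set (set T) := sigma_vector (fun w => row k (E w)).
(** A pi-system generating the sigma-algebra of the pair formed by the k-th rows of X and E. *)
Definition row_generators (k : 'I_n) : set (set T) :=
  [set A `&` B | A in sigmaX k & B in sigmaE k].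
(** [T] with the sigma-algebra of the k-th pair of rows: depending only on these rows becomes
    ordinary measurability, with its closure lemmas. *)
Definition row_type (k : 'I_n) := g_sigma_algebraType (row_generators k).

Definition xlin (a : 'cV[R]_p) (k : 'I_n) (w : T) : R := ((row k (X w) - mu) *m a) 0 0.
Definition elin (b : 'cV[R]_m) (k : 'I_n) (w : T) : R := (row k (E w) *m b) 0 0.

Lemma sigma_vector_measurable q (V : T -> 'rV[R]_q) :
  (forall j, measurable_fun setT (fun w => V w 0 j)) -> sigma_vector V `<=` measurable.
Proof.
move=> mV; apply: smallest_sub; first exact: sigma_algebra_measurable.
rewrite -bigcup_seq => A [j _ [B mB <-]]; exact: mV.
Qed.

Lemma sigma_vector_coord q (V : T -> 'rV[R]_q) j (B : set R) : measurable B ->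
  sigma_vector V ((fun w => V w 0 j) @^-1` B).
Proof.
move=> mB; apply: sub_sigma_algebra; rewrite -bigcup_seq; exists j => //=.
  by rewrite mem_index_enum.
by exists B; rewrite // setTI.
Qed.

Lemma sigma_vector_setI q (V : T -> 'rV[R]_q) : setI_closed (sigma_vector V).
Proof.
move=> A B VA VB.
exact: (@measurableI _ (g_sigma_algebraType (\big[setU/set0]_(i < q)
  preimage_set_system setT (fun w => V w 0 i) measurable)) A B VA VB).
Qed.

Lemma sigma_vector_setT q (V : T -> 'rV[R]_q) : sigma_vector V setT.
Proof.
exact: (@measurableT _ (g_sigma_algebraType (\big[setU/set0]_(i < q)
  preimage_set_system setT (fun w => V w 0 i) measurable))).
Qed.

Lemma sigma_vector_affine q (V : T -> 'rV[R]_q) (c : 'rV[R]_q) (a : 'cV[R]_q) (B : set R) :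
  measurable B -> sigma_vector V ((fun w => ((V w - c) *m a) 0 0) @^-1` B).
Proof.
move=> mB.
pose TV := g_sigma_algebraType (\big[setU/set0]_(i < q)
  preimage_set_system setT (fun w => V w 0 i) measurable).
have : measurable_fun setT ((fun w => \sum_j (V w 0 j - c 0 j) * a j 0) : TV -> R).
  apply: measurable_sum => j; apply: measurable_funM => //; apply: measurable_funB => //.
  by move=> _ A mA; rewrite setTI; exact: sigma_vector_coord.
move=> /(_ measurableT B mB); rewrite setTI.
have -> // : (fun w => ((V w - c) *m a) 0 0) = (fun w => \sum_j (V w 0 j - c 0 j) * a j 0).
by apply/funext => w; rewrite mxE; apply: eq_bigr => j _; rewrite !mxE.
Qed.

Lemma sigmaX_measurable k : sigmaX k `<=` measurable.
Proof. by apply: sigma_vector_measurable; case: (gaussX k). Qed.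

Lemma sigmaE_measurable k : sigmaE k `<=` measurable.
Proof. by apply: sigma_vector_measurable; case: (gaussE k). Qed.

Lemma row_generators_setI k : setI_closed (row_generators k).
Proof.
move=> _ _ [A XA [B EB <-]] [A' XA' [B' EB' <-]].
by exists (A `&` A'); [exact: sigma_vector_setI|exists (B `&` B'); [exact: sigma_vector_setI|rewrite setIACA]].
Qed.

Lemma row_generators_measurable k : row_generators k `<=` measurable.
Proof.
by move=> _ [A XA [B EB <-]]; apply: measurableI; [exact: sigmaX_measurable XA|exact: sigmaE_measurable EB].
Qed.

Lemma indep_pair k A B : sigmaX k A -> sigmaE k B -> P (A `&` B) = (P A * P B)%E.
Proof.
move=> XA EB.
pose C (i : 'I_n + 'I_n) := if i is inl _ then A else B.
have := indep (J := [set inl k; inr k]%SET) (A := C).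
have -> : \bigcap_(i in [set` [set inl k; inr k]%SET]) C i = A `&` B.
  apply/seteqP; split => w.
    by move=> h; split; [apply: (h (inl k))|apply: (h (inr k))]; rewrite /= !inE eqxx ?orbT.
  by move=> [Aw Bw] [i|i].
rewrite big_setU1/= ?big_set1/=; last by rewrite inE.
by apply=> i; rewrite !inE => /orP[] /eqP ->.
Qed.

Lemma indep_row_generators (C : 'I_n -> set T) : (forall k, row_generators k (C k)) ->
  P (\bigcap_k C k) = (\prod_k P (C k))%E.
Proof.
move=> GC.
have /choice[AB ABP] : forall k, exists AB : set T * set T,
    [/\ sigmaX k AB.1, sigmaE k AB.2 & C k = AB.1 `&` AB.2].
  by move=> k; have [A XA [B EB <-]] := GC k; exists (A, B).
pose F (i : 'I_n + 'I_n) := match i with inl k => (AB k).1 | inr k => (AB k).2 end.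
have := indep (J := [set: 'I_n + 'I_n]%SET) (A := F).
have -> : \bigcap_(i in [set` [set: 'I_n + 'I_n]%SET]) F i = \bigcap_k C k.
  apply/seteqP; split => w h.
    move=> k _; have [_ _ ->] := ABP k; split.
      by apply: (h (inl k)); rewrite /= inE.
    by apply: (h (inr k)); rewrite /= inE.
  by move=> [k|k] _; have := h k I; have [_ _ ->] := ABP k => -[].
move=> ->; last by move=> [k|k] _; case: (ABP k).
under eq_bigl do rewrite inE.
rewrite big_sumType/= -big_split/=; apply: eq_bigr => k _.
by have [XA EB ->] := ABP k; rewrite (indep_pair XA EB).
Qed.

(** Grouping: the 2n independent rows form n independent pairs. *)
Lemma indep_rows (C : 'I_n -> set T) : (forall k, <<s row_generators k >> (C k)) ->
  P (\bigcap_k C k) = (\prod_k P (C k))%E.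
Proof.
apply: indep_family_g_sigma_algebra => //.
- exact: row_generators_setI.
- exact: row_generators_measurable.
- move=> k; exists setT; first exact: sigma_vector_setT.
  by exists setT; [exact: sigma_vector_setT|rewrite setTI].
- exact: indep_row_generators.
Qed.

Lemma row_sigma_measurable k : <<s row_generators k >> `<=` measurable.
Proof.
by apply: smallest_sub; [exact: sigma_algebra_measurable|exact: row_generators_measurable].
Qed.

Lemma xlin_sigmaX a k (B : set R) : measurable B -> sigmaX k (xlin a k @^-1` B).
Proof.
have -> : xlin a k = (fun w => ((row k (X w) - mu) *m a) 0 0) by [].
exact: sigma_vector_affine.
Qed.

Lemma elin_sigmaE b k (B : set R) : measurable B -> sigmaE k (elin b k @^-1` B).
Proof.
have -> : elin b k = (fun w => ((row k (E w) - 0) *m b) 0 0).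
  by apply/funext => w; rewrite subr0.
exact: sigma_vector_affine.
Qed.

Lemma xlin_row a k : measurable_fun setT (xlin a k : row_type k -> R).
Proof.
move=> _ B mB; rewrite setTI; apply: sub_sigma_algebra.
exists (xlin a k @^-1` B); first exact: xlin_sigmaX.
by exists setT; [exact: sigma_vector_setT|rewrite setIT].
Qed.

Lemma elin_row b k : measurable_fun setT (elin b k : row_type k -> R).
Proof.
move=> _ B mB; rewrite setTI; apply: sub_sigma_algebra.
exists setT; first exact: sigma_vector_setT.
by exists (elin b k @^-1` B); [exact: elin_sigmaE|rewrite setTI].
Qed.

Lemma row_measurable_fun k (f : T -> R) :
  @measurable_fun _ _ (row_type k) _ setT f -> @measurable_fun _ _ T _ setT f.
Proof.
by move=> mf _ B mB; rewrite setTI; apply: (@row_sigma_measurable k); have := mf measurableT B mB; rewrite setTI.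
Qed.

Definition quad q (A : 'M[R]_q) (a : 'cV[R]_q) : R := (a^T *m A *m a) 0 0.

Lemma xlin_measurable a k : measurable_fun setT (xlin a k).
Proof. exact: row_measurable_fun (@xlin_row a k). Qed.

Lemma elin_measurable b k : measurable_fun setT (elin b k).
Proof. exact: row_measurable_fun (@elin_row b k). Qed.

Lemma quadX_ge0 a : (0 < n)%N -> 0 <= quad Sx a.
Proof. by case: n X gaussX => // n' X' gX' _; have [[_ +] _ _] := gX' ord0; exact. Qed.

Lemma quadE_ge0 b : (0 < n)%N -> 0 <= quad S b.
Proof. by case: n E gaussE => // n' E' gE' _; have [[_ +] _ _] := gE' ord0; exact. Qed.

Lemma xlinE a k w : xlin a k w = (row k (X w) *m a) 0 0 - (mu *m a) 0 0.
Proof. by rewrite /xlin mulmxBl !mxE. Qed.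

Lemma xlin_mxE a k w : xlin a k w = ((X w - const_mx 1 *m mu) *m a) k 0.
Proof.
rewrite /xlin (_ : row k (X w) - mu = row k (X w - const_mx 1 *m mu)).
  by rewrite -row_mul mxE.
by apply/rowP => j; rewrite !mxE big_ord1 !mxE mul1r.
Qed.

Lemma elin0 k w : elin 0 k w = 0.
Proof. by rewrite /elin mulmx0 mxE. Qed.

Lemma elin_mxE b k w : elin b k w = (E w *m b) k 0.
Proof. by rewrite /elin -row_mul mxE. Qed.

Lemma xlin_law a k :
  gaussian_law P (fun w => (row k (X w) *m a) 0 0) ((mu *m a) 0 0) (quad Sx a).
Proof.
split; last by move=> A mA; have [_ _ /(_ a A mA)] := gaussX k.
rewrite (_ : (fun w => _) = (fun w => xlin a k w + (mu *m a) 0 0)); last first.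
  by apply/funext => w; rewrite xlinE subrK.
by apply: measurable_funD => //; exact: xlin_measurable.
Qed.

Lemma elin_law b k : gaussian_law P (elin b k) 0 (quad S b).
Proof.
split; first exact: elin_measurable.
by move=> A mA; have [_ _ /(_ b A mA)] := gaussE k; rewrite mul0mx mxE.
Qed.

Lemma ord_gt0 (k : 'I_n) : (0 < n)%N.
Proof. exact: leq_ltn_trans (ltn_ord k). Qed.

Lemma xlin_mgf a k l : (\int[P]_w (expR (l * xlin a k w))%:E =
  (expR (l ^+ 2 * quad Sx a / 2))%:E)%E.
Proof.
rewrite -(gaussian_mgf l (quadX_ge0 a (ord_gt0 k)) (xlin_law a k)).
by apply: eq_integral => w _; rewrite xlinE.
Qed.

Lemma elin_mgf b k l : (\int[P]_w (expR (l * elin b k w))%:E =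
  (expR (l ^+ 2 * quad S b / 2))%:E)%E.
Proof.
rewrite -(gaussian_mgf l (quadE_ge0 b (ord_gt0 k)) (elin_law b k)).
by apply: eq_integral => w _; rewrite subr0.
Qed.

Lemma xlin_quarter_sqr_mgf a k : quad Sx a <= 1 ->
  (\int[P]_w (expR (xlin a k w ^+ 2 / 4))%:E <= 2%:E)%E.
Proof.
move=> a1; have a01 : 0 <= quad Sx a <= 1 by rewrite quadX_ge0// (ord_gt0 k).
apply: le_trans (gaussian_quarter_sqr_mgf a01 (xlin_law a k)).
by rewrite le_eqVlt; apply/predU1P; left; apply: eq_integral => w _; rewrite xlinE.
Qed.

Lemma elin_quarter_sqr_mgf b k : quad S b <= 1 ->
  (\int[P]_w (expR (elin b k w ^+ 2 / 4))%:E <= 2%:E)%E.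
Proof.
move=> b1; have b01 : 0 <= quad S b <= 1 by rewrite quadE_ge0// (ord_gt0 k).
apply: le_trans (gaussian_quarter_sqr_mgf b01 (elin_law b k)).
by rewrite le_eqVlt; apply/predU1P; left; apply: eq_integral => w _; rewrite subr0.
Qed.

Lemma xlin_sqr a k : (\int[P]_w (xlin a k w ^+ 2)%:E = (quad Sx a)%:E)%E.
Proof.
rewrite -(gaussian_second_moment (quadX_ge0 a (ord_gt0 k)) (xlin_law a k)).
by apply: eq_integral => w _; rewrite xlinE.
Qed.

Lemma xlinD a b k w : xlin (a + b) k w = xlin a k w + xlin b k w.
Proof. by rewrite /xlin mulmxDr mxE. Qed.

Lemma xlin_integrable_mul a b k : P.-integrable setT (fun w => (xlin a k w * xlin b k w)%:E).
Proof.
exact: (integrable_mul_sqr (@xlin_measurable a k) (@xlin_measurable b k) (xlin_sqr a k) (xlin_sqr b k)).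
Qed.

(** Polarization of the second moment at a + b. *)
Lemma xlin_mul a b k :
  (\int[P]_w (xlin a k w * xlin b k w)%:E = ((a^T *m Sx *m b) 0 0)%:E)%E.
Proof.
have Sxt : Sx^T = Sx by have [[]] := gaussX k.
have i2 c : P.-integrable setT (fun w => (xlin c k w ^+ 2)%:E).
  exact: (integrable_sqr (@xlin_measurable c k) (xlin_sqr c k)).
have := xlin_sqr (a + b) k.
have -> : (\int[P]_w (xlin (a + b) k w ^+ 2)%:E = \int[P]_w ((xlin a k w ^+ 2)%:E
    + 2%:E * (xlin a k w * xlin b k w)%:E + (xlin b k w ^+ 2)%:E))%E.
  by apply: eq_integral => w _; rewrite xlinD -EFinM -!EFinD; congr (_%:E); ring.
rewrite integralD//; last first.
  by apply: integrableD => //; apply: integrableZl => //; exact: xlin_integrable_mul.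
rewrite integralD//; last by apply: integrableZl => //; exact: xlin_integrable_mul.
rewrite integralZl//; last exact: xlin_integrable_mul.
have [r rE] : exists r, (\int[P]_w (xlin a k w * xlin b k w)%:E = r%:E)%E.
  exists (fine (\int[P]_w (xlin a k w * xlin b k w)%:E)); rewrite fineK//.
  by apply: integrable_fin_num => //; exact: xlin_integrable_mul.
rewrite !xlin_sqr rE -EFinM -!EFinD => -[]; rewrite /quad => h; congr (_%:E).
have sym : (b^T *m Sx *m a) 0 0 = (a^T *m Sx *m b) 0 0.
  transitivity ((b^T *m Sx *m a)^T 0 0); first by rewrite [RHS]mxE.
  by rewrite !trmx_mul trmxK Sxt mulmxA.
have D (u v : 'M[R]_1) : (u + v) 0 0 = u 0 0 + v 0 0 by rewrite mxE.
have tD : (a + b)^T = a^T + b^T by apply/matrixP => i j; rewrite !mxE.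
by move: h; rewrite tD !mulmxDr !mulmxDl !D sym; lra.
Qed.

Lemma elin_xlin_indep b a k (A B : set R) : measurable A -> measurable B ->
  P (elin b k @^-1` A `&` xlin a k @^-1` B) =
  (P (elin b k @^-1` A) * P (xlin a k @^-1` B))%E.
Proof.
move=> mA mB; rewrite setIC muleC; apply: (@indep_pair k).
  exact: xlin_sigmaX.
exact: elin_sigmaE.
Qed.

Lemma elin_xlin_mul b a k :
  P.-integrable setT (fun w => (elin b k w * xlin a k w)%:E) /\
  (\int[P]_w (elin b k w * xlin a k w)%:E = 0)%E.
Proof.
have nE : (fun w => - elin b k w) = elin (- b) k.
  by apply/funext => w; rewrite /elin mulmxN [RHS]mxE.
have qN : quad S (- b) = quad S b.
  have tN : (- b)^T = - b^T by apply/matrixP => i j; rewrite !mxE.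
  by rewrite /quad tN mulmxN !mulNmx opprK.
apply: (integral_mul_indep_symmetric (quadE_ge0 b (ord_gt0 k)) (elin_law b k) _
  (@xlin_measurable a k) (xlin_sqr a k)).
  by rewrite nE -qN; exact: elin_law.
by move=> A B mA mB; exact: elin_xlin_indep.
Qed.

(** * Exponential tail bounds over the independent rows *)

Lemma measurable_superlevel (f : T -> R) (L : R) :
  measurable_fun setT f -> measurable [set w | L <= f w].
Proof.
move=> mf; rewrite (_ : [set w | _] = f @^-1` `[L, +oo[).
  by rewrite -[_ @^-1` _]setTI; exact: mf.
by apply/seteqP; split => w; rewrite /= in_itv/= andbT.
Qed.

(** Markov's inequality for the exponential of the sum, whose expectation factors because [y k]
    depends on the k-th pair of rows only. *)
Lemma chernoff_rows (y : 'I_n -> T -> R) (b : 'I_n -> R) (L : R) :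
  (forall k, @measurable_fun _ _ (row_type k) _ setT (y k)) ->
  (forall k, (\int[P]_w (expR (y k w))%:E <= (expR (b k))%:E)%E) ->
  (P [set w | (L <= \sum_k y k w)%R] <= (expR (\sum_k b k - L))%:E)%E.
Proof.
move=> my yb.
have my' k : measurable_fun setT (y k) by exact: row_measurable_fun (my k).
have msum : measurable_fun setT (fun w => \sum_k y k w) by exact: measurable_sum.
set A := [set w | _]; have mA : measurable A by exact: measurable_superlevel.
suff : (P A * (expR L)%:E <= (expR (\sum_k b k))%:E)%E.
  have PAfin : P A \is a fin_num by rewrite fin_num_measure.
  rewrite -(fineK PAfin) -EFinM !lee_fin expRD expRN.
  by rewrite ler_pdivlMr ?expR_gt0.
have -> : (P A * (expR L)%:E = \int[P]_w ((expR L)%:E * (\1_A w)%:E))%E.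
  rewrite ge0_integralZl_EFin//; do ?[by move=> w _; rewrite lee_fin indicE|
    by apply/measurable_EFinP; exact: measurable_indic|exact: expR_ge0].
  by rewrite integral_indic// setIT muleC.
have -> : expR (\sum_k b k) = \prod_k expR (b k) by rewrite expR_sum.
apply: (@le_trans _ _ (\int[P]_w (\prod_k expR (y k w))%:E)%E).
  apply: ge0_le_integral => //.
  - by apply: emeasurable_funM => //; apply/measurable_EFinP; exact: measurable_indic.
  - apply/measurable_EFinP; under eq_fun do rewrite -expR_sum.
    exact: measurableT_comp.
  - move=> w _; rewrite -EFinM lee_fin -expR_sum indicE.
    have [|_] := boolP (w \in A); last by rewrite mulr0 expR_ge0.
    by move=> /set_mem Aw; rewrite mulr1 ler_expR.
rewrite (@integral_prod_indep _ _ _ _ _ (fun k => <<s row_generators k >>)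
    (fun k w => expR (y k w))).
- rewrite -prodEFin.
  have : (0 <= \prod_k \int[P]_w (expR (y k w))%:E <=
      \prod_k (expR (b k))%:E)%E; last by case/andP.
  elim/big_ind2 : _ => [|x1 x2 y1 y2 /andP[h1 h2] /andP[h3 h4]|k _].
  - by rewrite lexx andbT.
  - by rewrite mule_ge0//= lee_pmul.
  - by rewrite yb andbT; apply: integral_ge0 => w _; rewrite lee_fin expR_ge0.
- exact: row_sigma_measurable.
- exact: indep_rows.
- move=> k B mB.
  have mexp : @measurable_fun _ _ (row_type k) _ setT (fun w => expR (y k w)).
    by apply: measurableT_comp => //; exact: my.
  by have := mexp measurableT B mB; rewrite setTI.
- by move=> k w; exact: expR_ge0.
Qed.

Lemma linear_tail (f : 'I_n -> T -> R) (q : 'I_n -> R) (V L : R) :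
  (forall k, @measurable_fun _ _ (row_type k) _ setT (f k)) ->
  (forall k l, (\int[P]_w (expR (l * f k w))%:E = (expR (l ^+ 2 * q k / 2))%:E)%E) ->
  \sum_k q k <= V -> 0 < V -> 0 <= L ->
  (P [set w | (L <= \sum_k f k w)%R] <= (expR (- (L ^+ 2 / (2 * V))))%:E)%E.
Proof.
move=> mf fq qV V0 L0.
have [->|L_neq0] := eqVneq L 0.
  by rewrite expr0n mul0r oppr0 expR0; apply: probability_le1; apply: measurable_superlevel;
     apply: measurable_sum => k; exact: row_measurable_fun (mf k).
have Lgt0 : 0 < L by rewrite lt_neqAle eq_sym L_neq0.
(* The minimizer of l^2 V / 2 - l L. *)
pose l := L / V; have l0 : 0 < l by rewrite divr_gt0.
have -> : [set w | (L <= \sum_k f k w)%R] = [set w | (l * L <= \sum_k l * f k w)%R].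
  by apply/seteqP; split => w /=; rewrite -mulr_sumr ler_pM2l.
apply: le_trans (chernoff_rows (b := fun k => l ^+ 2 * q k / 2) _ _ _) _.
- by move=> k; apply: measurable_funM => //; exact: mf.
- by move=> k; rewrite fq.
rewrite lee_fin ler_expR -mulr_suml -mulr_sumr.
have : l ^+ 2 * (\sum_k q k) <= l ^+ 2 * V by rewrite ler_wpM2l// sqr_ge0.
have -> : l ^+ 2 * V = L ^+ 2 / V by rewrite /l; field; rewrite gt_eqF.
have -> : l * L = L ^+ 2 / V by rewrite /l; ring.
have -> : L ^+ 2 / (2 * V) = L ^+ 2 / V / 2 by field; rewrite gt_eqF.
lra.
Qed.

Lemma xlin_tail (z : 'I_n -> R) a V L :
  (\sum_k z k ^+ 2) * quad Sx a <= V -> 0 < V -> 0 <= L ->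
  (P [set w | (L <= \sum_k z k * xlin a k w)%R] <= (expR (- (L ^+ 2 / (2 * V))))%:E)%E.
Proof.
move=> zV; apply: (linear_tail (q := fun k => z k ^+ 2 * quad Sx a)).
- by move=> k; apply: measurable_funM => //; exact: xlin_row.
- move=> k l; under eq_integral do rewrite mulrA.
  by rewrite xlin_mgf exprMn mulrA.
- by rewrite -mulr_suml.
Qed.

Lemma elin_tail (z : 'I_n -> R) a V L :
  (\sum_k z k ^+ 2) * quad S a <= V -> 0 < V -> 0 <= L ->
  (P [set w | (L <= \sum_k z k * elin a k w)%R] <= (expR (- (L ^+ 2 / (2 * V))))%:E)%E.
Proof.
move=> zV; apply: (linear_tail (q := fun k => z k ^+ 2 * quad S a)).
- by move=> k; apply: measurable_funM => //; exact: elin_row.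
- move=> k l; under eq_integral do rewrite mulrA.
  by rewrite elin_mgf exprMn mulrA.
- by rewrite -mulr_suml.
Qed.

Lemma two_le_expR : 2 <= expR (7 / 8) :> R.
Proof.
have h : 1 + 7 / 16 <= expR (7 / 16) :> R by exact: expR_ge1Dx.
have -> : 7 / 8 = 7 / 16 + 7 / 16 :> R by field.
by rewrite expRD; nra.
Qed.

(** Each row contributes a factor 2 <= exp (7/8) against the threshold n, which leaves the exponent
    7 n / 8 - n = - n / 8. *)
Lemma sqr_tail (f : 'I_n -> T -> R) :
  (forall k, @measurable_fun _ _ (row_type k) _ setT (f k)) ->
  (forall k, (\int[P]_w (expR (f k w ^+ 2 / 4))%:E <= 2%:E)%E) ->
  (P [set w | (4 * n%:R <= \sum_k f k w ^+ 2)%R] <= (expR (- (n%:R / 8)))%:E)%E.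
Proof.
move=> mf f2.
have -> : [set w | (4 * n%:R <= \sum_k f k w ^+ 2)%R] =
    [set w | (n%:R <= \sum_k f k w ^+ 2 / 4)%R].
  by apply/seteqP; split => w /=; rewrite -mulr_suml ler_pdivlMr// mulrC.
apply: le_trans (chernoff_rows (b := fun=> 7 / 8) _ _ _) _.
- move=> k; apply: measurable_funM => //.
  exact: (@measurable_funX _ (row_type k)) (mf k).
- by move=> k; apply: le_trans (f2 k) _; rewrite lee_fin two_le_expR.
rewrite lee_fin ler_expR sumr_const card_ord -mulr_natl; lra.
Qed.

(* [1024] comes from [expR_le_bernstein]; the three exponentials of squares in
   [expR_prod_le] have expectation at most [2] each. *)
Definition bernstein_const : R := 1024 * 6.

Lemma bernstein_const_ge16 : 16 <= bernstein_const.
Proof. by rewrite /bernstein_const -natrM ler_nat. Qed.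

(** If M is the largest of the three squares then |(a + b) c| <= 2 M, and exp (M / 4) is one of the
    three summands. *)
Lemma expR_prod_le (a b c : R) :
  expR (`|(a + b) * c| / 8) <= expR (a ^+ 2 / 4) + expR (b ^+ 2 / 4) + expR (c ^+ 2 / 4).
Proof.
have h M : a ^+ 2 <= M -> b ^+ 2 <= M -> c ^+ 2 <= M -> `|(a + b) * c| / 8 <= M / 4.
  move=> aM bM cM; have : `|(a + b) * c| <= 2 * M; last by lra.
  have := sqr_ge0 (a + c); have := sqr_ge0 (a - c).
  have := sqr_ge0 (b + c); have := sqr_ge0 (b - c).
  by rewrite ler_norml => *; apply/andP; split; lra.
have ea := expR_ge0 (a ^+ 2 / 4); have eb := expR_ge0 (b ^+ 2 / 4).
have ec := expR_ge0 (c ^+ 2 / 4).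
have hM M : a ^+ 2 <= M -> b ^+ 2 <= M -> c ^+ 2 <= M ->
    expR (`|(a + b) * c| / 8) <= expR (M / 4).
  by move=> *; rewrite ler_expR; exact: h.
move: (expR (`|(a + b) * c| / 8)) hM ea eb ec => z hM ea eb ec.
have [ab|/ltW ab] := leP (a ^+ 2) (b ^+ 2).
  have [bc|/ltW bc] := leP (b ^+ 2) (c ^+ 2).
    by rewrite (le_trans (hM _ (le_trans ab bc) bc (lexx _)))// lerDr addr_ge0.
  by rewrite (le_trans (hM _ ab (lexx _) bc))// addrAC lerDr addr_ge0.
have [ac|/ltW ac] := leP (a ^+ 2) (c ^+ 2).
  by rewrite (le_trans (hM _ ac (le_trans ab ac) (lexx _)))// lerDr addr_ge0.
by rewrite (le_trans (hM _ (lexx _) ab ac))// -addrA lerDl addr_ge0.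
Qed.

(** Each summand has mean at least r, because the error part is uncorrelated with the predictors.
    The Bernstein bound with parameter th gives the exponent n (C th^2 - th r / 2). *)
Lemma covariance_lower_tail (a e : 'cV[R]_p) (b : 'cV[R]_m) (r : R) :
  quad Sx a <= 1 -> quad Sx e <= 1 -> quad S b <= 1 ->
  0 < r <= 1 -> r <= (a^T *m Sx *m e) 0 0 ->
  (P [set w | (\sum_k (xlin a k w + elin b k w) * xlin e k w <= n%:R * r / 2)%R]
   <= (expR (- (n%:R * r ^+ 2 / (16 * bernstein_const))))%:E)%E.
Proof.
move=> a1 e1 b1 /andP[r0 r1] rae.
move: bernstein_const (erefl (1024 * 6) : 1024 * 6 = bernstein_const) bernstein_const_ge16 => C CE C16.
(* The minimizer of C th^2 - th r / 2, with value - r^2 / (16 C). As r <= 1 and C >= 16 it is at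
   most 1/16. *)
pose th := r / (4 * C).
have C0 : 0 < C by lra.
have th0 : 0 < th by rewrite divr_gt0// mulr_gt0.
have th16 : 0 <= th <= 16^-1.
  rewrite ltW//= /th ler_pdivrMr ?mulr_gt0//; lra.
pose y k w := (xlin a k w + elin b k w) * xlin e k w.
have my k : @measurable_fun _ _ (row_type k) _ setT (y k).
  apply: measurable_funM; last exact: xlin_row.
  by apply: measurable_funD; [exact: xlin_row|exact: elin_row].
have my' k : measurable_fun setT (y k) by exact: row_measurable_fun (my k).
have yE k w : (y k w)%:E = ((xlin a k w * xlin e k w)%:E + (elin b k w * xlin e k w)%:E)%E.
  by rewrite -EFinD -mulrDl.
have i1 k := xlin_integrable_mul a e k.
have i2 k := (elin_xlin_mul b e k).1.
have iy k : P.-integrable setT (EFin \o y k).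
  by rewrite (_ : EFin \o y k = (fun w => (xlin a k w * xlin e k w)%:E +
     (elin b k w * xlin e k w)%:E)%E); [exact: integrableD|apply/funext => w; exact: yE].
have Ey k : (\int[P]_w (y k w)%:E = ((a^T *m Sx *m e) 0 0)%:E)%E.
  under eq_integral do rewrite yE.
  by rewrite integralD// xlin_mul (elin_xlin_mul b e k).2 adde0.
have Eabs k : (\int[P]_w (expR (`|y k w| / 8))%:E <= 6%:E)%E.
  pose g (f : T -> R) w := (expR (f w ^+ 2 / 4))%:E.
  have mg (f : T -> R) : measurable_fun setT f -> measurable_fun setT (g f).
    move=> mf; apply/measurable_EFinP; apply: measurableT_comp => //.
    by apply: measurable_funM => //; exact: measurable_funX.
  have g0 (f : T -> R) w : (0 <= g f w)%E by rewrite lee_fin expR_ge0.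
  have ma := mg _ (@xlin_measurable a k); have me := mg _ (@xlin_measurable e k).
  have mb := mg _ (@elin_measurable b k).
  apply: (@le_trans _ _ (\int[P]_w (g (xlin a k) w + g (elin b k) w + g (xlin e k) w))%E).
    apply: ge0_le_integral => //.
    - apply/measurable_EFinP; apply: measurableT_comp => //.
      by apply: measurable_funM => //; exact: measurableT_comp.
    - by apply: emeasurable_funD => //; exact: emeasurable_funD.
    - by move=> w _; rewrite /g -!EFinD lee_fin expR_prod_le.
  rewrite ge0_integralD//; last 2 first.
  - by move=> w _; rewrite adde_ge0.
  - exact: emeasurable_funD.
  rewrite ge0_integralD//.
  have -> : 6%:E = (2%:E + 2%:E + 2%:E)%E :> \bar R by rewrite -!EFinD; congr (_%:E); ring.
  apply: leeD; last exact: xlin_quarter_sqr_mgf.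
  by apply: leeD; [exact: xlin_quarter_sqr_mgf|exact: elin_quarter_sqr_mgf].
have -> : [set w | (\sum_k (xlin a k w + elin b k w) * xlin e k w <= n%:R * r / 2)%R] =
    [set w | (- th * (n%:R * r / 2) <= \sum_k - th * y k w)%R].
  by apply/seteqP; split => w /=; rewrite -mulr_sumr !mulNr lerN2 ler_pM2l.
apply: le_trans (chernoff_rows (b := fun=> - th * r + C * th ^+ 2) _ _ _) _.
- by move=> k; apply: measurable_funM => //; exact: my.
- move=> k; apply: le_trans (integral_expR_bernstein (my' k) (iy k) (Ey k) (Eabs k) th16) _.
  by rewrite CE lee_fin ler_expR lerD2r !mulNr lerN2 ler_pM2l.
rewrite lee_fin ler_expR sumr_const card_ord -[leLHS]/(_ *+ n - _) -mulr_natl.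
rewrite le_eqVlt; apply/predU1P; left; rewrite /th; field; rewrite gt_eqF//.
Qed.
End Rows.

(** * Integer grid *)

Section Grid.
Variable R : realType.

(** Integer vectors as sign and absolute value, a finite type. The bound 2n loses nothing: a
    coordinate whose square is at most 4n has absolute value at most 2n. Zero has two codes, which
    only makes the count larger. *)
Definition grid_point n := {ffun 'I_n -> bool * 'I_(2 * n).+1}.

Definition grid n : {set grid_point n} :=
  [set z : grid_point n | (\sum_i (z i).2 ^ 2 <= 4 * n)%N]%SET.

Definition grid_vec n (z : grid_point n) : 'cV[R]_n :=
  \col_i ((-1) ^+ (z i).1 * ((z i).2)%:R).

Lemma grid_vec_sqr n (z : grid_point n) i : grid_vec z i 0 ^+ 2 = ((z i).2 ^ 2)%:R.
Proof. by rewrite mxE exprMn sqrr_sign mul1r natrX. Qed.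

Lemma sqnorm_grid_vec n (z : grid_point n) : z \in grid n -> sqnorm (grid_vec z) <= 4 * n%:R.
Proof.
rewrite inE -(ler_nat R) natrM => h; apply: le_trans h.
by rewrite natr_sum; apply: ler_sum => i _; rewrite grid_vec_sqr.
Qed.

(* [\sum_z 1 <= \sum_z exp (4 n - |z|^2)], and the last sum is a product. *)
Lemma card_grid n : #|grid n|%:R <= expR (6 * n%:R) :> R.
Proof.
have two_le : 2 <= expR 1 :> R by have := expR_ge1Dx (1 : R); lra.
apply: (@le_trans _ _ (\sum_(z : grid_point n) \prod_i expR (4 - ((z i).2 ^ 2)%:R))).
  rewrite -sum1_card natr_sum big_mkcond/=; apply: ler_sum => z _.
  rewrite -expR_sum sumrB sumr_const card_ord; case: ifPn => [|_]; last exact: expR_ge0.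
  rewrite inE -(ler_nat R) natr_sum natrM => h.
  by apply: le_trans (expR_ge1Dx _); rewrite lerDl subr_ge0 -[4 *+ n]mulr_natr.
rewrite -(bigA_distr_bigA (fun (i : 'I_n) (x : bool * 'I_(2 * n).+1) =>
   expR (4 - (x.2 ^ 2)%:R) : R)).
rewrite expRM_natr -[n in leRHS](card_ord n) -prodr_const.
apply: ler_prod => i _; apply/andP; split.
  by apply: sumr_ge0 => x _; exact: expR_ge0.
rewrite -(pair_bigA _ (fun (b : bool) (j : 'I_(2 * n).+1) => expR (4 - (j ^ 2)%:R) : R))/=.
rewrite big_bool/=.
have geo (K : nat) : \sum_(j < K) expR (- (j ^ 2)%:R) <= 2 - (2 : R) * 2^-1 ^+ K.
  elim: K => [|K IH]; first by rewrite big_ord0 expr0; lra.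
  rewrite big_ord_recr/= exprS.
  suff : expR (- (K ^ 2)%:R) <= (2 : R)^-1 ^+ K by lra.
  rewrite expRN exprVn lef_pV2 ?posrE ?expR_gt0 ?exprn_gt0//.
  apply: (@le_trans _ _ (expR K%:R)).
    by rewrite -[K%:R]mulr1 expRM_natl lerXn2r// nnegrE ?expR_ge0.
  by rewrite ler_expR ler_nat; case: K {IH} => // K; rewrite expnS leq_pmulr// expn_gt0.
have S2 : \sum_(j < (2 * n).+1) expR (4 - (j ^ 2)%:R) <= 2 * expR 4 :> R.
  under eq_bigr do rewrite expRD.
  rewrite -mulr_sumr mulrC ler_wpM2r ?expR_ge0//.
  have := geo (2 * n).+1; have : 0 <= (2 : R)^-1 ^+ (2 * n).+1 by rewrite exprn_ge0.
  lra.
(* Two signs and a geometric sum below 2 give at most 4 exp 4 per coordinate, and 4 <= exp 2. *)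
have -> : expR 6 = expR 1 * expR 1 * expR 4 :> R by rewrite -!expRD; congr expR; ring.
have e4 := expR_gt0 (4 : R).
have : 4 <= expR 1 * expR 1 :> R by nra.
by move=> /(ler_wpM2r (ltW e4)); lra.
Qed.

(* Each coordinate of [v] is rounded up or down, whichever increases the linear
   form [f]. *)
Lemma exists_grid_round n (f v : 'cV[R]_n) : sqnorm v <= n%:R ->
  exists2 z, z \in grid n & \sum_i f i 0 * v i 0 <= \sum_i f i 0 * grid_vec z i 0.
Proof.
move=> vn.
pose y i : int := if 0 <= f i 0 then Num.floor (v i 0) + 1 else Num.floor (v i 0).
have fl i := ge_floor (v i 0).
have fl1 i : v i 0 < (Num.floor (v i 0) + 1)%:~R by exact: floorD1_gt.
have fy i : f i 0 * v i 0 <= f i 0 * (y i)%:~R.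
  rewrite /y; case: ifPn => f0; first by rewrite ler_wpM2l// ltW.
  by rewrite ler_wnM2l// ltW// ltNge.
(* Rounding moves a coordinate by at most 1, and y^2 <= 2 v^2 + 2 (y - v)^2. Summing gives 2n + 2n =
   4n, which fixes the radius of the grid. *)
have y2 i : ((y i)%:~R : R) ^+ 2 <= 2 * v i 0 ^+ 2 + 2.
  have : `|(y i)%:~R - v i 0| <= 1.
    have := fl i; have := fl1 i; rewrite /y intrD ler_norml => h1 h2.
    by case: ifPn => _; rewrite ?intrD; apply/andP; split; lra.
  rewrite -(ler_sqr) ?nnegrE// expr1n real_normK ?num_real//.
  have := sqr_ge0 ((y i)%:~R - 2 * v i 0); nra.
have ynat i : ((y i)%:~R : R) ^+ 2 = (`|y i|%N ^ 2)%:R.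
  by rewrite natrX -(real_normK (num_real _)) -intr_norm -abszE.
have ysum : (\sum_i `|y i|%N ^ 2 <= 4 * n)%N.
  rewrite -(ler_nat R) natr_sum natrM.
  apply: (@le_trans _ _ (\sum_i (2 * v i 0 ^+ 2 + 2))).
    by apply: ler_sum => i _; rewrite -ynat.
  rewrite big_split/= -mulr_sumr sumr_const card_ord -[_ *+ n]mulr_natr.
  by rewrite -/(sqnorm v); lra.
have yb i : (`|y i|%N < (2 * n).+1)%N.
  rewrite ltnS -(leq_exp2r _ _ (ltn0Sn 1)).
  have n0 : (0 < n)%N by exact: leq_ltn_trans (ltn_ord i).
  apply: (@leq_trans (4 * n)); last by rewrite expnMn leq_mul2l/= leq_pmulr.
  by apply: leq_trans ysum; rewrite (bigD1 i)//= leq_addr.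
pose z : grid_point n := [ffun i => (y i < 0, Ordinal (yb i))].
have zE i : grid_vec z i 0 = (y i)%:~R.
  rewrite mxE ffunE/= [in RHS](intEsign (y i)) intrM; congr (_ * _).
  by rewrite rmorph_sign.
exists z; first by rewrite inE; under eq_bigr do rewrite ffunE/=.
by apply: ler_sum => i _; rewrite zE.
Qed.

(** Scale v to squared norm n and its image g = M^T v to squared norm p, then round first v and next
    g to grid points. The bilinear form does not decrease at either rounding, so no approximation
    error has to be reabsorbed. *)
Lemma grid_operator_bound n p (M : 'M[R]_(n, p)) (L : R) :
  (forall (z : grid_point n) (z' : grid_point p), z \in grid n -> z' \in grid p ->
     ((grid_vec z)^T *m M *m grid_vec z') 0 0 <= L) ->
  forall v, n%:R * p%:R * sqnorm (M^T *m v) <= L ^+ 2 * sqnorm v.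
Proof.
move=> ML v; set g := M^T *m v.
have [g0|g0] := eqVneq g 0.
  rewrite g0 [X in _ * X](_ : _ = 0) ?mulr0.
    by apply: mulr_ge0; [exact: sqr_ge0|exact: sqnorm_ge0].
  by rewrite /sqnorm big1// => i _; rewrite mxE expr0n.
have v0 : v != 0 by apply: contra_neq g0 => v0; rewrite /g v0 mulmx0.
have gg := sqnorm_gt0 g0; have vv := sqnorm_gt0 v0.
pose s := Num.sqrt (n%:R / sqnorm v); pose t := Num.sqrt (p%:R / sqnorm g).
have s2 : s ^+ 2 = n%:R / sqnorm v by rewrite sqr_sqrtr// divr_ge0// ltW.
have t2 : t ^+ 2 = p%:R / sqnorm g by rewrite sqr_sqrtr// divr_ge0// ltW.
have sqZ q (c : R) (x : 'cV[R]_q) : sqnorm (c *: x) = c ^+ 2 * sqnorm x.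
  by rewrite /sqnorm mulr_sumr; apply: eq_bigr => i _; rewrite mxE exprMn.
have bil : (((s *: v)^T *m M) *m (t *: g)) 0 0 = s * t * sqnorm g.
  rewrite -scalemxAr linearZ/= -!scalemxAl scalerA mxE [t * s]mulrC sqnormE; congr (_ * _).
  by rewrite {2}/g trmx_mul trmxK.
have step1 : s * t * sqnorm g <= L.
  rewrite -bil.
  have [|z zg hz] := @exists_grid_round n (M *m (t *: g)) (s *: v).
    by rewrite sqZ s2 divfK// gt_eqF.
  have [|z' zg' hz'] := @exists_grid_round p ((grid_vec z)^T *m M)^T (t *: g).
    by rewrite sqZ t2 divfK// gt_eqF.
  apply: le_trans (ML z z' zg zg').
  apply: (@le_trans _ _ (((grid_vec z)^T *m M *m (t *: g)) 0 0)).
    rewrite -!mulmxA !dotE; under eq_bigr do rewrite mulrC.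
    by under [leRHS]eq_bigr do rewrite mulrC.
  by move: hz'; rewrite -!dotE !trmxK.
have s0 : 0 <= s by exact: sqrtr_ge0.
have t0 : 0 <= t by exact: sqrtr_ge0.
have stg : 0 <= s * t * sqnorm g by rewrite !mulr_ge0// ltW.
have : (s * t * sqnorm g) ^+ 2 <= L ^+ 2 by rewrite ler_sqr ?nnegrE// (le_trans stg).
rewrite !exprMn s2 t2 -(ler_pM2r vv); apply: le_trans.
by rewrite le_eqVlt; apply/predU1P; left; field; rewrite !gt_eqF.
Qed.

End Grid.

(** * Failure probabilities *)

Section FailureBounds.
Context (R : realType) (d : measure_display) (T : measurableType d).
Variable P : probability T R.

(* [Q] itself need not be measurable. *)
Definition fails_le (c : R) (Q : T -> Prop) : Prop :=
  exists N : set T, [/\ measurable N, (P N <= c%:E)%E & forall w, ~ N w -> Q w].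

Lemma fails_le_imp c c' (Q Q' : T -> Prop) :
  c <= c' -> (forall w, Q w -> Q' w) -> fails_le c Q -> fails_le c' Q'.
Proof.
move=> cc' QQ' [N [mN PN NQ]]; exists N; split => //.
  by rewrite (le_trans PN)// lee_fin.
by move=> w /NQ /QQ'.
Qed.

Lemma fails_le_and c c' (Q Q' : T -> Prop) :
  fails_le c Q -> fails_le c' Q' -> fails_le (c + c') (fun w => Q w /\ Q' w).
Proof.
move=> [N [mN PN NQ]] [N' [mN' PN' NQ']]; exists (N `|` N'); split.
- exact: measurableU.
- by rewrite (le_trans (measureU2 _ _ _))// EFinD leeD.
- by move=> w h; split; [apply: NQ|apply: NQ'] => ?; apply: h; [left|right].
Qed.

Lemma fails_le_seq (I : eqType) (s : seq I) c (Q : I -> T -> Prop) : 0 <= c ->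
  (forall i, i \in s -> fails_le c (Q i)) ->
  fails_le ((size s)%:R * c) (fun w => forall i, i \in s -> Q i w).
Proof.
move=> c0; elim: s => [|i s IH] h.
  by exists set0; split => //; rewrite measure0 mul0r.
apply: fails_le_imp (fails_le_and (h i (mem_head _ _)) (IH _)).
- by rewrite /= -natr1 mulrDl mul1r addrC.
- by move=> w [Qi Qs] j; rewrite inE => /predU1P[->//|]; exact: Qs.
- by move=> j js; apply: h; rewrite inE js orbT.
Qed.

Lemma fails_le_forall (I : finType) (A : {set I}) c (Q : I -> T -> Prop) : 0 <= c ->
  (forall i, i \in A -> fails_le c (Q i)) ->
  fails_le (#|A|%:R * c) (fun w => forall i, i \in A -> Q i w).
Proof.
move=> c0 h; have := @fails_le_seq _ (enum A) c Q c0; rewrite -cardE => H.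
apply: fails_le_imp (H _) => //.
  by move=> w h1 i iA; apply: h1; rewrite mem_enum.
by move=> i; rewrite mem_enum; exact: h.
Qed.

Lemma fails_le_lt c (f : T -> R) L : measurable_fun setT f ->
  (P [set w | (L <= f w)%R] <= c%:E)%E -> fails_le c (fun w => f w < L).
Proof.
move=> mf PL; exists [set w | L <= f w]; split => //.
  exact: measurable_superlevel.
by move=> w /= /negP; rewrite -ltNge.
Qed.

Lemma fails_le_measurable c (Q : T -> Prop) : measurable [set w | Q w] ->
  fails_le c Q -> 1 - fine (P [set w | Q w]) <= c.
Proof.
move=> mQ [N [mN PN NQ]].
have fQ : P [set w | Q w] \is a fin_num by rewrite fin_num_measure.
rewrite lerBlDr -lee_fin EFinD fineK//.
have <- : P setT = 1%:E by exact: probability_setT.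
apply: le_trans (leeD2r _ PN); apply: le_trans (measureU2 _ _ _) => //.
apply: le_measure; rewrite ?inE//; first exact: measurableU.
by move=> w _; have [Nw|/NQ] := pselect (N w); [left|right].
Qed.

End FailureBounds.

(** * High-probability events at a fixed sample size *)

Section FixedSampleSize.
Context (R : realType) (d : measure_display) (T : measurableType d).
Variable P : probability T R.
Variables (n p m : nat) (X : T -> 'M[R]_(n, p)) (E : T -> 'M[R]_(n, m)).
Variables (mu : 'rV[R]_p) (Sx : 'M[R]_p) (S : 'M[R]_m).
Hypothesis gaussX : forall i : 'I_n, mvgaussian P (fun w => row i (X w)) mu Sx.
Hypothesis gaussE : forall i : 'I_n, mvgaussian P (fun w => row i (E w)) 0 S.
Hypothesis indep : independent_rows P X E.
Hypothesis n_gt0 : (0 < n)%N.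
Hypothesis m_gt0 : (0 < m)%N.
Hypothesis n_le_p : (n <= p)%N.
Variables (r : R).
Hypothesis r01 : 0 < r <= 1.

Local Notation xlin := (xlin X mu).
Local Notation elin := (elin E).
Local Notation failure := (expR (- (n%:R * r ^+ 2 / (16 * bernstein_const R)))).

Let n0 : 0 < n%:R :> R. Proof. by rewrite ltr0n. Qed.

(** Brings the other exponents down to the Bernstein one, so that all events share the probability
    [failure]. *)
Lemma failure_exponent_le c : 16^-1 <= c ->
  n%:R * r ^+ 2 / (16 * bernstein_const R) <= n%:R * r ^+ 2 * c.
Proof.
case/andP: r01 => r0 _ c16.
have := bernstein_const_ge16 R; move: (bernstein_const R) => C C16.
apply: ler_wpM2l; first by rewrite mulr_ge0 ?sqr_ge0// ltW.
by apply: le_trans c16; rewrite lef_pV2 ?posrE; lra.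
Qed.

Let eta := Num.sqrt (r / 8).

Let eta2 : eta ^+ 2 = r / 8.
Proof. by rewrite sqr_sqrtr// divr_ge0//; case/andP: r01 => /ltW. Qed.

(** The constant weights 1 and -1 give the two sides. The exponent is n eta^2 / 2 = n r / 16, at
    least n r^2 / 16 because r <= 1. *)
Lemma fails_le_sum_of_tail (f : 'I_n -> T -> R) :
  (forall k, measurable_fun setT (f k)) ->
  (forall z : 'I_n -> R, (\sum_k z k ^+ 2) * 1 <= n%:R ->
     (P [set w | (n%:R * eta <= \sum_k z k * f k w)%R] <=
      (expR (- ((n%:R * eta) ^+ 2 / (2 * n%:R))))%:E)%E) ->
  fails_le P (2 * failure) (fun w => `|\sum_k f k w| <= n%:R * eta).
Proof.
move=> mf H.
have e_le : expR (- ((n%:R * eta) ^+ 2 / (2 * n%:R))) <= failure.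
  rewrite ler_expR lerN2 exprMn eta2.
  apply: le_trans (failure_exponent_le (lexx _)) _.
  have -> : n%:R ^+ 2 * (r / 8) / (2 * n%:R) = n%:R * r * 16^-1 by field; rewrite gt_eqF.
  rewrite ler_wpM2r// ler_wpM2l ?(ltW n0)// expr2 ler_piMl//; by case/andP: r01 => /ltW.
have tail (s : R) : s ^+ 2 = 1 -> fails_le P failure (fun w => s * \sum_k f k w < n%:R * eta).
  move=> s1; apply: fails_le_lt; first by apply: measurable_funM => //; exact: measurable_sum.
  under eq_set => w do rewrite mulr_sumr.
  apply: le_trans (H (fun=> s) _) _; last by rewrite lee_fin.
  by rewrite mulr1 s1 sumr_const card_ord.
have t1 := tail 1 (expr1n _ _); have t2 := tail (-1) (sqrr_sign _ 1).
apply: fails_le_imp (fails_le_and t1 t2); first by rewrite [leRHS]mulr_natl mulr2n.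
move=> w; rewrite mul1r mulN1r => -[/ltW h1 /ltW h2].
by rewrite ler_norml h1 andbT lerNl.
Qed.

Lemma fails_le_sum_xlin a : quad Sx a <= 1 ->
  fails_le P (2 * failure) (fun w => `|\sum_k xlin a k w| <= n%:R * eta).
Proof.
move=> a1; apply: fails_le_sum_of_tail.
  by move=> k; exact: (xlin_measurable gaussX gaussE).
move=> z zn; apply: (xlin_tail gaussX gaussE indep) => //.
  apply: le_trans zn; rewrite ler_wpM2l//.
  by apply: sumr_ge0 => k _; exact: sqr_ge0.
by rewrite mulr_ge0 ?sqrtr_ge0// ltW.
Qed.

Lemma fails_le_sum_elin a : quad S a <= 1 ->
  fails_le P (2 * failure) (fun w => `|\sum_k elin a k w| <= n%:R * eta).
Proof.
move=> a1; apply: fails_le_sum_of_tail.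
  by move=> k; exact: (elin_measurable gaussX gaussE).
move=> z zn; apply: (elin_tail gaussX gaussE indep) => //.
  apply: le_trans zn; rewrite ler_wpM2l//.
  by apply: sumr_ge0 => k _; exact: sqr_ge0.
by rewrite mulr_ge0 ?sqrtr_ge0// ltW.
Qed.

Let r2_le1 : r ^+ 2 <= 1.
Proof. by case/andP: r01 => r0 r1; rewrite expr_le1// ltW. Qed.

Lemma expR_le_failure : expR (- (n%:R / 8)) <= failure.
Proof.
rewrite ler_expR lerN2; apply: le_trans (failure_exponent_le (lexx _)) _.
apply: (@le_trans _ _ (n%:R * 1 * 8^-1)); last by rewrite mulr1.
apply: ler_pM => //; first by rewrite mulr_ge0 ?sqr_ge0// ltW.
  by rewrite ler_wpM2l// ltW.
by rewrite lef_pV2 ?posrE//; lra.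
Qed.

Lemma fails_le_sqr_xlin a : quad Sx a <= 1 ->
  fails_le P failure (fun w => \sum_k xlin a k w ^+ 2 <= 4 * n%:R).
Proof.
move=> a1.
apply: (@fails_le_imp _ _ _ _ _ _ (fun w => \sum_k xlin a k w ^+ 2 < 4 * n%:R)
  _ (lexx failure)); first by move=> w /ltW.
apply: fails_le_lt.
  apply: measurable_sum => k; apply: measurable_funX.
  exact: (xlin_measurable gaussX gaussE).
apply: le_trans (sqr_tail gaussX gaussE indep _ _) _.
- by move=> k; exact: xlin_row.
- by move=> k; exact: (xlin_quarter_sqr_mgf gaussX gaussE).
by rewrite lee_fin expR_le_failure.
Qed.

Lemma fails_le_sqr_elin a : quad S a <= 1 ->
  fails_le P failure (fun w => \sum_k elin a k w ^+ 2 <= 4 * n%:R).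
Proof.
move=> a1.
apply: (@fails_le_imp _ _ _ _ _ _ (fun w => \sum_k elin a k w ^+ 2 < 4 * n%:R)
  _ (lexx failure)); first by move=> w /ltW.
apply: fails_le_lt.
  apply: measurable_sum => k; apply: measurable_funX.
  exact: (elin_measurable gaussX gaussE).
apply: le_trans (sqr_tail gaussX gaussE indep _ _) _.
- by move=> k; exact: elin_row.
- by move=> k; exact: (elin_quarter_sqr_mgf gaussX gaussE).
by rewrite lee_fin expR_le_failure.
Qed.

Lemma fails_le_covariance (a e : 'cV[R]_p) (b : 'cV[R]_m) :
  quad Sx a <= 1 -> quad Sx e <= 1 -> quad S b <= 1 -> r <= (a^T *m Sx *m e) 0 0 ->
  fails_le P failure
    (fun w => n%:R * r / 2 <= \sum_k (xlin a k w + elin b k w) * xlin e k w).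
Proof.
move=> a1 e1 b1 rae; have := covariance_lower_tail gaussX gaussE indep a1 e1 b1 r01 rae.
move=> H.
apply: (@fails_le_imp _ _ _ _ _ _ (fun w =>
   - \sum_k (xlin a k w + elin b k w) * xlin e k w < - (n%:R * r / 2))
  _ (lexx failure)); first by move=> w; rewrite ltrN2 => /ltW.
apply: fails_le_lt.
  apply: measurableT_comp => //; apply: measurable_sum => k.
  apply: measurable_funM; last exact: (xlin_measurable gaussX gaussE).
  by apply: measurable_funD; [exact: (xlin_measurable gaussX gaussE)|
                              exact: (elin_measurable gaussX gaussE)].
by under eq_set => w do rewrite lerN2.
Qed.

(** The covariance bound of [e] with itself, without error part and with r = 1. *)
Lemma fails_le_sqr_lower e : quad Sx e = 1 ->
  fails_le P failure (fun w => n%:R / 2 <= \sum_k xlin e k w ^+ 2).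
Proof.
move=> e1; have r11 : 0 < (1 : R) <= 1 by rewrite ltr01 lexx.
have S0 : quad S 0 <= 1 by rewrite /quad mulmx0 mxE ler01.
have e1' : quad Sx e <= 1 by rewrite e1.
have ee : 1 <= (e^T *m Sx *m e) 0 0 by rewrite -e1.
have := covariance_lower_tail gaussX gaussE indep e1' e1' S0 r11 ee => H.
have sumE w : \sum_k (xlin e k w + elin 0 k w) * xlin e k w = \sum_k xlin e k w ^+ 2.
  by apply: eq_bigr => k _; rewrite elin0 addr0 expr2.
apply: (@fails_le_imp _ _ _ _ _ _ (fun w => - \sum_k xlin e k w ^+ 2 < - (n%:R / 2))
  _ (lexx failure)); first by move=> w; rewrite ltrN2 => /ltW.
apply: fails_le_lt.
  apply: measurableT_comp => //; apply: measurable_sum => k.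
  by apply: measurable_funX; exact: (xlin_measurable gaussX gaussE).
apply: (@le_trans _ _ (expR (- (n%:R * 1 ^+ 2 / (16 * bernstein_const R))))%:E).
  apply: le_trans H; rewrite le_eqVlt; apply/predU1P; left; congr (P _).
  by apply/seteqP; split => w /=; rewrite sumE mulr1 lerN2.
have := bernstein_const_ge16 R; rewrite lee_fin ler_expR lerN2.
move: (bernstein_const R) => C C16.
by rewrite ler_wpM2r ?invr_ge0; [|lra|rewrite ler_wpM2l ?expr1n// ltW].
Qed.

(* Union bound over the at most [exp (6 n + 6 p)] pairs of grid points, each of
   them failing with probability at most [exp (- 13 p)]; [416 = 2 * 13 * 16]. *)
Lemma fails_le_operator_norm (lam : R) : 0 < lam ->
  (forall a, quad Sx a <= lam * sqnorm a) ->
  fails_le P failure (fun w => forall v,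
    sqnorm ((X w - const_mx 1 *m mu)^T *m v) <= 416 * p%:R * lam * sqnorm v).
Proof.
move=> lam0 Slam.
have p0 : 0 < p%:R :> R by rewrite ltr0n (leq_trans n_gt0).
(* [V] bounds the variance of the bilinear form at any pair of grid points, of squared norms at most
   4n and 4p; [L] is chosen so that L^2 / (2 V) = 13 p. *)
pose V := 16 * n%:R * p%:R * lam; have V0 : 0 < V by rewrite !mulr_gt0.
pose L := Num.sqrt (26 * p%:R * V).
have L2 : L ^+ 2 = 26 * p%:R * V by rewrite sqr_sqrtr// ltW// !mulr_gt0.
pose tail := expR (- (13 * p%:R)) : R.
have H (z : grid_point n) (z' : grid_point p) : z \in grid n -> z' \in grid p ->
    fails_le P tail (fun w => \sum_k grid_vec R z k 0 * xlin (grid_vec R z') k w < L).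
  move=> zg zg'; apply: fails_le_lt.
    apply: measurable_sum => k; apply: measurable_funM => //.
    exact: (xlin_measurable gaussX gaussE).
  apply: (@le_trans _ _ (expR (- (L ^+ 2 / (2 * V))))%:E).
    apply: (xlin_tail gaussX gaussE indep) => //; last exact: sqrtr_ge0.
    rewrite (_ : V = (4 * n%:R) * (lam * (4 * p%:R))); last by rewrite /V; ring.
    apply: ler_pM.
    - by apply: sumr_ge0 => k _; exact: sqr_ge0.
    - exact: (quadX_ge0 gaussX).
    - exact: sqnorm_grid_vec.
    - by rewrite (le_trans (Slam _))// ler_wpM2l ?(ltW lam0)// sqnorm_grid_vec.
  rewrite lee_fin ler_expR lerN2 L2 le_eqVlt; apply/predU1P; left.
  by field; rewrite gt_eqF.
have t0 : 0 <= tail by exact: expR_ge0.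
have {H}H (z : grid_point n) : z \in grid n -> fails_le P (#|grid p|%:R * tail)
    (fun w => forall z', z' \in grid p ->
      \sum_k grid_vec R z k 0 * xlin (grid_vec R z') k w < L).
  by move=> zg; apply: fails_le_forall => // z' zg'; exact: H.
have t0' : 0 <= #|grid p|%:R * tail by rewrite mulr_ge0.
apply: fails_le_imp (fails_le_forall t0' H).
  rewrite mulrA.
  apply: (@le_trans _ _ (expR (6 * n%:R) * expR (6 * p%:R) * tail)).
    by rewrite ler_wpM2r//; apply: ler_pM => //; exact: card_grid.
  (* 6n + 6p - 13p <= - n because n <= p. *)
  rewrite -!expRD ler_expR; apply: (@le_trans _ _ (- n%:R)).
    have : n%:R <= p%:R :> R by rewrite ler_nat.
    lra.
  rewrite lerN2; apply: le_trans (failure_exponent_le (_ : 16^-1 <= 1)) _.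
    by lra.
  by rewrite mulr1 ler_piMr// ltW.
move=> w h v; set M := X w - _.
have /grid_operator_bound/(_ v) : forall (z : grid_point n) (z' : grid_point p),
    z \in grid n -> z' \in grid p ->
    ((grid_vec R z)^T *m M *m grid_vec R z') 0 0 <= L.
  move=> z z' zg zg'; apply: ltW; have := h z zg z' zg'.
  rewrite -mulmxA dotE; congr (_ < _); apply: eq_bigr => k _; congr (_ * _).
  by rewrite xlin_mxE.
move=> h1; rewrite -(ler_pM2l (mulr_gt0 n0 p0)); apply: le_trans h1 _; rewrite L2 /V.
by rewrite le_eqVlt; apply/predU1P; left; ring.
Qed.

(** Along this direction [xlin] is the j-th predictor, centered at its mean and divided by its
    standard deviation. *)
Definition coord_dir (j : 'I_p) : 'cV[R]_p := (Num.sqrt (Sx j j))^-1 *: delta_mx j 0.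

Lemma mul_delta_entry q (A : 'M[R]_(q, p)) k j : (A *m (delta_mx j 0 : 'cV_p)) k 0 = A k j.
Proof. by rewrite -colE mxE. Qed.

Lemma quadZ q (A : 'M[R]_q) (c : R) (a : 'cV[R]_q) : quad A (c *: a) = c ^+ 2 * quad A a.
Proof.
have tZ : (c *: a)^T = c *: a^T by apply/matrixP => i j; rewrite !mxE.
by rewrite /quad tZ -!scalemxAl -scalemxAr scalerA mxE expr2.
Qed.

Lemma quad_coord_dir j : 0 < Sx j j -> quad Sx (coord_dir j) = 1.
Proof.
move=> Sj; rewrite /coord_dir quadZ /quad trmx_delta -rowE mul_delta_entry mxE.
by rewrite exprVn sqr_sqrtr ?mulVf ?gt_eqF// ltW.
Qed.

Lemma col_coord_dir j w : 0 < Sx j j ->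
  col j (X w) = const_mx (mu 0 j) + Num.sqrt (Sx j j) *: (\col_k xlin (coord_dir j) k w).
Proof.
move=> Sj; have sj : Num.sqrt (Sx j j) != 0 by rewrite gt_eqF// sqrtr_gt0.
apply/matrixP => k l; rewrite !mxE xlin_mxE /coord_dir -scalemxAr mxE mul_delta_entry.
by rewrite mulVKf// !mxE big_ord1 !mxE mul1r addrC subrK.
Qed.

(** The factor 12 counts failures: 4 for each predictor, 7 more for each active one, and 1 for the
    operator norm, with 1 <= p and at most p active indices. The strict inequality assumed on [D] is
    the one required by the counting in [top_indicesP]. *)
Lemma fails_le_screening (B : 'M[R]_(p, m)) (lam c3 : R) (D : nat) :
  0 < lam -> (forall a, quad Sx a <= lam * sqnorm a) ->
  0 < c3 -> (forall j, c3 <= Sx j j) ->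
  (forall i, i \in active B -> exists (c : R) (a : 'cV[R]_m),
     [/\ 0 < c, a != 0, quad Sx (c^-1 *: (B *m a)) <= 1, quad S (c^-1 *: a) <= 1
       & r <= ((c^-1 *: (B *m a))^T *m Sx *m coord_dir i) 0 0]) ->
  416 * p%:R * lam * m%:R / (c3 * (n%:R / 4)) < D%:R * (r / 32) ^+ 2 ->
  fails_le P (12 * p%:R * failure) (fun w => active B \subset
    top_indices (fun j => cancor (X w *m B + E w) (col j (X w))) D).
Proof.
move=> lam0 Slam c30 c3S act HD.
case/andP: (r01) => r0 r1.
have Sj j : 0 < Sx j j by exact: lt_le_trans (c3S j).
have F0 : 0 <= failure by exact: expR_ge0.
pose Qlow i w := r / 32 <= cancor (X w *m B + E w) (col i (X w)).
pose Qall (j : 'I_p) w := `|\sum_k xlin (coord_dir j) k w| <= n%:R * eta /\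
  (\sum_k xlin (coord_dir j) k w ^+ 2 <= 4 * n%:R /\
   n%:R / 2 <= \sum_k xlin (coord_dir j) k w ^+ 2).
have Hall j : j \in [set: 'I_p]%SET -> fails_le P (4 * failure) (Qall j).
  move=> _; have q1 := quad_coord_dir (Sj j).
  have q1' : quad Sx (coord_dir j) <= 1 by rewrite q1.
  apply: fails_le_imp (fails_le_and (fails_le_sum_xlin q1')
    (fails_le_and (fails_le_sqr_xlin q1') (fails_le_sqr_lower q1))) => //.
  by lra.
(* Stated as an implication, so that the events on the predictor itself are counted once, in
   [Hall]. *)
have Hact i : i \in active B -> fails_le P (7 * failure) (fun w => Qall i w -> Qlow i w).
  move=> iA; have [c [a [c0 a0 qX qE rc]]] := act i iA.
  have q1 : quad Sx (coord_dir i) <= 1 by rewrite quad_coord_dir.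
  have := fails_le_and (fails_le_covariance qX q1 qE rc)
    (fails_le_and (fails_le_and (fails_le_sum_xlin qX) (fails_le_sum_elin qE))
       (fails_le_and (fails_le_sqr_xlin qX) (fails_le_sqr_elin qE))).
  apply: fails_le_imp; first by lra.
  move=> w [cov [[sX sE] [qqX qqE]]] [sv [vv _]].
  pose u : 'cV[R]_n := \col_k (xlin (c^-1 *: (B *m a)) k w + elin (c^-1 *: a) k w).
  pose v : 'cV[R]_n := \col_k xlin (coord_dir i) k w.
  apply: (@cancor_lower_bound _ _ _ _ _ u v a ((mu *m (B *m a)) 0 0) (mu 0 i) c
    (Num.sqrt (Sx i i)) r eta) => //.
  - by rewrite sqrtr_gt0.
  - exact: sqrtr_ge0.
  - have ent d1 d2 (e : R) (M : 'M[R]_(d1, d2)) k l : (e *: M) k l = e * M k l by rewrite mxE.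
    have addE d1 d2 (M N : 'M[R]_(d1, d2)) k l : (M + N) k l = M k l + N k l by rewrite mxE.
    apply/matrixP => k l; rewrite [l]ord1 addE ent mulmxDl addE [X in _ = X + _]mxE.
    have rowE' x : (row k (X w) *m x) 0 0 = (X w *m x) k 0 by rewrite -row_mul mxE.
    rewrite [u k 0]mxE xlinE elin_mxE -!scalemxAr !ent rowE'.
    rewrite -mulrBr -mulrDr mulVKf ?gt_eqF// -(mulmxA (X w)); lra.
  - exact: col_coord_dir.
  - by under eq_bigr do rewrite !mxE.
  - under eq_bigr do rewrite mxE.
    by rewrite big_split/= (le_trans (ler_normD _ _))//; lra.
  - by under eq_bigr do rewrite mxE.
  - rewrite /sqnorm; apply: (@le_trans _ _ (2 * \sum_k xlin (c^-1 *: (B *m a)) k w ^+ 2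
        + 2 * \sum_k elin (c^-1 *: a) k w ^+ 2)); last by lra.
    rewrite !mulr_sumr -big_split/=; apply: ler_sum => k _; rewrite mxE.
    by have := sqr_ge0 (xlin (c^-1 *: (B *m a)) k w - elin (c^-1 *: a) k w); lra.
  - by rewrite /sqnorm; under eq_bigr do rewrite mxE.
have F4 : 0 <= 4 * failure by rewrite mulr_ge0.
have F7 : 0 <= 7 * failure by rewrite mulr_ge0.
apply: fails_le_imp (fails_le_and (fails_le_forall F4 Hall)
  (fails_le_and (fails_le_forall F7 Hact) (fails_le_operator_norm lam0 Slam))).
  have p1 : 1 <= p%:R :> R by rewrite (ler_nat R 1) (leq_trans n_gt0).
  have pA : #|active B|%:R <= p%:R :> R.
    by rewrite ler_nat -[leqRHS](card_ord p); exact: max_card.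
  rewrite cardsT card_ord.
  have := ler_wpM2r F0 p1; have := ler_wpM2r F0 pA; lra.
move=> w [hall [hact hop]].
(* Centering costs at most n eta^2 = n r / 8 <= n / 8 of the n / 2 in [Qall], so n / 4 remains with
   room to spare. *)
have XL j : c3 * (n%:R / 4) <= cdot (col j (X w)) (col j (X w)).
  have [s1 [_ s2]] := hall j (finset.in_setT j).
  rewrite col_coord_dir// cdot_affine// -expr2 sqr_sqrtr ?(ltW (Sj j))//.
  apply: ler_pM; rewrite ?(ltW c30) ?divr_ge0 ?(ltW n0)//.
  have vE : \sum_k (\col_k xlin (coord_dir j) k w) k 0 = \sum_k xlin (coord_dir j) k w.
    by apply: eq_bigr => k _; rewrite mxE.
  rewrite /cdot vE; under eq_bigr do rewrite mxE -expr2.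
  move: s1 s2; set z := \sum_k xlin (coord_dir j) k w => s1 s2.
  suff : n%:R^-1 * z * z <= n%:R / 8 by have := n0; lra.
  have : z ^+ 2 <= (n%:R * eta) ^+ 2.
    rewrite -(real_normK (num_real z)) ler_sqr ?nnegrE//.
    by rewrite mulr_ge0 ?sqrtr_ge0// ltW.
  rewrite exprMn eta2 => zn; rewrite -mulrA ler_pdivrMl// -expr2 (le_trans zn)//.
  have : n%:R ^+ 2 * r <= n%:R ^+ 2 * 1 :> R by rewrite ler_wpM2l// sqr_ge0.
  by lra.
have L0 : 0 <= 416 * p%:R * lam by exact: mulr_ge0 (mulr_ge0 (ler0n _ _) (ler0n _ _)) (ltW lam0).
move: (416 * p%:R * lam) L0 hop HD => L L0 hop HD.
have c3n : 0 < c3 * (n%:R / 4) by rewrite mulr_gt0// divr_gt0.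
apply/fintype.subsetP => i iA.
apply: (top_indicesP _ _ _ (sum_sqr_cancor_le _ n_gt0 m_gt0 L0 c3n hop XL) HD).
- by rewrite divr_gt0.
- by move=> j; exact: cancor_ge0.
- by apply: hact => //; exact: hall.
Qed.

End FixedSampleSize.

(** * Measurability *)

Section Measurability.
Context (R : realType).

(** Numerator minus c times denominator: free of division, hence continuous in [a] even where the
    quotient is degenerate. *)
Definition cancor_gap n m (Y : 'M[R]_(n, m)) (x : 'cV[R]_n) (c : R) (a : 'cV[R]_m) : R :=
  \sum_k (center_cols Y *m a) k 0 * center_cols x k 0
  - c * Num.sqrt ((\sum_k (center_cols Y *m a) k 0 ^+ 2) * sqnorm (center_cols x)).

(** A vanishing denominator is harmless in both directions: the quotient is then 0 and cannot exceed
    c >= 0, and the numerator vanishes by Cauchy-Schwarz, so the gap is not positive. *)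
Lemma cancor_gtP n m (Y : 'M[R]_(n, m)) (x : 'cV[R]_n) (c : R) :
  (0 < n)%N -> (0 < m)%N -> 0 <= c ->
  c < cancor Y x <-> exists a : 'cV[R]_m, 0 < cancor_gap Y x c a.
Proof.
move=> n0 m0 c0.
have gapE a : cancor_gap Y x c a = cdot (Y *m a) x
    - c * Num.sqrt (cdot (Y *m a) (Y *m a) * cdot x x).
  by rewrite /cancor_gap -!center_dotE// -dotE center_colsM -!sqnormE.
split => [|[a]]; rewrite ?gapE.
  move=> /(@sup_gt _ _ c)[]; first by have [a a0] := exists_nonzero_col R m0; eexists; exists a.
  move=> _ [a a0 <-]; rewrite cancor_quotientE// => h; exists a; rewrite gapE subr_gt0.
  have [d0|d0] := eqVneq (Num.sqrt (cdot (Y *m a) (Y *m a) * cdot x x)) 0.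
    by move: h; rewrite d0 invr0 mulr0 => /(le_lt_trans c0); rewrite ltxx.
  by rewrite -ltr_pdivlMr// lt_neqAle eq_sym d0 sqrtr_ge0.
rewrite subr_gt0 => h.
have [d0|d0] := eqVneq (Num.sqrt (cdot (Y *m a) (Y *m a) * cdot x x)) 0.
  have : cdot (Y *m a) x ^+ 2 <= cdot (Y *m a) (Y *m a) * cdot x x.
    by rewrite -!center_dotE// -!sqnormE; exact: dot_cauchy_schwarz.
  have D0 : 0 <= cdot (Y *m a) (Y *m a) * cdot x x by rewrite mulr_ge0// cdot_ge0.
  move/eqP: d0 (d0) => /[!sqrtr_eq0] d1 d0; move=> /le_trans/(_ d1).
  rewrite d0 mulr0 in h.
  by rewrite leNgt exprn_gt0.
have a0 : a != 0.
  apply: contra_neq d0 => ->; rewrite mulmx0.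
  have -> : cdot (0 : 'cV[R]_n) 0 = 0.
    have S0 : \sum_k (0 : 'cV[R]_n) k 0 = 0 by apply: big1 => k _; rewrite mxE.
    rewrite /cdot S0 mulr0 subr0; apply: big1 => k _; rewrite mxE mul0r//.
  by rewrite mul0r sqrtr0.
apply: lt_le_trans (cancor_has_sup Y x n0 a0).
by rewrite ltr_pdivlMr// lt_neqAle eq_sym d0 sqrtr_ge0.
Qed.

Lemma cancor_gap_continuous n m (Y : 'M[R]_(n, m)) (x : 'cV[R]_n) (c : R) :
  continuous (cancor_gap Y x c : 'cV[R]_m -> R).
Proof.
have csum q (f : 'I_q -> 'cV[R]_m -> R) : (forall k, continuous (f k)) ->
    continuous (fun a => \sum_k f k a).
  by move=> cf; apply: continuous_big => //; exact: add_continuous.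
have cM (f g : 'cV[R]_m -> R) : continuous f -> continuous g ->
    continuous (fun a => f a * g a).
  by move=> cf cg a; exact: (cvgM (cf a) (cg a)).
have cC (e : R) : continuous (fun _ : 'cV[R]_m => e) by exact: cst_continuous.
have clin k : continuous (fun a : 'cV[R]_m => (center_cols Y *m a) k 0 : R).
  rewrite (_ : (fun _ => _) = (fun a : 'cV[R]_m => \sum_j center_cols Y k j * a j 0));
    last by apply/funext => b; rewrite mxE.
  by apply: csum => j; apply: (cM (fun=> center_cols Y k j) (fun a => a j 0)); [exact: cC|exact: coord_continuous].
have c1 : continuous (fun a : 'cV[R]_m => \sum_k (center_cols Y *m a) k 0 * center_cols x k 0).
  by apply: csum => k; apply: (cM _ (fun=> center_cols x k 0)); [exact: clin|exact: cC].
have c2 : continuous (fun a : 'cV[R]_m => \sum_k (center_cols Y *m a) k 0 ^+ 2).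
  by apply: csum => k; apply: (cM _ _ (clin k) (clin k)).
have c3 := cM _ _ c2 (cC (sqnorm (center_cols x))).
have c4 : continuous (fun a : 'cV[R]_m => Num.sqrt
    ((\sum_k (center_cols Y *m a) k 0 ^+ 2) * sqnorm (center_cols x))).
  by move=> a; apply: (continuous_comp (c3 a)); exact: sqrt_continuous.
have c5 := cM _ _ (cC c) c4.
by move=> a; exact: (cvgB (c1 a) (c5 a)).
Qed.

Lemma cancor_gap_rat n m (Y : 'M[R]_(n, m)) (x : 'cV[R]_n) (c : R) (a : 'cV[R]_m) :
  0 < cancor_gap Y x c a ->
  exists q : 'cV[rat]_m, 0 < cancor_gap Y x c (map_mx ratr q).
Proof.
move=> a0; have := @cancor_gap_continuous n m Y x c a.
move=> /(_ [set y | 0 < y]) /(_ (open_nbhs_nbhs (conj (@open_gt R 0) a0))).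
move=> /nbhs_ballP[e /= e0 he].
have /choice[q qP] : forall j : 'I_m, exists q : rat, ball (a j 0) e (ratr q : R).
  move=> j; have [|q] := @rat_in_itvoo R (a j 0) (a j 0 + e); first by rewrite ltrDl.
  rewrite in_itv/= => /andP[q1 q2]; exists q.
  by rewrite /ball/= distrC gtr0_norm ?subr_gt0// ltrBlDl.
exists (\col_j q j); apply: he; split => // i j; rewrite [j]ord1 !mxE; exact: qP.
Qed.

Context (d : measure_display) (T : measurableType d).

(** A positive gap persists near [a], hence at a rational vector; so each set where [cancor] exceeds
    c >= 0 is a countable union of measurable sets. For c < 0 it is the whole space. *)
Lemma measurable_cancor n m (Y : T -> 'M[R]_(n, m)) (x : T -> 'cV[R]_n) :
  (0 < n)%N -> (0 < m)%N ->
  (forall k j, measurable_fun setT (fun w => Y w k j)) ->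
  (forall k, measurable_fun setT (fun w => x w k 0)) ->
  measurable_fun setT (fun w => cancor (Y w) (x w)).
Proof.
move=> n0 m0 mY mx.
have mcY k j : measurable_fun setT (fun w => center_cols (Y w) k j).
  under eq_fun do rewrite center_colsE.
  by apply: measurable_funB => //; apply: measurable_funM => //; apply: measurable_sum.
have mcx k : measurable_fun setT (fun w => center_cols (x w) k 0).
  under eq_fun do rewrite center_colsE.
  by apply: measurable_funB => //; apply: measurable_funM => //; apply: measurable_sum.
have mgap c a : measurable_fun setT (fun w => cancor_gap (Y w) (x w) c a).
  have mYa k : measurable_fun setT (fun w => (center_cols (Y w) *m a) k 0).
    under eq_fun do rewrite mxE; apply: measurable_sum => j.
    exact: measurable_funM.
  apply: measurable_funB; first by apply: measurable_sum => k; exact: measurable_funM.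
  apply: measurable_funM => //.
  apply: measurableT_comp; first by apply: continuous_measurable_fun; exact: sqrt_continuous.
  by apply: measurable_funM; apply: measurable_sum => k; exact: measurable_funX.
move=> _; apply: (measurability _ (RGenOInfty.measurableE R)) => //.
move=> _ [_ [c ->] <-]; rewrite setTI.
have [c0|c0] := ltP c 0.
  rewrite (_ : _ @^-1` _ = setT)//; apply/seteqP; split => w //= _.
  by rewrite in_itv/= andbT (lt_le_trans c0)// cancor_ge0.
rewrite (_ : _ @^-1` _ = \bigcup_(q : 'cV[rat]_m)
    [set w | 0 < cancor_gap (Y w) (x w) c (map_mx ratr q)]).
  apply: countable_bigcupT_measurable => [|q]; first exact: countableP.
  rewrite (_ : [set w | _] = (fun w => cancor_gap (Y w) (x w) c (map_mx ratr q)) @^-1` `]0, +oo[).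
    by rewrite -[_ @^-1` _]setTI; exact: mgap.
  by apply/seteqP; split => w; rewrite /= in_itv/= andbT.
apply/seteqP; split => w; rewrite /= in_itv/= andbT.
  by move=> /(cancor_gtP _ _ n0 m0 c0)[a /cancor_gap_rat[q hq]]; exists q.
by move=> [q _ hq]; apply/(cancor_gtP _ _ n0 m0 c0); exists (map_mx ratr q).
Qed.

(** For a fixed index the number of strictly larger values is a finite sum of indicators of
    measurable events. *)
Lemma measurable_top_indices p (om : T -> 'I_p -> R) (D : nat) (A : {set 'I_p}) :
  (forall j, measurable_fun setT (fun w => om w j)) ->
  measurable [set w | A \subset top_indices (om w) D].
Proof.
move=> mom.
have -> : [set w | A \subset top_indices (om w) D] =
    \bigcap_(i in [set` A]) [set w | i \in top_indices (om w) D].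
  apply/seteqP; split => w /= h.
    by move=> i /= iA; exact: (fintype.subsetP h).
  by apply/fintype.subsetP => i iA; exact: h.
apply: fin_bigcap_measurable; first exact: finite_finset.
move=> i _.
pose b k := [set w | `|om w i| < `|om w k|].
have mb k : measurable (b k).
  rewrite (_ : b k = (fun w => `|om w i| < `|om w k|) @^-1` [set true]); last first.
    by apply/seteqP; split => w.
  rewrite -[_ @^-1` _]setTI; apply: measurable_fun_ltr => //; exact: measurableT_comp.
have cardE w : #|[set k | `|om w i| < `|om w k|]%SET|%:R = \sum_k \1_(b k) w :> R.
  rewrite -sum1_card natr_sum big_mkcond/=; apply: eq_bigr => k _.
  rewrite inE indicE; case: ifPn => h; first by rewrite mem_set.
  by rewrite memNset//=; exact/negP.
rewrite (_ : [set w | _] = (fun w => \sum_k \1_(b k) w) @^-1` `]-oo, (D%:R : R)[).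
  rewrite -[_ @^-1` _]setTI; apply: (@measurable_sum _ _ R) => // k.
  exact: measurable_indic.
by apply/seteqP; split => w; rewrite /= in_itv/= inE -(ltr_nat R) cardE.
Qed.

End Measurability.

(** * Sure screening *)

Lemma measurable_screened (R : realType) (d : measure_display) (T : measurableType d)
    (P : probability T R) (n p m : nat)
    (X : T -> 'M[R]_(n, p)) (E : T -> 'M[R]_(n, m)) (B : 'M[R]_(p, m))
    (mu : 'rV[R]_p) (nu : 'rV[R]_m) (Sx : 'M[R]_p) (S : 'M[R]_m) (A : {set 'I_p})
    (delta : R) :
  (0 < n)%N -> (0 < m)%N ->
  (forall i : 'I_n, mvgaussian P (fun w => row i (X w)) mu Sx) ->
  (forall i : 'I_n, mvgaussian P (fun w => row i (E w)) nu S) ->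
  measurable [set w | A \subset screened (X w) (X w *m B + E w) delta].
Proof.
move=> n0 m0 gX gE.
have mX (k : 'I_n) j : measurable_fun setT (fun w => X w k j).
  by have [_ /(_ j) + _] := gX k; under eq_fun do rewrite mxE.
have mE (k : 'I_n) j : measurable_fun setT (fun w => E w k j).
  by have [_ /(_ j) + _] := gE k; under eq_fun do rewrite mxE.
apply: measurable_top_indices => j; apply: measurable_cancor => //.
  move=> k l; under eq_fun do rewrite mxE [X in X + _]mxE.
  apply: measurable_funD => //; apply: measurable_sum => q.
  exact: measurable_funM.
by move=> k; under eq_fun do rewrite mxE; exact: mX.
Qed.

(** Normalizes the signal condition: dividing the test direction by [c] makes both variances at most
    1 and turns the signal into r = h / c. The counting inequality is requested only when r <= 1,
    which is derived here. *)
Lemma sure_screening_fixed_size (R : realType) (d : measure_display) (T : measurableType d)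
    (P : probability T R) (n p m : nat)
    (X : T -> 'M[R]_(n, p)) (E Y : T -> 'M[R]_(n, m)) (B : 'M[R]_(p, m))
    (mu : 'rV[R]_p) (Sx : 'M[R]_p) (S : 'M[R]_m) (delta lam c3 c h : R) :
  (0 < n)%N -> (0 < m)%N -> (n <= p)%N ->
  (forall w, Y w = X w *m B + E w) ->
  (forall i : 'I_n, mvgaussian P (fun w => row i (X w)) mu Sx) ->
  (forall i : 'I_n, mvgaussian P (fun w => row i (E w)) 0 S) ->
  independent_rows P X E ->
  0 < lam -> lambda_max Sx <= lam -> 0 < c3 -> c3 <= min_diag Sx -> 0 < c -> 0 < h ->
  (forall i : 'I_p, i \in active B -> exists a : 'cV[R]_m,
     [/\ l2norm a = 1,
         Num.max (l2norm (mxsqrt Sx *m B *m a)) (l2norm (mxsqrt S *m a)) <= c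
       & h <= `|((delta_mx 0 i : 'rV_p) *m Sx *m B *m a) 0 0| * (Num.sqrt (Sx i i))^-1]) ->
  (h / c <= 1 -> 416 * p%:R * lam * m%:R / (c3 * (n%:R / 4)) <
     (Num.truncn (delta * p%:R))%:R * (h / c / 32) ^+ 2) ->
  1 - fine (P [set w | active B \subset screened (X w) (Y w) delta]) <=
    12 * p%:R * expR (- (n%:R * (h / c) ^+ 2 / (16 * bernstein_const R))).
Proof.
move=> n0 m0 np YE gX gE ind lam0 Slam c30 c3S c0 h0 cond2 HD.
(* Without active predictors the event is certain; otherwise [i0] will force r <= 1. *)
have [act0|[i0 i0A]] := set_0Vmem (active B).
  rewrite (_ : [set w | _] = setT).
    rewrite (_ : fine _ = 1) ?subrr ?mulr_ge0 ?expR_ge0//.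
    by have -> : P setT = 1%:E by exact: probability_setT.
  by apply/seteqP; split => w //= _; rewrite act0 finset.sub0set.
have [psdX mX _] := gX (Ordinal n0); have [psdS _ _] := gE (Ordinal n0).
have c3j j : c3 <= Sx j j by exact: le_min_diag.
have Sj j : 0 < Sx j j by exact: lt_le_trans (c3j j).
have act i : i \in active B -> exists (c' : R) (a : 'cV[R]_m),
     [/\ 0 < c', a != 0, quad Sx (c'^-1 *: (B *m a)) <= 1, quad S (c'^-1 *: a) <= 1
       & h / c <= ((c'^-1 *: (B *m a))^T *m Sx *m coord_dir Sx i) 0 0].
  move=> iA; have [a [a1 aXE cov]] := cond2 i iA.
  move: aXE; rewrite ge_max => /andP[aX aE].
  have a0 : a != 0.
    apply: contra_eq_neq a1 => ->; rewrite /l2norm big1 ?sqrtr0 1?eq_sym ?oner_eq0// => k _.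
    by rewrite mxE expr0n.
  (* The sign of the covariance is moved into the test direction, which removes the absolute
     value. *)
  pose s : R := (-1) ^+ (((delta_mx 0 i : 'rV_p) *m Sx *m B *m a) 0 0 < 0)%R.
  have s2 : s ^+ 2 = 1 by exact: sqrr_sign.
  have s0 : s != 0 by rewrite signr_eq0.
  have q1 q (A : 'M[R]_q) b : quad A b <= c ^+ 2 -> quad A (c^-1 *: (s *: b)) <= 1.
    by move=> hb; rewrite !quadZ s2 mul1r exprVn mulrC ler_pdivrMr ?exprn_gt0// mul1r.
  exists c, (s *: a); split => //.
  - by rewrite scaler_eq0 negb_or s0.
  - rewrite -scalemxAr; apply: q1.
    by rewrite /quad -sqr_l2norm_mxsqrt// mulmxA ler_sqr ?nnegrE ?sqrtr_ge0// ltW.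
  - by apply: q1; rewrite /quad -sqr_l2norm_mxsqrt// ler_sqr ?nnegrE ?sqrtr_ge0// ltW.
  have biE (k l : R) (v : 'cV[R]_p) : ((k *: v)^T *m Sx *m (l *: (delta_mx i 0 : 'cV_p))) 0 0 =
      k * l * (((delta_mx 0 i : 'rV_p) *m Sx *m v) 0 0).
    have tZ : (k *: v)^T = k *: v^T by apply/matrixP => x y; rewrite !mxE.
    rewrite tZ -!scalemxAl -scalemxAr scalerA [LHS]mxE; congr (_ * _).
    have [Sxt _] := psdX.
    transitivity ((v^T *m Sx *m (delta_mx i 0 : 'cV_p))^T 0 0); first by rewrite [RHS]mxE.
    by rewrite !trmx_mul trmxK trmx_delta Sxt mulmxA.
  rewrite -[B *m (s *: a)]scalemxAr scalerA /coord_dir biE mulmxA /s.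
  move: cov; move: (_ 0 0) (Num.sqrt _) => x sg cov.
  have -> : c^-1 * (-1) ^+ (x < 0)%R / sg * x = ((-1) ^+ (x < 0)%R * x) / sg / c by ring.
  by rewrite -normrEsign ler_pM2r ?invr_gt0.
(* The signal is a covariance of two linear forms of variance at most 1. *)
have r1 : h / c <= 1.
  have [c' [a [_ _ qa _ hr]]] := act i0 i0A.
  have hc : 0 < h / c by rewrite divr_gt0.
  have : (h / c) ^+ 2 <= 1.
    apply: (@le_trans _ _ (((c'^-1 *: (B *m a))^T *m Sx *m coord_dir Sx i0) 0 0 ^+ 2)).
      by rewrite ler_sqr ?nnegrE ?(ltW hc)// (le_trans _ hr)// ltW.
    apply: le_trans (psd_cauchy_schwarz _ _ psdX) _.
    by rewrite -!/(quad _ _) quad_coord_dir// mulr1.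
  by rewrite expr_le1// ltW.
have r01 : 0 < h / c <= 1 by rewrite divr_gt0.
have Slam' a : quad Sx a <= lam * sqnorm a.
  have [Sxt _] := psdX; apply: le_trans (quad_le_lambda_max a Sxt) _.
  by rewrite ler_wpM2r// sqnorm_ge0.
apply: fails_le_measurable.
  rewrite (_ : [set w | _] = [set w | active B \subset screened (X w) (X w *m B + E w) delta]).
    exact: (measurable_screened B _ delta n0 m0 gX gE).
  by apply/seteqP; split => w /=; rewrite YE.
have H := fails_le_screening gX gE ind n0 m0 np r01 lam0 Slam' c30 c3j act (HD r1).
apply: (fails_le_imp (lexx _) _ H) => w.
by rewrite /screened YE.
Qed.

(** * Constants and exponents as n grows *)

Lemma half_le_truncn (R : realType) (x : R) : 2 <= x -> x / 2 <= (Num.truncn x)%:R.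
Proof.
move=> x2; have := truncnS_gt x; rewrite -natr1 => H; lra.
Qed.

(* The arguments [q], [tt], [ss], [ta], [r] stand for [n ^ (2 kappa + 2 u)],
   [n ^ t], [n ^ s], [n ^ tau] and [c7 n ^ (- kappa) / (c6 n ^ u)]. *)
Lemma selected_count_bound (R : realType) (delta N p q tt ss ta M Cm K c1 c3 rho r A : R) :
  0 < N -> N <= p -> 0 < q -> 1 <= tt -> 1 <= ss -> 1 <= ta ->
  0 <= M -> M <= Cm * ss -> 0 < c1 -> 0 < c3 -> 0 < A ->
  0 < K -> 0 < rho -> 2 <= K * rho ^+ 2 ->
  8 * 1024 * A * c1 * Cm / c3 < K * rho ^+ 2 ->
  K <= delta * (N / (q * tt * ss * ta)) -> 0 <= r -> r ^+ 2 * q = rho ^+ 2 -> r <= 1 ->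
  A * p * (c1 * ta) * M / (c3 * (N / 4)) <
    (Num.truncn (delta * p))%:R * (r / 32) ^+ 2.
Proof.
move=> N0 Np q0 tt1 ss1 ta1 M0 Mb c10 c30 A0 K0 rho0 K2 KA Kd r0 rq r1.
have p0 : 0 < p := lt_le_trans N0 Np.
have tt0 : 0 < tt by exact: lt_le_trans tt1.
have ss0 : 0 < ss by exact: lt_le_trans ss1.
have ta0 : 0 < ta by exact: lt_le_trans ta1.
have qrho : 0 < r ^+ 2 * q by rewrite rq exprn_gt0.
(* Here r <= 1 enters: it gives K q >= K rho^2 >= 2, hence delta p >= 2, so that the integer part
   keeps at least half of delta p. *)
have qge : rho ^+ 2 <= q.
  by rewrite -rq ler_piMl ?(ltW q0)// expr_le1.
have r_gt0 : 0 < r.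
  by rewrite lt_neqAle r0 andbT; apply: contraTneq qrho => <-; rewrite expr0n mul0r ltxx.
have Dge : K * (q * tt * ss * ta) / N * p <= delta * p.
  rewrite ler_pM2r// ler_pdivrMr// -ler_pdivlMr ?mulr_gt0//.
  by rewrite -mulrA.
have tsta1 : 1 <= tt * ss * ta.
  by rewrite !mulr_ege1.
have D2 : 2 <= delta * p.
  apply: le_trans Dge; apply: (le_trans K2).
  have -> : K * (q * tt * ss * ta) / N * p = K * q * (tt * ss * ta) * (p / N) by ring.
  rewrite -[K * rho ^+ 2]mulr1; apply: ler_pM => //.
  - by rewrite mulr_ge0 ?sqr_ge0 ?ltW.
  - rewrite -[leLHS]mulr1; apply: ler_pM => //.
      by rewrite mulr_ge0 ?sqr_ge0 ?ltW.
    by rewrite ler_pM2l.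
  - by rewrite ler_pdivlMr// mul1r.
have := half_le_truncn D2.
move: (Num.truncn _) => D HD.
have DK : K * (q * tt * ss * ta) / N * p / 2 <= D%:R.
  by apply: le_trans HD; rewrite ler_pM2r ?invr_gt0.
apply: (@lt_le_trans _ _ (K * (q * tt * ss * ta) / N * p / 2 * (r / 32) ^+ 2)); last first.
  by rewrite ler_pM2r// exprn_gt0// divr_gt0.
have -> : K * (q * tt * ss * ta) / N * p / 2 * (r / 32) ^+ 2 =
  K * (r ^+ 2 * q) * tt * (ss * ta * p / N / 2048).
  by field; rewrite gt_eqF.
rewrite rq.
have -> : A * p * (c1 * ta) * M / (c3 * (N / 4)) =
    (4 * A * c1 / c3 * M) * (p * ta / N).
  by field; rewrite !gt_eqF.
apply: (@le_lt_trans _ _ ((4 * A * c1 / c3 * (Cm * ss)) * (p * ta / N))).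
  apply: ler_wpM2r; first by rewrite divr_ge0 ?mulr_ge0 ?ltW.
  by apply: ler_wpM2l => //; rewrite divr_ge0 ?mulr_ge0 ?ltW.
(* 8 * 1024 = 4 * 2048: the 4 comes from n / 4, and 2048 = 2 * 32^2 from the halved integer part and
   the level r / 32. *)
have -> : (4 * A * c1 / c3 * (Cm * ss)) * (p * ta / N) =
   (8 * 1024 * A * c1 * Cm / c3) * (ss * ta * p / N / 2048).
  by field; rewrite !gt_eqF.
have S0 : 0 < ss * ta * p / N / 2048 by apply: divr_gt0; [rewrite divr_gt0 ?mulr_gt0 | rewrite ltr0n].
rewrite ltr_pM2r//; apply: (lt_le_trans KA).
by rewrite ler_peMr// mulr_ge0 ?sqr_ge0 ?ltW.
Qed.

Lemma near_le_powR (R : realType) (e M : R) : 0 < e ->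
  \forall n \near \oo, M <= n%:R `^ e.
Proof.
move=> e0; pose N := Order.max 1 M.
have N0 : 0 < N by rewrite lt_max ltr01.
near=> n.
apply: (@le_trans _ _ N); first by rewrite le_max lexx orbT.
rewrite [leLHS](_ : N = (N `^ e^-1) `^ e); last first.
  by rewrite -powRrM mulVf ?lt0r_neq0// powRr1// ltW.
apply: ge0_ler_powR; rewrite ?nnegrE ?powR_ge0 ?ler0n ?(ltW e0)//.
by near: n; exact: nbhs_infty_ger.
Unshelve. all: by end_near. Qed.

(** Half of the exponent absorbs the factor p; the other half is kept and divided by L >= 1, which
    is ln n in the application. *)
Lemma mul_expR_le_half (R : realType) (a p L x : R) :
  0 < p -> 0 <= x -> 0 < a -> ln p <= a / 2 * x -> 1 <= L ->
  p * expR (- (a * x)) <= expR (- (a / 2) * x / L).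
Proof.
move=> p0 x0 a0 lnp L1.
rewrite -{1}(lnK p0) -expRD ler_expR.
apply: (@le_trans _ _ (- (a / 2 * x))); first by lra.
rewrite mulNr mulNr lerN2 ler_pdivrMr; last by exact: lt_le_trans L1.
by rewrite ler_peMr// mulr_ge0// divr_ge0// ltW.
Qed.

(** Each n has its own probability space. The dimensions satisfy 0 < m < n, which forces n >= 2, so
    the conditions are imposed from there on. *)
Theorem theorem5 (R : realType)
  (p m : nat -> nat)
  (d : nat -> measure_display) (T : forall n, measurableType (d n))
  (P : forall n, probability (T n) R)
  (X : forall n, T n -> 'M[R]_(n, p n))
  (E : forall n, T n -> 'M[R]_(n, m n))
  (Y : forall n, T n -> 'M[R]_(n, m n))
  (B : forall n, 'M[R]_(p n, m n))
  (mu : forall n, 'rV[R]_(p n))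
  (Sx : forall n, 'M[R]_(p n)) (S : forall n, 'M[R]_(m n))
  (delta : nat -> R)
  (t tau kappa u s ppi c1 c2 c3 c4 c5 c6 c7 c9 : R)
  (iota := 2 * kappa + 2 * u + t + s)
  (* setting *)
  (dims : forall n, (1 < n)%N -> [/\ (0 < m n)%N, (m n < n)%N & (n < p n)%N])
  (model : forall n (w : T n), Y n w = X n w *m B n + E n w)
  (delta01 : forall n, (1 < n)%N -> 0 < delta n < 1)
  (* Condition 1 *)
  (t_ge0 : 0 <= t) (tau_ge0 : 0 <= tau)
  (c1_gt0 : 0 < c1) (c2_gt0 : 0 < c2) (c3_gt0 : 0 < c3)
  (c4_gt0 : 0 < c4) (c5_gt0 : 0 < c5)
  (gaussX : forall n, (1 < n)%N -> forall i : 'I_n,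
     mvgaussian (P n) (fun w => row i (X n w)) (mu n) (Sx n))
  (gaussE : forall n, (1 < n)%N -> forall i : 'I_n,
     mvgaussian (P n) (fun w => row i (E n w)) 0 (S n))
  (indep : forall n, (1 < n)%N -> independent_rows (P n) (X n) (E n))
  (cond1 : forall n, (1 < n)%N ->
     [/\ lambda_max (Sx n) <= c1 * n%:R `^ tau,
         c2 * n%:R `^ (- t) <= lambda_min (S n),
         c3 <= min_diag (Sx n),
         max_diag (S n) <= c4
       & max_diag ((B n)^T *m Sx n *m B n) <= c5])
  (* Condition 2 *)
  (c6_gt0 : 0 < c6) (c7_gt0 : 0 < c7)
  (cond2 : forall n, (1 < n)%N -> forall i : 'I_(p n), i \in active (B n) ->
     exists a : 'cV[R]_(m n),
       [/\ l2norm a = 1,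
           Num.max (l2norm (mxsqrt (Sx n) *m B n *m a))
                   (l2norm (mxsqrt (S n) *m a)) <= c6 * n%:R `^ u
         & c7 * n%:R `^ (- kappa) <=
           `|((delta_mx 0 i : 'rV_(p n)) *m Sx n *m B n *m a) 0 0|
             * (Num.sqrt (Sx n i i))^-1])
  (* Condition 3 *)
  (s01 : 0 <= s < 1)
  (m_bigO : (fun n => (m n)%:R : R^o) =O_\oo (fun n => n%:R `^ s : R^o))
  (iota_tau : iota + tau < 1)
  (c9_gt1 : 1 < c9)
  (p_gt : forall n, (1 < n)%N -> c9 * n%:R < (p n)%:R)
  (ppi_bounds : 0 < ppi < 1 - 2 * kappa - 2 * u - t - s)
  (p_bigO : (fun n => ln (p n)%:R : R^o) =O_\oo (fun n => n%:R `^ ppi : R^o))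
  (delta_lim : (fun n => delta n * n%:R `^ (1 - iota - tau)) @ \oo --> +oo) :
  exists2 c0 : R, 0 < c0 &
    (fun n => 1 - fine (P n [set w | active (B n)
                               \subset screened (X n w) (Y n w) (delta n)])
       : R^o)
    =O_\oo (fun n => expR (- c0 * n%:R `^ (1 - iota) / ln n%:R) : R^o).
Proof.
have C16 := bernstein_const_ge16 R.
have C0 : 0 < bernstein_const R by apply: lt_le_trans C16; rewrite ltr0n.
(* r_n = rho n^(- kappa - u), so the failure exponent is a n^(1 - 2 kappa - 2 u). *)
pose rho := c7 / c6; pose a := rho ^+ 2 / (16 * bernstein_const R).
have rho0 : 0 < rho by rewrite divr_gt0.
have a0 : 0 < a by rewrite divr_gt0 ?exprn_gt0// mulr_gt0// ltr0n.
exists (a / 2); first by rewrite divr_gt0.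
move/eqO_exP: m_bigO => [Cm Cm0 mO]; move/eqO_exP: p_bigO => [Cp Cp0 pO].
have [A A0 AE] : exists2 A : R, 0 < A & A = 416 by exists 416; [lra|].
have [J J0 JE] : exists2 J : R, 0 < J & J = 8 * 1024 * A by exists (8 * 1024 * A); [lra|].
pose Q : R := J * c1 * Cm / c3.
have Q0 : 0 < Q by rewrite divr_gt0// mulr_gt0// mulr_gt0.
(* delta n^(1 - iota - tau) eventually exceeds any constant. With this one K rho^2 = Q + 2, which is
   both at least 2 and larger than [Q], as [selected_count_bound] asks. *)
pose K := (Q + 2) / rho ^+ 2.
have rho20 : 0 < rho ^+ 2 by rewrite exprn_gt0.
have K0 : 0 < K by rewrite divr_gt0// addr_gt0// ltr0n.
have KE : K * rho ^+ 2 = Q + 2 by rewrite divfK// gt_eqF.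
(* This gap makes ln p = O(n^ppi) negligible against n^(1 - iota). *)
have e0 : 0 < 1 - iota - ppi by rewrite /iota; case/andP: ppi_bounds; lra.
have [s0 _] := andP s01.
apply/eqO_exP; exists 12; first by rewrite ltr0n.
near=> n.
have n3 : (2 < n)%N by near: n; exact: nbhs_infty_gt.
have n1 : (1 < n)%N by exact: ltn_trans n3.
have n0 : (0 < n)%N by exact: ltn_trans n1.
have N0 : 0 < n%:R :> R by rewrite ltr0n.
have N1 : 1 <= n%:R :> R by rewrite ler1n.
have [m0 mn np] := dims n n1.
have [S1 _ S3 _ _] := cond1 n n1.
have powD x y : n%:R `^ (x + y) = n%:R `^ x * n%:R `^ y :> R.
  by rewrite powRD//; apply/implyP => _; rewrite gt_eqF.
have pow0 x : 0 < n%:R `^ x :> R by exact: powR_gt0.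
have pow1 x : 0 <= x -> 1 <= n%:R `^ x :> R.
  by move=> x0; rewrite -[leLHS](powRr0 n%:R) ler_powR.
have mle : (m n)%:R <= Cm * n%:R `^ s.
  suff : `|(m n)%:R : R^o| <= Cm * `|n%:R `^ s : R^o| by rewrite !ger0_norm// ltW.
  by near: n.
have lnp : ln (p n)%:R <= Cp * n%:R `^ ppi.
  suff : `|ln (p n)%:R : R^o| <= Cp * `|n%:R `^ ppi : R^o|.
    by move=> H; apply: (le_trans (ler_norm _)); apply: (le_trans H); rewrite ger0_norm// ltW.
  by near: n.
have Kle : K <= delta n * n%:R `^ (1 - iota - tau).
  by near: n; move/cvgryPge: delta_lim; exact.
have a20 : 0 < a / 2 by rewrite divr_gt0.
have lnp2 : ln (p n)%:R <= a / 2 * n%:R `^ (1 - iota).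
  apply: (le_trans lnp).
  rewrite (_ : 1 - iota = (1 - iota - ppi) + ppi); last by rewrite subrK.
  rewrite powD mulrA ler_pM2r// -ler_pdivrMl ?a20//.
  by near: n; exact: near_le_powR.
have lnn : 1 <= ln n%:R :> R.
  rewrite -[leLHS]expRK ler_ln ?posrE ?expR_gt0//.
  by near: n; exact: nbhs_infty_ger.
set c := c6 * n%:R `^ u; set h := c7 * n%:R `^ (- kappa).
have c_0 : 0 < c by rewrite mulr_gt0.
have h_0 : 0 < h by rewrite mulr_gt0.
set q := n%:R `^ (2 * kappa + 2 * u) : R.
have rq : (h / c) ^+ 2 * q = rho ^+ 2.
  rewrite /h /c /q powRN powD !(mulr_natl _ 2) !powD /rho.
  by field; rewrite !gt_eqF.
have q0 : 0 < q by exact: pow0.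
(* The O-estimate bounds an absolute value, so 1 - P >= 0 has to be known; it uses the measurability
   of the event. *)
have P1 : fine (P n [set w | active (B n) \subset screened (X n w) (Y n w) (delta n)]) <= 1.
  have mA := measurable_screened (B n) (active (B n)) (delta n) n0 m0 (gaussX n n1) (gaussE n n1).
  rewrite (_ : [set w | _] = [set w | active (B n) \subset
    screened (X n w) (X n w *m B n + E n w) (delta n)]).
    have := @probability_le1 _ _ _ (P n) _ mA; rewrite -{1}(fineK (fin_num_measure (P n) _ mA)).
    by rewrite lee_fin.
  by apply/seteqP; split => w /=; rewrite model.
suff : 1 - fine (P n [set w | active (B n) \subset screened (X n w) (Y n w) (delta n)]) <=
    12 * expR (- (a / 2) * n%:R `^ (1 - iota) / ln n%:R).
  by move=> H; rewrite !ger0_norm ?subr_ge0 ?expR_ge0.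
apply: (@le_trans _ _ (12 * (p n)%:R * expR (- (n%:R * (h / c) ^+ 2 / (16 * bernstein_const R))))).
  apply: (@sure_screening_fixed_size R _ _ (P n) n (p n) (m n) (X n) (E n) (Y n) (B n)
    (mu n) (Sx n) (S n) (delta n) (c1 * n%:R `^ tau) c3 c h) => //.
  - exact: ltnW.
  - exact: gaussX.
  - exact: gaussE.
  - exact: indep.
  - by rewrite mulr_gt0.
  - exact: cond2.
  move=> r1; rewrite -AE; apply: (@selected_count_bound R (delta n) n%:R (p n)%:R q (n%:R `^ t) (n%:R `^ s)
    (n%:R `^ tau) (m n)%:R Cm K c1 c3 rho (h / c) A) => //.
  - by rewrite ler_nat ltnW.
  - exact: pow1.
  - exact: pow1.
  - exact: pow1.
  - by rewrite KE lerDr ltW.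
  - by rewrite -JE KE ltrDl ltr0n.
  - apply: (le_trans Kle); rewrite le_eqVlt; apply/orP; left; apply/eqP; congr (_ * _).
    by rewrite /q -!powD -{2}[n%:R](powRr1 (ltW N0)) -powRB; [congr (_ `^ _); rewrite /iota; ring|apply/implyP => _; rewrite gt_eqF].
  - by rewrite divr_ge0 ?ltW.
rewrite -mulrA ler_pM2l ?ltr0n//.
(* n r_n^2 = rho^2 n^(1 - 2 kappa - 2 u) >= rho^2 n^(1 - iota), because t and s are nonnegative. *)
apply: (@le_trans _ _ ((p n)%:R * expR (- (a * n%:R `^ (1 - iota))))).
  rewrite ler_pM2l ?ltr0n ?(ltn_trans _ np)// ler_expR lerN2 /a.
  rewrite (_ : rho ^+ 2 / _ * _ = rho ^+ 2 * n%:R `^ (1 - iota) / (16 * bernstein_const R)); last by ring.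
  rewrite ler_pM2r ?invr_gt0 ?mulr_gt0 ?ltr0n//.
  rewrite -rq -mulrA [leRHS]mulrC ler_pM2l ?exprn_gt0 ?divr_gt0//.
  rewrite /q -powD -[leRHS](powRr1 (ltW N0)) ler_powR// /iota; lra.
by apply: mul_expR_le_half => //; rewrite ?ltr0n ?(ltn_trans _ np)// ltW.
Unshelve. all: by end_near. Qed.
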